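(* Let $m\ge1$ be an integer and $f(z)=\sum_{n\ge0}a_nz^{-n/m}\in\mathbb{C}[[z^{-1/m}]]$ a Gevrey-1 series. Assume there exists $\lambda>0$ such that the Borel transform $\widetilde f(\zeta)=\sum_{n\ge1}\frac{a_n\zeta^{n/m-1}}{\Gamma(n/m)}$ extends analytically to $\Omega_\lambda^\star$ and $$\exists A>0,\ \exists B>0,\ \forall\zeta\in\Omega_\lambda^\star:\ |\widetilde f(\zeta)\zeta^{\frac{m-1}{m}}|\le Ae^{B|\zeta|}.$$ Put $a_n^{(\lambda)}=\lambda^{\frac nm-1}a_n$ and define $d_n^{(\lambda)}$, $n\ge1$, recursively by $$d_n^{(\lambda)}=\frac{1}{\Gamma(\frac nm)}\Big(a_n^{(\lambda)}+\sum_{\substack{j\ge1,\ l\ge1\\ l+jm=n}}d_{\frac lm,j}\,a_l^{(\lambda)}\Big),\qquad d_{r,j}=\Big(\sum_{1\le p\le j}\frac{B_{j,p}\big(\frac{1!}{2},\frac{2!}{3},\dots,\frac{i!}{i+1},\dots\big)}{\Gamma(r-p)}\Big)\frac{\Gamma(r+j)}{j!}.$$ Then the generalized factorial series $$a_0+\lambda\sum_{n=1}^{+\infty}\frac{\Gamma(\frac nm)\Gamma(\lambda z)\,d_n^{(\lambda)}}{\Gamma(\lambda z+\frac nm)}$$ converges absolutely for $z\in P(\max(B,1/\lambda))$, and its sum equals the Borel sum $\mathrm{S}_0f(z)=a_0+\int_0^{+\infty}\widetilde f(\zeta)e^{-z\zeta}d\zeta$ there.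
   Context: $\Delta$ is the image of the open disc $D(1,1)=\{s:|s-1|<1\}$ under $s\mapsto-\ln s$ (principal logarithm); $\Delta_\lambda=\{\lambda\zeta:\zeta\in\Delta\}$ and $\Delta_\lambda^\star=\Delta_\lambda\setminus\{0\}$. $\mathbb{C}_m^\star$ is the $m$-sheeted covering of $\mathbb{C}^\star$: points $x=(|x|,\arg x)$, $\arg x\in\mathbb{R}/2\pi m\mathbb{Z}$, projection $\pi(x)=\dot x=|x|e^{i\arg x}$; $|\arg x|$ uses the representative in $]-m\pi,m\pi]$; $x^{k/m}$ has modulus $|x|^{k/m}$ and argument $\frac km\arg x$; complex values are read via the projection. $\Omega_\lambda^\star=\pi^{-1}(\Delta_\lambda^\star)$. $P(B)=\{z\in\mathbb{C}_m^\star:|\arg z|\le\pi/2,\ \Re(\dot z)>B\}$. Gevrey-1 means $|a_n|\le CK^n\Gamma(1+n/m)$. The Laplace integral is along the ray $\arg\zeta=0$. $1/\Gamma$ is the entire reciprocal Gamma function. $B_{j,p}$ are the partial exponential Bell polynomials: $B_{j,p}(x_1,x_2,\dots)=\sum\frac{j!}{\prod_i k_i!(i!)^{k_i}}\prod_i x_i^{k_i}$ over $k_i\ge0$ with $\sum k_i=p$, $\sum ik_i=j$. *)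

(* Defs.v *)
From Stdlib Require Import Reals List Factorial.
From Coquelicot Require Import Coquelicot.
Open Scope R_scope.

Definition Cexp (w : C) : C :=
  (exp (Re w) * cos (Im w), exp (Re w) * sin (Im w)).

(* principal argument in ]-pi, pi] (value 0 at 0, irrelevant) *)
Definition Arg (s : C) : R :=
  let x := Re s in let y := Im s in
  match Rlt_dec 0 x with
  | left _ => atan (y / x)
  | right _ =>
    match Rlt_dec x 0 with
    | left _ => match Rle_dec 0 y with
                | left _ => atan (y / x) + PI
                | right _ => atan (y / x) - PI
                end
    | right _ => match Rlt_dec 0 y with
                 | left _ => PI / 2
                 | right _ => match Rlt_dec y 0 with
                              | left _ => - (PI / 2)
                              | right _ => 0
                              end
                 end
    end
  end.

Definition Cln (s : C) : C := (ln (Cmod s), Arg s).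

Definition in_Delta (lam : R) (zeta : C) : Prop :=
  exists s : C, Cmod (s - 1)%C < 1 /\ zeta = (RtoC lam * (- Cln s))%C.

(* Points of the m-sheeted covering C_m^* are represented in logarithmic
   coordinates w (zeta = "exp w", |zeta| = exp (Re w), arg zeta = Im w),
   w and w + 2 i pi m representing the same point.  Omega_lambda^* in these
   coordinates: *)
Definition Omega_star (lam : R) (w : C) : Prop :=
  in_Delta lam (Cexp w) /\ Cexp w <> RtoC 0.

Definition RGamma (x : R) : R :=
  RInt_gen (fun t => Rpower t (x - 1) * exp (- t))
           (at_right 0) (Rbar_locally p_infty).

Definition CGamma (s : C) : C :=
  (RInt_gen (fun t => exp ((Re s - 1) * ln t) * cos (Im s * ln t) * exp (- t))
            (at_right 0) (Rbar_locally p_infty),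
   RInt_gen (fun t => exp ((Re s - 1) * ln t) * sin (Im s * ln t) * exp (- t))
            (at_right 0) (Rbar_locally p_infty)).

Fixpoint rising (x : R) (k : nat) : R :=
  match k with O => 1 | S k' => rising x k' * (x + INR k') end.

(* entire reciprocal Gamma on the reals: 1/Gamma(x) = (x)_k / Gamma(x+k),
   for any k with x + k > 0 *)
Definition rgamma (x : R) : R :=
  let k := Z.to_nat (up (- x)) in rising x k / RGamma (x + INR k).

Fixpoint lists_bounded (len bound : nat) : list (list nat) :=
  match len with
  | O => nil :: nil
  | S l => flat_map (fun k => map (cons k) (lists_bounded l bound)) (seq 0 (S bound))
  end.

Fixpoint sum_list (ks : list nat) : nat :=
  match ks with nil => O | k :: r => (k + sum_list r)%nat end.

Fixpoint wsum_from (i : nat) (ks : list nat) : nat :=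
  match ks with nil => O | k :: r => (i * k + wsum_from (S i) r)%nat end.

Fixpoint bell_prod_from (i : nat) (x : nat -> R) (ks : list nat) : R :=
  match ks with
  | nil => 1
  | k :: r => x i ^ k / (INR (fact k) * INR (fact i) ^ k) * bell_prod_from (S i) x r
  end.

Definition Rsum_list (l : list R) : R := fold_right Rplus 0 l.

(* partial exponential Bell polynomial B_{j,p}(x_1, x_2, ...) : sum over
   (k_1,...,k_j), k_i >= 0, sum k_i = p, sum i k_i = j (necessarily k_i <= j) *)
Definition Bell (j p : nat) (x : nat -> R) : R :=
  Rsum_list (map (fun ks => INR (fact j) * bell_prod_from 1 x ks)
    (filter (fun ks => andb (Nat.eqb (sum_list ks) p) (Nat.eqb (wsum_from 1 ks) j))
            (lists_bounded j j))).

Definition xbell (i : nat) : R := INR (fact i) / INR (i + 1).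

Fixpoint sum1 (n : nat) (g : nat -> R) : R :=
  match n with O => 0 | S n' => sum1 n' g + g n end.
Fixpoint Csum1 (n : nat) (g : nat -> C) : C :=
  match n with O => RtoC 0 | S n' => (Csum1 n' g + g n)%C end.

Definition d_rj (r : R) (j : nat) : R :=
  sum1 j (fun p => Bell j p xbell * rgamma (r - INR p))
  * RGamma (r + INR j) / INR (fact j).

Definition alam (m : nat) (lam : R) (a : nat -> C) (n : nat) : C :=
  (RtoC (Rpower lam (INR n / INR m - 1)) * a n)%C.

Definition dn (m : nat) (lam : R) (a : nat -> C) (n : nat) : C :=
  (RtoC (/ RGamma (INR n / INR m)) *
   (alam m lam a n +
    Csum1 n (fun j => if Nat.ltb (j * m) n
                      then (RtoC (d_rj (INR (n - j * m) / INR m) j)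
                            * alam m lam a (n - j * m))%C
                      else RtoC 0)))%C.

Definition fact_term (m : nat) (lam : R) (a : nat -> C) (z : C) (n : nat) : C :=
  (RtoC lam * RtoC (RGamma (INR n / INR m)) * CGamma (RtoC lam * z) * dn m lam a n
   / CGamma (RtoC lam * z + RtoC (INR n / INR m)))%C.

(* n-th term of the Borel transform at zeta = exp w:
   a_n zeta^(n/m - 1) / Gamma(n/m) *)
Definition borel_term (m : nat) (a : nat -> C) (w : C) (n : nat) : C :=
  (a n * Cexp (RtoC (INR n / INR m - 1) * w) / RtoC (RGamma (INR n / INR m)))%C.

Definition Gevrey1 (m : nat) (a : nat -> C) : Prop :=
  exists Cc K : R, forall n : nat,
    Cmod (a n) <= Cc * K ^ n * RGamma (1 + INR n / INR m).

(* Main.v *)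
Require Import Defs.
From Stdlib Require Import Reals Lra Lia List Factorial.
From Coquelicot Require Import Coquelicot.
Open Scope R_scope.

(** Substitute [zeta = - lam ln s] and [s = 1 - tau^m]. The hypotheses say that
    [H(tau) = F(zeta) tau^(m-1)] is a holomorphic function on the unit disc with
    [|H(tau)| <= K |1 - tau^m|^(- lam B)], so Cauchy's formula bounds its Taylor coefficients by
    [O(n^(b-1))] for every [b > max (lam B, 1)]. Expanding [(- ln (1 - t) / t)^al] by Bell
    polynomials in the Borel series gives an asymptotic expansion of [H] at [0+] with coefficients
    [d_n]; by uniqueness of such expansions the Taylor coefficients are the [d_n]. Integrating
    [F(zeta) exp (- z zeta)] term by term produces the Beta integrals
    [Gamma(lam z) Gamma(n/m) / Gamma(lam z + n/m)], and the growth of [d_n] makes the exchange of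
    sum and integral dominated as soon as [lam Re z > max (lam B, 1)]. *)

(** The [m] sheets and the exponent [(m - 1) / m] of the growth bound disappear together: a turn of
    [tau] is [m] turns of [zeta], and [tau ^ (m - 1)] is at most a constant times
    [zeta ^ ((m - 1) / m)] in modulus. Everything is then written in [log tau], where circles become
    vertical segments and Cauchy's formula a statement on rectangles for a [2 * i * PI]-periodic
    function; boundedness towards [Re = - infinity] replaces a value at [tau = 0]. Collecting the
    powers of [tau] in the Borel series would mean rearranging a double series. An asymptotic
    expansion of order [N] sees only finitely many terms, and uniqueness carries its coefficients
    over to the convergent Taylor series. The integral of [Cmod (1 - t) ^ (- b)] over a circle of
    radius [r] is controlled by [(1 - r) ^ (1 - b)] only for [1 < b]: this is where [1 / lam] enters
    beside [B]. The Beta relation is obtained without a double integral: its two sides obey one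
    recurrence in [w], and estimates far to the right leave no room for a difference. *)

Notation CV := C_R_CompleteNormedModule.

Ltac ceq := repeat match goal with
  | H : UniformSpace.sort _ |- _ => change C in (type of H) end;
  match goal with |- @eq _ ?a ?b => change (@eq C a b) end.
Ltac cring := ceq; ring.
Ltac cfield := ceq; field.

(** * Modulus inequalities *)

Lemma Ceq (z w : C) : Re z = Re w -> Im z = Im w -> z = w.
Proof. destruct z, w; simpl; intros -> ->; reflexivity. Qed.

Lemma Cmod_sub_sym (x y : C) : Cmod (x - y) = Cmod (y - x).
Proof. rewrite <- Cmod_opp. f_equal. ring. Qed.

Lemma Cmod_sub_le (x y : C) : Cmod x - Cmod y <= Cmod (x - y).
Proof.
  pose proof (Cmod_triangle (x - y) y) as H.
  replace (x - y + y)%C with x in H by ring. lra.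
Qed.

Lemma Cmod_sub_triangle (x y : C) : Cmod (x - y) <= Cmod x + Cmod y.
Proof.
  replace (x - y)%C with (x + - y)%C by ring.
  rewrite <- (Cmod_opp y). apply Cmod_triangle.
Qed.

Lemma Cmod_le_Rabs (z : C) : Cmod z <= Rabs (Re z) + Rabs (Im z).
Proof.
  destruct z as [x y]; simpl.
  replace (x, y) with ((x, 0) + (0, y))%C by (apply Ceq; simpl; ring).
  eapply Rle_trans; [apply Cmod_triangle|]. unfold Cmod; simpl.
  replace (x * (x * 1) + 0 * (0 * 1)) with (x²) by (unfold Rsqr; ring).
  replace (0 * (0 * 1) + y * (y * 1)) with (y²) by (unfold Rsqr; ring).
  rewrite !sqrt_Rsqr_abs. lra.
Qed.

Lemma im_le_Cmod (c : C) : Rabs (Im c) <= Cmod c.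
Proof. eapply Rle_trans; [|apply Rmax_Cmod]. apply Rmax_r. Qed.

(** * Complex differentiability *)

(* Balls for [Cmod], as opposed to the product uniformity [C_UniformSpace]. *)
Notation CU := (AbsRing_UniformSpace C_AbsRing).
Notation ccont f z := (continuous (T := CU) (U := CU) f z).

Lemma locally_CU (z : C) (P : C -> Prop) :
  locally (T := CU) z P <->
  exists d, 0 < d /\ forall w, Cmod (w - z) < d -> P w.
Proof.
  split.
  - intros [d Hd]. exists d. split; [apply cond_pos|]. exact Hd.
  - intros [d [Hd H]]. exists (mkposreal d Hd). exact H.
Qed.

Lemma ccont_eps (f : C -> C) (z : C) :
  ccont f z <-> forall eps, 0 < eps ->
    exists d, 0 < d /\ forall w, Cmod (w - z) < d -> Cmod (f w - f z) < eps.
Proof.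
  split.
  - intros H eps He. apply locally_CU.
    apply (H (fun y => Cmod (y - f z) < eps)). apply locally_CU.
    exists eps; auto.
  - intros H P HP. apply locally_CU in HP. destruct HP as [e [He HP]].
    destruct (H e He) as [d [Hd Hw]]. apply locally_CU. exists d; auto.
Qed.

Lemma ccont_const (c z : C) : ccont (fun _ => c) z.
Proof. exact (continuous_const (U := CU) (V := CU) c z). Qed.

Lemma ccont_id (z : C) : ccont (fun w => w) z.
Proof. exact (continuous_id (U := CU) z). Qed.

Lemma ccont_plus (f g : C -> C) (z : C) :
  ccont f z -> ccont g z -> ccont (fun w => f w + g w)%C z.
Proof.
  exact (continuous_plus (U := CU) (V := AbsRing_NormedModule C_AbsRing) f g z).
Qed.

Lemma ccont_opp (f : C -> C) (z : C) : ccont f z -> ccont (fun w => - f w)%C z.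
Proof.
  exact (continuous_opp (U := CU) (V := AbsRing_NormedModule C_AbsRing) f z).
Qed.

Lemma ccont_minus (f g : C -> C) (z : C) :
  ccont f z -> ccont g z -> ccont (fun w => f w - g w)%C z.
Proof. intros; apply ccont_plus; [|apply ccont_opp]; assumption. Qed.

Lemma ccont_mult (f g : C -> C) (z : C) :
  ccont f z -> ccont g z -> ccont (fun w => f w * g w)%C z.
Proof. exact (continuous_mult (U := CU) (K := C_AbsRing) f g z). Qed.

Lemma ccont_comp (f g : C -> C) (z : C) :
  ccont g z -> ccont f (g z) -> ccont (fun w => f (g w)) z.
Proof. exact (continuous_comp (U := CU) (V := CU) (W := CU) g f z). Qed.

(* Caratheodory's form of differentiability. *)
Definition cdiff (f : C -> C) (z : C) : Prop :=
  exists phi : C -> C, ccont phi z /\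
    locally (T := CU) z (fun w => f w = f z + phi w * (w - z))%C.

Lemma cdiff_of_ex_derive (f : C -> C) (z : C) :
  @ex_derive C_AbsRing C_NormedModule f z -> cdiff f z.
Proof.
  intros [l [_ Hl]].
  (* The slope function takes the value [l] at [z]; whether [w = z] is decided on the real number
     [Cmod (w - z)]. *)
  exists (fun w => if Req_EM_T (Cmod (w - z)) 0 then l else (f w - f z) / (w - z))%C.
  split.
  - apply ccont_eps. intros eps Heps.
    assert (He2 : 0 < eps / 2) by lra.
    specialize (Hl z (fun P H => H) (mkposreal (eps / 2) He2)).
    destruct Hl as [d Hd]. exists d. split; [apply cond_pos|].
    intros w Hw. specialize (Hd w Hw). simpl in Hd.
    unfold norm, minus, plus, opp, scal, mult in Hd; simpl in Hd.
    destruct (Req_EM_T (Cmod (z - z)) 0) as [E|E];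
      [|exfalso; apply E; replace (z - z)%C with (RtoC 0) by cring; apply Cmod_0].
    destruct (Req_EM_T (Cmod (w - z)) 0) as [E1|E1].
    + replace (l - l)%C with (RtoC 0) by cring. rewrite Cmod_0; lra.
    + assert (Hn : (w - z <> 0)%C) by (intros E2; apply E1; rewrite E2; apply Cmod_0).
      assert (0 < Cmod (w - z)) by (apply Cmod_gt_0; exact Hn).
      replace ((f w - f z) / (w - z) - l)%C with
        ((f w + - f z + - ((w + - z) * l)) / (w - z))%C by (cfield; exact Hn).
      rewrite Cmod_div by exact Hn.
      apply Rle_lt_trans with (eps / 2); [|lra].
      apply Rle_div_l; auto.
  - apply filter_forall. intros w.
    destruct (Req_EM_T (Cmod (w - z)) 0) as [E1|E1].
    + apply Cmod_eq_0 in E1.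
      assert (w = z) by (replace w with (w - z + z)%C by cring; rewrite E1; cring).
      subst w. cring.
    + cfield. intros E2; apply E1; rewrite E2; apply Cmod_0.
Qed.

Lemma cdiff_ccont (f : C -> C) (z : C) : cdiff f z -> ccont f z.
Proof.
  intros [phi [Hc Hl]].
  apply (continuous_ext_loc (T := CU) (U := CU) f (fun w => f z + phi w * (w - z))%C).
  - revert Hl. apply filter_imp. intros w Hw; symmetry; exact Hw.
  - apply ccont_plus; [apply ccont_const|].
    apply ccont_mult; [exact Hc|].
    apply ccont_minus;
      [apply ccont_id|apply ccont_const].
Qed.

Lemma cdiff_const (c z : C) : cdiff (fun _ => c) z.
Proof.
  exists (fun _ => RtoC 0). split; [apply ccont_const|].
  apply filter_forall. intros w. cring.
Qed.

Lemma cdiff_id (z : C) : cdiff (fun w => w) z.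
Proof.
  exists (fun _ => RtoC 1). split; [apply ccont_const|].
  apply filter_forall. intros w. cring.
Qed.

Lemma cdiff_plus (f g : C -> C) (z : C) :
  cdiff f z -> cdiff g z -> cdiff (fun w => f w + g w)%C z.
Proof.
  intros [p [Hp Hf]] [q [Hq Hg]]. exists (fun w => p w + q w)%C. split.
  - apply ccont_plus; auto.
  - generalize (filter_and _ _ Hf Hg). apply filter_imp.
    intros w [E1 E2]. rewrite E1, E2. cring.
Qed.

Lemma cdiff_mult (f g : C -> C) (z : C) :
  cdiff f z -> cdiff g z -> cdiff (fun w => f w * g w)%C z.
Proof.
  intros Df Dg. pose proof (cdiff_ccont _ _ Dg) as Cg.
  destruct Df as [p [Hp Hf]]. destruct Dg as [q [Hq Hg]].
  exists (fun w => p w * g w + f z * q w)%C. split.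
  - apply ccont_plus;
      apply ccont_mult; auto. apply ccont_const.
  - generalize (filter_and _ _ Hf Hg). apply filter_imp.
    intros w [E1 E2]. rewrite E1. replace (f z * g z)%C with (f z * g z)%C by cring.
    rewrite E2. cring.
Qed.

Lemma cdiff_comp (f g : C -> C) (z : C) :
  cdiff g z -> cdiff f (g z) -> cdiff (fun w => f (g w)) z.
Proof.
  intros Dg [p [Hp Hf]]. pose proof (cdiff_ccont _ _ Dg) as Cg.
  destruct Dg as [q [Hq Hg]].
  exists (fun w => p (g w) * q w)%C. split.
  - apply ccont_mult; auto.
    apply ccont_comp; auto.
  - assert (Hf' : locally (T := CU) z (fun w => f (g w) = f (g z) + p (g w) * (g w - g z))%C)
      by exact (Cg _ Hf).
    generalize (filter_and _ _ Hf' Hg). apply filter_imp.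
    intros w [E1 E2]. rewrite E1. rewrite E2 at 2. cring.
Qed.

Lemma ccont_inv (f : C -> C) (z : C) :
  ccont f z -> f z <> 0%C -> ccont (fun w => / f w)%C z.
Proof.
  intros H Hz. apply ccont_eps. intros eps He.
  assert (Ha : 0 < Cmod (f z)) by (apply Cmod_gt_0; exact Hz).
  set (a := Cmod (f z)) in *.
  destruct (proj1 (ccont_eps _ _) H (Rmin (a / 2) (eps * (a * a / 2)))) as [d [Hd Hw]].
  { apply Rmin_pos; [lra|]. apply Rmult_lt_0_compat; nra. }
  exists d; split; auto. intros w Hwd. specialize (Hw w Hwd).
  pose proof (Rmin_l (a / 2) (eps * (a * a / 2))).
  pose proof (Rmin_r (a / 2) (eps * (a * a / 2))).
  assert (Hb : a / 2 < Cmod (f w)).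
  { pose proof (Cmod_sub_le (f z) (f w)) as K. fold a in K.
    rewrite Cmod_sub_sym in K. lra. }
  assert (Hn : f w <> 0%C) by (apply Cmod_gt_0; lra).
  replace (/ f w - / f z)%C with ((f z - f w) / (f w * f z))%C by (cfield; split; auto).
  rewrite Cmod_div by (apply Cmult_neq_0; auto). rewrite Cmod_mult, Cmod_sub_sym. fold a.
  apply Rlt_div_l; [apply Rmult_lt_0_compat; lra|].
  eapply Rlt_le_trans; [exact Hw|]. eapply Rle_trans; [eassumption|].
  apply Rmult_le_compat_l; [lra|]. nra.
Qed.

Lemma ccont_neq0 (f : C -> C) (z : C) :
  ccont f z -> f z <> 0%C -> locally (T := CU) z (fun w => f w <> 0%C).
Proof.
  intros H Hz. assert (Ha : 0 < Cmod (f z)) by (apply Cmod_gt_0; exact Hz).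
  destruct (proj1 (ccont_eps _ _) H _ Ha) as [d [Hd Hw]]. apply locally_CU.
  exists d; split; auto. intros w Hwd E. specialize (Hw w Hwd). rewrite E in Hw.
  replace (0 - f z)%C with (- f z)%C in Hw by cring. rewrite Cmod_opp in Hw. lra.
Qed.

Lemma cdiff_inv (z : C) : z <> 0%C -> cdiff Cinv z.
Proof.
  intros Hz. exists (fun w => - (/ w * / z))%C. split.
  - apply ccont_opp.
    apply ccont_mult; [|apply ccont_const].
    apply (ccont_inv (fun w => w)); auto. apply ccont_id.
  - generalize (ccont_neq0 (fun w => w) z (ccont_id z) Hz).
    apply filter_imp. intros w Hw. cfield. split; auto.
Qed.

(** The slope function of [g] at [z] is the reciprocal of that of [f], composed with [g], so
    continuity of [g] is all that is asked of it. Applied to [Cexp], it differentiates the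
    logarithm. *)
Lemma cdiff_inverse (f g : C -> C) (z : C) :
  ccont g z -> locally (T := CU) z (fun w => f (g w) = w) ->
  (exists phi : C -> C, ccont phi (g z) /\ phi (g z) <> 0%C /\
    locally (T := CU) (g z) (fun w => f w = f (g z) + phi w * (w - g z))%C) ->
  cdiff g z.
Proof.
  intros Cg Hinv [phi [Hc [Hn Hl]]].
  exists (fun w => / phi (g w))%C.
  assert (Cpg : ccont (fun w => phi (g w)) z)
    by (apply ccont_comp; auto).
  split; [now apply ccont_inv|].
  assert (Hz : f (g z) = z) by (apply (locally_singleton (T := CU) _ _ Hinv)).
  assert (Hl' : locally (T := CU) z
    (fun w => f (g w) = f (g z) + phi (g w) * (g w - g z))%C) by exact (Cg _ Hl).
  generalize (filter_and _ _ (filter_and _ _ Hinv Hl') (ccont_neq0 _ _ Cpg Hn)).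
  apply filter_imp. intros w [[E1 E2] E3].
  rewrite <- E1 at 3. rewrite E2, Hz. cfield. exact E3.
Qed.

Lemma cdiff_ext (f g : C -> C) (z : C) :
  (forall w, f w = g w) -> cdiff f z -> cdiff g z.
Proof.
  intros E [p [Hp H]]. exists p. split; auto.
  revert H. apply filter_imp. intros w. rewrite !E. auto.
Qed.

(** The form of differentiability used in Goursat's argument: near [z], [f] is uniformly close,
    relative to the distance, to an affine function, whose contour integral is zero. *)
Lemma cdiff_affine_bound (f : C -> C) (z : C) : cdiff f z ->
  exists l : C, forall eps, 0 < eps -> exists d, 0 < d /\ forall w, Cmod (w - z) < d ->
    Cmod (f w - (f z + l * (w - z))) <= eps * Cmod (w - z).
Proof.
  intros [phi [Hc Hl]]. exists (phi z). intros eps He.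
  destruct (proj1 (ccont_eps _ _) Hc eps He) as [d1 [Hd1 H1]].
  apply locally_CU in Hl. destruct Hl as [d2 [Hd2 H2]].
  exists (Rmin d1 d2). split; [now apply Rmin_pos|]. intros w Hw.
  pose proof (Rmin_l d1 d2). pose proof (Rmin_r d1 d2).
  rewrite (H2 w) by lra.
  replace (f z + phi w * (w - z) - (f z + phi z * (w - z)))%C with
    ((phi w - phi z) * (w - z))%C by cring.
  rewrite Cmod_mult. apply Rmult_le_compat_r; [apply Cmod_ge_0|].
  left. apply H1. lra.
Qed.

(** * Complex-valued integrals *)

(** Differentiability uses the [Cmod] balls and integration the product uniformity; this and the
    converse below transport continuity from one to the other, with the factor [sqrt 2] between the
    two kinds of ball. *)
Lemma CU_to_CV (z : C) : continuous (T := CU) (U := CV) (fun w : C => w) z.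
Proof.
  apply filterlim_locally. intros eps. apply locally_CU. exists eps.
  split; [apply cond_pos|]. intros w Hw. apply C_NormedModule_mixin_compat1. exact Hw.
Qed.

Lemma CV_to_CU (z : C) : continuous (T := CV) (U := CU) (fun w : C => w) z.
Proof.
  apply filterlim_locally. intros eps.
  assert (H2 : 0 < sqrt 2) by (apply sqrt_lt_R0; lra).
  assert (H : 0 < eps / sqrt 2) by (apply Rdiv_lt_0_compat; [apply cond_pos|lra]).
  exists (mkposreal _ H). intros w Hw.
  pose proof (C_NormedModule_mixin_compat2 z w _ Hw) as K. simpl in K.
  replace (sqrt 2 * (eps / sqrt 2)) with (pos eps) in K by (field; lra). exact K.
Qed.

Notation rcont f t := (continuous (T := R_UniformSpace) (U := CV) f t).

Lemma rcont_comp (f : C -> C) (g : R -> C) (t : R) :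
  rcont g t -> ccont f (g t) -> rcont (fun s => f (g s)) t.
Proof.
  intros Hg Hf.
  apply (continuous_comp (U := R_UniformSpace) (V := CU) (W := CV) (fun s => f (g s))
    (fun w => w)); [|apply CU_to_CV].
  apply (continuous_comp (U := R_UniformSpace) (V := CU) (W := CU) g f); [|exact Hf].
  apply (continuous_comp (U := R_UniformSpace) (V := CV) (W := CU) g (fun w => w));
    [exact Hg|apply CV_to_CU].
Qed.

Lemma rcont_pair (f g : R -> R) (t : R) :
  continuous f t -> continuous g t -> rcont (fun s => (f s, g s)) t.
Proof.
  intros Hf Hg.
  apply (continuous_comp_2 (U := R_UniformSpace) (V := R_UniformSpace)
    (W := R_UniformSpace) (X := CV) f g (fun a b => (a, b))); auto.
  apply continuous_ext with (f := fun x : prod_UniformSpace R_UniformSpace R_UniformSpace => x).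
  - intros [x y]; reflexivity.
  - apply continuous_id.
Qed.

Lemma rcont_ext (f g : R -> C) (t : R) :
  (forall s, f s = g s) -> rcont f t -> rcont g t.
Proof. intros E H. exact (continuous_ext _ _ t E H). Qed.

Lemma rcont_const (c : C) (t : R) : rcont (fun _ => c) t.
Proof. exact (continuous_const (U := R_UniformSpace) (V := CV) c t). Qed.

Lemma rcont_CU (f : R -> C) (t : R) :
  rcont f t <-> continuous (T := R_UniformSpace) (U := CU) f t.
Proof.
  split; intros H.
  - apply (continuous_comp (U := R_UniformSpace) (V := CV) (W := CU) f (fun w => w));
      [exact H|apply CV_to_CU].
  - apply (continuous_comp (U := R_UniformSpace) (V := CU) (W := CV) f (fun w => w));
      [exact H|apply CU_to_CV].
Qed.

Lemma rcont_mult (f g : R -> C) (t : R) :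
  rcont f t -> rcont g t -> rcont (fun s => f s * g s)%C t.
Proof.
  rewrite !rcont_CU.
  exact (continuous_mult (U := R_UniformSpace) (K := C_AbsRing) f g t).
Qed.

Lemma rcont_minus (f g : R -> C) (t : R) :
  rcont f t -> rcont g t -> rcont (fun s => f s - g s)%C t.
Proof.
  exact (continuous_minus (U := R_UniformSpace) (V := CV) f g t).
Qed.

Lemma rcont_RtoC (f : R -> R) (t : R) :
  continuous f t -> rcont (fun s => RtoC (f s)) t.
Proof. intros H. apply rcont_pair; [exact H|apply continuous_const]. Qed.

Lemma rcont_fst (f : R -> C) (t : R) : rcont f t -> continuous (fun s => fst (f s)) t.
Proof.
  intros H. apply (continuous_comp (U := R_UniformSpace) (V := CV) (W := R_UniformSpace)
    f (fun z : C => fst z)); [exact H|apply (@continuous_fst R_UniformSpace R_UniformSpace)].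
Qed.

Lemma rcont_snd (f : R -> C) (t : R) : rcont f t -> continuous (fun s => snd (f s)) t.
Proof.
  intros H. apply (continuous_comp (U := R_UniformSpace) (V := CV) (W := R_UniformSpace)
    f (fun z : C => snd z)); [exact H|apply (@continuous_snd R_UniformSpace R_UniformSpace)].
Qed.

Lemma rcont_Cmod (f : R -> C) (t : R) : rcont f t -> continuous (fun s => Cmod (f s)) t.
Proof.
  intros H. apply (continuous_ext (fun s => @norm R_AbsRing CV (f s))).
  - intros s. symmetry. apply Cmod_norm.
  - apply (continuous_comp (U := R_UniformSpace) (V := CV) (W := R_UniformSpace)); [exact H|].
    apply (filterlim_norm (V := CV)).
Qed.

Notation is_CInt f a b l := (is_RInt (V := CV) f a b l).
Notation CInt f a b := (RInt (V := CV) f a b).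
Notation ex_CInt f a b := (ex_RInt (V := CV) f a b).

(** [CV] is a module over the reals, so linearity of the integral covers real factors only; a
    complex factor is treated on real and imaginary parts. *)
Lemma is_CInt_mult (c : C) (f : R -> C) (a b : R) (l : C) :
  is_CInt f a b l -> is_CInt (fun t => c * f t)%C a b (c * l)%C.
Proof.
  intros H.
  pose proof (is_RInt_fct_extend_fst (U := R_NormedModule) (V := R_NormedModule) f a b l H) as H1.
  pose proof (is_RInt_fct_extend_snd (U := R_NormedModule) (V := R_NormedModule) f a b l H) as H2.
  apply (is_RInt_fct_extend_pair (U := R_NormedModule) (V := R_NormedModule)
    (fun t => c * f t)%C a b).
  - exact (is_RInt_minus _ _ _ _ _ _ (is_RInt_scal _ _ _ (fst c) _ H1)
      (is_RInt_scal _ _ _ (snd c) _ H2)).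
  - exact (is_RInt_plus _ _ _ _ _ _ (is_RInt_scal _ _ _ (fst c) _ H2)
      (is_RInt_scal _ _ _ (snd c) _ H1)).
Qed.

Lemma ex_CInt_cont (f : R -> C) (a b : R) : a <= b ->
  (forall t, a <= t <= b -> rcont f t) -> ex_CInt f a b.
Proof.
  intros Hab H. apply (ex_RInt_continuous (V := CV)). intros t Ht.
  rewrite Rmin_left, Rmax_right in Ht by lra. apply H; lra.
Qed.

Lemma ex_CInt_mult (c : C) (f : R -> C) (a b : R) :
  ex_CInt f a b -> ex_CInt (fun t => c * f t)%C a b.
Proof. intros [l H]. exists (c * l)%C. now apply is_CInt_mult. Qed.

Lemma CInt_mult (c : C) (f : R -> C) (a b : R) :
  ex_CInt f a b -> CInt (fun t => c * f t)%C a b = (c * CInt f a b)%C.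
Proof.
  intros H. apply (is_RInt_unique (V := CV)). apply is_CInt_mult.
  now apply (RInt_correct (V := CV)).
Qed.

Lemma CInt_plus (f g : R -> C) (a b : R) :
  ex_CInt f a b -> ex_CInt g a b ->
  CInt (fun t => f t + g t)%C a b = (CInt f a b + CInt g a b)%C.
Proof. intros H1 H2. exact (RInt_plus (V := CV) f g a b H1 H2). Qed.

Lemma CInt_minus (f g : R -> C) (a b : R) :
  ex_CInt f a b -> ex_CInt g a b ->
  CInt (fun t => f t - g t)%C a b = (CInt f a b - CInt g a b)%C.
Proof. intros H1 H2. exact (RInt_minus (V := CV) f g a b H1 H2). Qed.

Lemma CInt_const (c : C) (a b : R) : CInt (fun _ => c) a b = (RtoC (b - a) * c)%C.
Proof.
  rewrite (RInt_const (V := CV)). apply Ceq; simpl; unfold scal; simpl; unfold mult; simpl; ring.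
Qed.

Lemma CInt_Chasles (f : R -> C) (a b c : R) :
  ex_CInt f a b -> ex_CInt f b c -> (CInt f a b + CInt f b c)%C = CInt f a c.
Proof. exact (RInt_Chasles (V := CV) f a b c). Qed.

Lemma CInt_ext (f g : R -> C) (a b : R) :
  (forall t, Rmin a b < t < Rmax a b -> f t = g t) -> CInt f a b = CInt g a b.
Proof. exact (RInt_ext (V := CV) f g a b). Qed.

Lemma Cmod_CInt_le (f : R -> C) (g : R -> R) (a b : R) : a <= b ->
  ex_CInt f a b -> ex_RInt g a b ->
  (forall t, a <= t <= b -> Cmod (f t) <= g t) -> Cmod (CInt f a b) <= RInt g a b.
Proof.
  intros Hab Hf Hg H. rewrite Cmod_norm.
  apply (norm_RInt_le (V := CV) f g a b).
  - exact Hab.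
  - intros t Ht. eapply Rle_trans; [right; symmetry; apply Cmod_norm|]. now apply H.
  - now apply (RInt_correct (V := CV)).
  - now apply (RInt_correct (V := R_CompleteNormedModule)).
Qed.

Lemma Cmod_CInt_le_const (f : R -> C) (M a b : R) : a <= b -> ex_CInt f a b ->
  (forall t, a <= t <= b -> Cmod (f t) <= M) -> Cmod (CInt f a b) <= (b - a) * M.
Proof.
  intros Hab Hf H.
  replace ((b - a) * M) with (RInt (fun _ => M) a b)
    by (rewrite RInt_const; reflexivity).
  apply Cmod_CInt_le; auto. apply ex_RInt_const.
Qed.

(** * Cauchy's theorem on rectangles *)

Definition hint (f : C -> C) (x1 x2 y : R) : C := CInt (fun x => f (x, y)) x1 x2.
Definition vint (f : C -> C) (x y1 y2 : R) : C := CInt (fun y => f (x, y)) y1 y2.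

(** The counterclockwise contour integral; [Ci] comes from [dz = i dy] on the vertical sides. *)
Definition rect (f : C -> C) (x1 x2 y1 y2 : R) : C :=
  (hint f x1 x2 y1 + Ci * vint f x2 y1 y2 - hint f x1 x2 y2 - Ci * vint f x1 y1 y2)%C.

Lemma rcont_hline (f : C -> C) (x y : R) :
  ccont f (x, y) -> rcont (fun x => f (x, y)) x.
Proof.
  intros H. apply (rcont_comp f (fun x => (x, y))); [|exact H].
  apply rcont_pair; [apply continuous_id|apply continuous_const].
Qed.

Lemma rcont_vline (f : C -> C) (x y : R) :
  ccont f (x, y) -> rcont (fun y => f (x, y)) y.
Proof.
  intros H. apply (rcont_comp f (fun y => (x, y))); [|exact H].
  apply rcont_pair; [apply continuous_const|apply continuous_id].
Qed.

Lemma ex_hint (f : C -> C) (x1 x2 y : R) : x1 <= x2 ->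
  (forall x, x1 <= x <= x2 -> ccont f (x, y)) -> ex_CInt (fun x => f (x, y)) x1 x2.
Proof. intros Hx H. apply ex_CInt_cont; auto. intros t Ht. now apply rcont_hline, H. Qed.

Lemma ex_vint (f : C -> C) (x y1 y2 : R) : y1 <= y2 ->
  (forall y, y1 <= y <= y2 -> ccont f (x, y)) -> ex_CInt (fun y => f (x, y)) y1 y2.
Proof. intros Hx H. apply ex_CInt_cont; auto. intros t Ht. now apply rcont_vline, H. Qed.

Definition bdcont (f : C -> C) (x1 x2 y1 y2 : R) : Prop :=
  (forall x, x1 <= x <= x2 -> ccont f (x, y1) /\ ccont f (x, y2)) /\
  (forall y, y1 <= y <= y2 -> ccont f (x1, y) /\ ccont f (x2, y)).

Lemma rect_split_x (f : C -> C) (x1 x2 x3 y1 y2 : R) : x1 <= x2 -> x2 <= x3 ->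
  (forall x, x1 <= x <= x3 -> ccont f (x, y1) /\ ccont f (x, y2)) ->
  rect f x1 x3 y1 y2 = (rect f x1 x2 y1 y2 + rect f x2 x3 y1 y2)%C.
Proof.
  intros H1 H2 Hc. unfold rect.
  assert (E : forall y, (forall x, x1 <= x <= x3 -> ccont f (x, y)) ->
    hint f x1 x3 y = (hint f x1 x2 y + hint f x2 x3 y)%C).
  { intros y Hy. symmetry. unfold hint. apply CInt_Chasles; apply ex_hint; auto;
      intros x Hx; apply Hy; lra. }
  rewrite (E y1 (fun x Hx => proj1 (Hc x Hx))), (E y2 (fun x Hx => proj2 (Hc x Hx))). ring.
Qed.

Lemma rect_split_y (f : C -> C) (x1 x2 y1 y2 y3 : R) : y1 <= y2 -> y2 <= y3 ->
  (forall y, y1 <= y <= y3 -> ccont f (x1, y) /\ ccont f (x2, y)) ->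
  rect f x1 x2 y1 y3 = (rect f x1 x2 y1 y2 + rect f x1 x2 y2 y3)%C.
Proof.
  intros H1 H2 Hc. unfold rect.
  assert (E : forall x, (forall y, y1 <= y <= y3 -> ccont f (x, y)) ->
    vint f x y1 y3 = (vint f x y1 y2 + vint f x y2 y3)%C).
  { intros x Hx. symmetry. unfold vint. apply CInt_Chasles; apply ex_vint; auto;
      intros y Hy; apply Hx; lra. }
  rewrite (E x1 (fun y Hy => proj1 (Hc y Hy))), (E x2 (fun y Hy => proj2 (Hc y Hy))). ring.
Qed.

Lemma rect_minus (f g : C -> C) (x1 x2 y1 y2 : R) : x1 <= x2 -> y1 <= y2 ->
  bdcont f x1 x2 y1 y2 -> bdcont g x1 x2 y1 y2 ->
  rect (fun w => f w - g w)%C x1 x2 y1 y2 = (rect f x1 x2 y1 y2 - rect g x1 x2 y1 y2)%C.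
Proof.
  intros Hx Hy [F1 F2] [G1 G2]. unfold rect, hint, vint.
  rewrite (CInt_minus (fun x => f (x, y1)) (fun x => g (x, y1)) x1 x2
    (ex_hint f x1 x2 y1 Hx (fun x H => proj1 (F1 x H)))
    (ex_hint g x1 x2 y1 Hx (fun x H => proj1 (G1 x H)))).
  rewrite (CInt_minus (fun x => f (x, y2)) (fun x => g (x, y2)) x1 x2
    (ex_hint f x1 x2 y2 Hx (fun x H => proj2 (F1 x H)))
    (ex_hint g x1 x2 y2 Hx (fun x H => proj2 (G1 x H)))).
  rewrite (CInt_minus (fun y => f (x1, y)) (fun y => g (x1, y)) y1 y2
    (ex_vint f x1 y1 y2 Hy (fun y H => proj1 (F2 y H)))
    (ex_vint g x1 y1 y2 Hy (fun y H => proj1 (G2 y H)))).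
  rewrite (CInt_minus (fun y => f (x2, y)) (fun y => g (x2, y)) y1 y2
    (ex_vint f x2 y1 y2 Hy (fun y H => proj2 (F2 y H)))
    (ex_vint g x2 y1 y2 Hy (fun y H => proj2 (G2 y H)))).
  ring.
Qed.

Lemma rect_bound (f : C -> C) (x1 x2 y1 y2 M : R) : x1 <= x2 -> y1 <= y2 ->
  bdcont f x1 x2 y1 y2 ->
  (forall x y, x1 <= x <= x2 -> y1 <= y <= y2 ->
     x = x1 \/ x = x2 \/ y = y1 \/ y = y2 -> Cmod (f (x, y)) <= M) ->
  Cmod (rect f x1 x2 y1 y2) <= 2 * ((x2 - x1) + (y2 - y1)) * M.
Proof.
  intros Hx Hy [C1 C2] H. unfold rect.
  eapply Rle_trans; [apply Cmod_sub_triangle|].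
  rewrite Cmod_mult, Cmod_Ci, Rmult_1_l.
  assert (A1 : Cmod (vint f x1 y1 y2) <= (y2 - y1) * M).
  { apply Cmod_CInt_le_const; auto.
    - apply ex_vint; auto. intros y Hy1. exact (proj1 (C2 y Hy1)).
    - intros t Ht. apply H; auto; lra. }
  assert (A2 : Cmod (vint f x2 y1 y2) <= (y2 - y1) * M).
  { apply Cmod_CInt_le_const; auto.
    - apply ex_vint; auto. intros y Hy1. exact (proj2 (C2 y Hy1)).
    - intros t Ht. apply H; auto; lra. }
  assert (A3 : Cmod (hint f x1 x2 y1) <= (x2 - x1) * M).
  { apply Cmod_CInt_le_const; auto.
    - apply ex_hint; auto. intros y Hy1. exact (proj1 (C1 y Hy1)).
    - intros t Ht. apply H; auto; lra. }
  assert (A4 : Cmod (hint f x1 x2 y2) <= (x2 - x1) * M).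
  { apply Cmod_CInt_le_const; auto.
    - apply ex_hint; auto. intros y Hy1. exact (proj2 (C1 y Hy1)).
    - intros t Ht. apply H; auto; lra. }
  assert (Cmod (hint f x1 x2 y1 + Ci * vint f x2 y1 y2 - hint f x1 x2 y2)
    <= (x2 - x1) * M + (y2 - y1) * M + (x2 - x1) * M); [|lra].
  eapply Rle_trans; [apply Cmod_sub_triangle|].
  assert (Cmod (hint f x1 x2 y1 + Ci * vint f x2 y1 y2) <= (x2 - x1) * M + (y2 - y1) * M); [|lra].
  eapply Rle_trans; [apply Cmod_triangle|].
  rewrite Cmod_mult, Cmod_Ci, Rmult_1_l. lra.
Qed.

Lemma CInt_RtoC (a b : R) : is_CInt (fun t => RtoC t) a b (RtoC ((b * b - a * a) / 2)).
Proof.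
  apply (is_RInt_fct_extend_pair (U := R_NormedModule) (V := R_NormedModule)
    (fun t => RtoC t) a b).
  - simpl. replace ((b * b - a * a) / 2) with (minus (b * b / 2) (a * a / 2))
      by (unfold minus, plus, opp; simpl; field).
    apply (is_RInt_derive (V := R_CompleteNormedModule) (fun t => t * t / 2) (fun t => t)).
    + intros x _. auto_derive; auto. field.
    + intros x _. apply continuous_id.
  - pose proof (is_RInt_const (V := R_NormedModule) a b 0) as K.
    unfold scal in K; simpl in K; unfold mult in K; simpl in K. rewrite Rmult_0_r in K.
    exact K.
Qed.

Lemma CInt_affine (A B : C) (a b : R) :
  CInt (fun t => A + B * RtoC t)%C a b
  = (RtoC (b - a) * A + B * RtoC ((b * b - a * a) / 2))%C.
Proof.
  pose proof (CInt_RtoC a b) as H.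
  rewrite CInt_plus.
  - rewrite CInt_const, CInt_mult by (eexists; exact H). f_equal. f_equal.
    apply (is_RInt_unique (V := CV)). exact H.
  - apply (ex_RInt_const (V := CV)).
  - apply ex_CInt_mult. eexists; exact H.
Qed.

Lemma rect_affine (c l : C) (x1 x2 y1 y2 : R) :
  rect (fun w => c + l * w)%C x1 x2 y1 y2 = 0%C.
Proof.
  unfold rect, hint, vint.
  assert (Hh : forall y, CInt (fun x => c + l * (x, y))%C x1 x2 =
    (RtoC (x2 - x1) * (c + l * (0, y)) + l * RtoC ((x2 * x2 - x1 * x1) / 2))%C).
  { intros y. rewrite <- CInt_affine. apply CInt_ext. intros t _.
    apply Ceq; simpl; ring. }
  assert (Hv : forall x, CInt (fun y => c + l * (x, y))%C y1 y2 =
    (RtoC (y2 - y1) * (c + l * RtoC x) + (l * Ci) * RtoC ((y2 * y2 - y1 * y1) / 2))%C).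
  { intros y. rewrite <- CInt_affine. apply CInt_ext. intros t _.
    apply Ceq; simpl; ring. }
  rewrite !Hh, !Hv. apply Ceq; simpl; field.
Qed.

(** Every right endpoint bounds all left endpoints, so the supremum of the latter lies in each
    interval. *)
Lemma nested_intervals (u d : nat -> R) :
  (forall n, u n <= u (S n) /\ u (S n) + d (S n) <= u n + d n /\ 0 <= d n) ->
  exists p, forall n, u n <= p <= u n + d n.
Proof.
  intros H.
  assert (Hm : forall n k, u n <= u (n + k)%nat /\ u (n + k)%nat + d (n + k)%nat <= u n + d n).
  { intros n k. induction k as [|k IH].
    - rewrite Nat.add_0_r. lra.
    - rewrite Nat.add_succ_r. destruct (H (n + k)%nat) as [A [B _]]. lra. }
  assert (Hc : forall n k, u k <= u n + d n).
  { intros n k. destruct (Nat.le_gt_cases n k) as [L|L].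
    - replace k with (n + (k - n))%nat by lia. destruct (Hm n (k - n)%nat).
      destruct (H (n + (k - n))%nat) as [_ [_ P]]. lra.
    - destruct (Hm k (n - k)%nat) as [A _]. replace (k + (n - k))%nat with n in A by lia.
      destruct (H n) as [_ [_ P]]. lra. }
  destruct (completeness (fun x => exists n, x = u n)) as [p [P1 P2]].
  - exists (u 0%nat + d 0%nat). intros x [n ->]. apply Hc.
  - exists (u 0%nat), 0%nat. reflexivity.
  - exists p. intros n. split.
    + apply P1. now exists n.
    + apply P2. intros x [k ->]. apply Hc.
Qed.

Section Bisection.

Variables (f : C -> C) (W Ht : R).

(** Only the lower left corner is stored, the sides at level [n] being [W / 2 ^ n] and [Ht / 2 ^ n].
    The first quarter that carries at least a fourth of the integral is kept; if three fail, the
    last one qualifies because the four integrals add up to the whole. *)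
Definition quarter_next (n : nat) (c : R * R) : R * R :=
  let w := W / 2 ^ S n in let h := Ht / 2 ^ S n in
  let (x, y) := c in
  let q := Cmod (rect f x (x + 2 * w) y (y + 2 * h)) / 4 in
  if Rle_dec q (Cmod (rect f x (x + w) y (y + h))) then (x, y) else
  if Rle_dec q (Cmod (rect f (x + w) (x + 2 * w) y (y + h))) then (x + w, y) else
  if Rle_dec q (Cmod (rect f x (x + w) (y + h) (y + 2 * h))) then (x, y + h) else
  (x + w, y + h).

Fixpoint quarter (c : R * R) (n : nat) : R * R :=
  match n with O => c | S n' => quarter_next n' (quarter c n') end.

End Bisection.

Theorem goursat (f : C -> C) (x1 x2 y1 y2 : R) : x1 <= x2 -> y1 <= y2 ->
  (forall x y, x1 <= x <= x2 -> y1 <= y <= y2 -> cdiff f (x, y)) ->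
  rect f x1 x2 y1 y2 = 0%C.
Proof.
  intros Hx Hy Hf.
  set (W := x2 - x1). set (Ht := y2 - y1).
  assert (HW : 0 <= W) by (unfold W; lra). assert (HH : 0 <= Ht) by (unfold Ht; lra).
  assert (Hcc : forall x y, x1 <= x <= x2 -> y1 <= y <= y2 -> ccont f (x, y))
    by (intros x y Ax Ay; apply cdiff_ccont, Hf; auto).
  set (eta := Cmod (rect f x1 x2 y1 y2)).
  destruct (Req_dec eta 0) as [E0|En0]; [now apply Cmod_eq_0|exfalso].
  assert (Heta : 0 < eta) by (pose proof (Cmod_ge_0 (rect f x1 x2 y1 y2)); unfold eta in *; lra).
  set (c := quarter f W Ht (x1, y1)).
  assert (P2n : forall n, 0 < 2 ^ n) by (intros n; apply pow_lt; lra).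
  assert (Inv : forall n, x1 <= fst (c n) /\ fst (c n) + W / 2 ^ n <= x2 /\
    y1 <= snd (c n) /\ snd (c n) + Ht / 2 ^ n <= y2 /\
    eta / 4 ^ n <= Cmod (rect f (fst (c n)) (fst (c n) + W / 2 ^ n)
                           (snd (c n)) (snd (c n) + Ht / 2 ^ n)) /\
    (fst (c n) <= fst (c (S n)) /\
     fst (c (S n)) + W / 2 ^ S n <= fst (c n) + W / 2 ^ n) /\
    (snd (c n) <= snd (c (S n)) /\
     snd (c (S n)) + Ht / 2 ^ S n <= snd (c n) + Ht / 2 ^ n)).
  { assert (Step : forall n, x1 <= fst (c n) -> fst (c n) + W / 2 ^ n <= x2 ->
      y1 <= snd (c n) -> snd (c n) + Ht / 2 ^ n <= y2 ->
      Cmod (rect f (fst (c n)) (fst (c n) + W / 2 ^ n)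
                           (snd (c n)) (snd (c n) + Ht / 2 ^ n)) / 4 <=
      Cmod (rect f (fst (c (S n))) (fst (c (S n)) + W / 2 ^ S n)
                           (snd (c (S n))) (snd (c (S n)) + Ht / 2 ^ S n)) /\
     (fst (c n) <= fst (c (S n)) /\
     fst (c (S n)) + W / 2 ^ S n <= fst (c n) + W / 2 ^ n) /\
    (snd (c n) <= snd (c (S n)) /\
     snd (c (S n)) + Ht / 2 ^ S n <= snd (c n) + Ht / 2 ^ n)).
    { intros n A1 A2 A3 A4.
      change (c (S n)) with (quarter_next f W Ht n (c n)).
      destruct (c n) as [x y]. unfold quarter_next. cbn [fst snd] in *.
      set (w := W / 2 ^ S n). set (h := Ht / 2 ^ S n).
      assert (Ew : W / 2 ^ n = 2 * w) by (unfold w; simpl; field; apply Rgt_not_eq, P2n).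
      assert (Eh : Ht / 2 ^ n = 2 * h) by (unfold h; simpl; field; apply Rgt_not_eq, P2n).
      rewrite Ew, Eh in *.
      assert (Hw : 0 <= w) by (apply Rdiv_le_0_compat; auto).
      assert (Hh : 0 <= h) by (apply Rdiv_le_0_compat; auto).
      assert (Es : rect f x (x + 2 * w) y (y + 2 * h) =
        (rect f x (x + w) y (y + h) + rect f (x + w) (x + 2 * w) y (y + h) +
         (rect f x (x + w) (y + h) (y + 2 * h)
          + rect f (x + w) (x + 2 * w) (y + h) (y + 2 * h)))%C).
      { rewrite (rect_split_y f x (x + 2 * w) y (y + h) (y + 2 * h)) by
          (try lra; intros t Tt; split; apply Hcc; lra).
        rewrite (rect_split_x f x (x + w) (x + 2 * w) y (y + h)) by
          (try lra; intros t Tt; split; apply Hcc; lra).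
        rewrite (rect_split_x f x (x + w) (x + 2 * w) (y + h) (y + 2 * h)) by
          (try lra; intros t Tt; split; apply Hcc; lra).
        reflexivity. }
      match goal with |- context [Rle_dec ?a ?b] => destruct (Rle_dec a b) as [L1|L1] end; [cbn [fst snd]; split; [exact L1|]; repeat split; lra|].
      match goal with |- context [Rle_dec ?a ?b] => destruct (Rle_dec a b) as [L2|L2] end.
      { cbn [fst snd]. replace (x + w + w) with (x + 2 * w) by ring. repeat split; lra. }
      match goal with |- context [Rle_dec ?a ?b] => destruct (Rle_dec a b) as [L3|L3] end.
      { cbn [fst snd]. replace (y + h + h) with (y + 2 * h) by ring. repeat split; lra. }
      cbn [fst snd]. replace (x + w + w) with (x + 2 * w) by ring.
      replace (y + h + h) with (y + 2 * h) by ring.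
      repeat split; try lra.
      apply Rnot_le_lt in L1, L2, L3.
      assert (Hs : Cmod (rect f x (x + 2 * w) y (y + 2 * h)) <=
        Cmod (rect f x (x + w) y (y + h)) + Cmod (rect f (x + w) (x + 2 * w) y (y + h)) +
         (Cmod (rect f x (x + w) (y + h) (y + 2 * h))
          + Cmod (rect f (x + w) (x + 2 * w) (y + h) (y + 2 * h)))).
      { rewrite Es at 1. eapply Rle_trans; [apply Cmod_triangle|].
        apply Rplus_le_compat; apply Cmod_triangle. }
      lra. }
    intros n. induction n as [|n IH].
    - assert (B1 : x1 <= fst (c 0%nat)) by (simpl; lra).
      assert (B2 : fst (c 0%nat) + W / 2 ^ 0 <= x2) by (simpl; unfold W; lra).
      assert (B3 : y1 <= snd (c 0%nat)) by (simpl; lra).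
      assert (B4 : snd (c 0%nat) + Ht / 2 ^ 0 <= y2) by (simpl; unfold Ht; lra).
      destruct (Step 0%nat B1 B2 B3 B4) as [_ [S1 S2]].
      repeat split; try tauto. simpl. unfold eta, W, Ht.
      right. rewrite !Rdiv_1_r. do 2 f_equal; ring.
    - destruct IH as [A1 [A2 [A3 [A4 [A5 [[A6 A7] [A8 A9]]]]]]].
      destruct (Step n A1 A2 A3 A4) as [S0 _].
      assert (B1 : x1 <= fst (c (S n))) by lra.
      assert (B2 : fst (c (S n)) + W / 2 ^ S n <= x2) by lra.
      assert (B3 : y1 <= snd (c (S n))) by lra.
      assert (B4 : snd (c (S n)) + Ht / 2 ^ S n <= y2) by lra.
      destruct (Step (S n) B1 B2 B3 B4) as [_ [S1 S2]].
      repeat split; try tauto.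
      eapply Rle_trans; [|exact S0].
      replace (eta / 4 ^ S n) with (eta / 4 ^ n / 4)
        by (simpl; field; apply pow_nonzero; lra).
      lra. }
  assert (Dn : forall n D, 0 <= D -> 0 <= D / 2 ^ n)
    by (intros n D HD; apply Rdiv_le_0_compat; auto).
  destruct (nested_intervals (fun n => fst (c n)) (fun n => W / 2 ^ n)) as [px Hpx].
  { intros n. destruct (Inv n) as (_ & _ & _ & _ & _ & [A B] & _).
    repeat split; auto. }
  destruct (nested_intervals (fun n => snd (c n)) (fun n => Ht / 2 ^ n)) as [py Hpy].
  { intros n. destruct (Inv n) as (_ & _ & _ & _ & _ & _ & [A B]).
    repeat split; auto. }
  assert (Hp : cdiff f (px, py)).
  { specialize (Hpx 0%nat). specialize (Hpy 0%nat). simpl in Hpx, Hpy.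
    apply Hf; unfold W, Ht in *; lra. }
  destruct (cdiff_affine_bound _ _ Hp) as [l Hl].
  set (P := W + Ht). assert (HP : 0 <= P) by (unfold P; lra).
  (* At level [N] the integral is at least [eta / 4 ^ N] and at most [2 * eps * P ^ 2 / 4 ^ N]; this
     [eps] makes the two incompatible, and the [+ 1] covers [P = 0]. *)
  set (eps := eta / (4 * (P * P + 1))).
  assert (Hk : 0 < 4 * (P * P + 1)) by nra.
  assert (Heps : 0 < eps) by (apply Rdiv_lt_0_compat; auto).
  destruct (Hl eps Heps) as [d [Hd Hb]].
  destruct (pow_lt_1_zero (/ 2) ltac:(rewrite Rabs_pos_eq; lra) (d / (P + 1))) as [N HN].
  { apply Rdiv_lt_0_compat; lra. }
  specialize (HN N (le_n N)). rewrite Rabs_pos_eq in HN by (apply pow_le; lra).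
  rewrite pow_inv in HN.
  assert (HPd : P / 2 ^ N < d).
  { apply Rle_lt_trans with ((P + 1) * / 2 ^ N).
    - unfold Rdiv. apply Rmult_le_compat_r; [left; apply Rinv_0_lt_compat, P2n|lra].
    - apply Rmult_lt_reg_r with (/ (P + 1)); [apply Rinv_0_lt_compat; lra|].
      replace ((P + 1) * / 2 ^ N * / (P + 1)) with (/ 2 ^ N)
        by (field; split; [lra|apply Rgt_not_eq, P2n]). exact HN. }
  destruct (Inv N) as (A1 & A2 & A3 & A4 & A5 & _).
  specialize (Hpx N). specialize (Hpy N). cbv beta in Hpx, Hpy.
  set (x := fst (c N)) in *. set (y := snd (c N)) in *.
  set (w := W / 2 ^ N) in *. set (h := Ht / 2 ^ N) in *.
  assert (Hwh : w + h = P / 2 ^ N) by (unfold w, h, P; field; apply Rgt_not_eq, P2n).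
  assert (Hw : 0 <= w) by (now apply Dn). assert (Hh : 0 <= h) by (now apply Dn).
  (* The affine approximation at the limit point: subtracting it leaves the contour integral
     unchanged and makes the integrand small. *)
  set (g := fun q : C => (f (px, py) - l * (px, py) + l * q)%C).
  assert (Cg : forall z, ccont g z).
    { intros z. apply ccont_plus; [apply ccont_const|].
      apply ccont_mult; [apply ccont_const|apply ccont_id]. }
  assert (Hg : rect f x (x + w) y (y + h) = rect (fun q => f q - g q)%C x (x + w) y (y + h)).
  { assert (Eg : rect g x (x + w) y (y + h) = 0%C) by apply rect_affine.
    transitivity (rect f x (x + w) y (y + h) - rect g x (x + w) y (y + h))%C.
    { rewrite Eg. ring. }
    symmetry. apply rect_minus; try lra; split; intros t Tt; split;
      first [exact (Cg _) | apply Hcc; lra]. }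
  assert (Hfin : Cmod (rect f x (x + w) y (y + h)) <=
    2 * ((x + w - x) + (y + h - y)) * (eps * (w + h))).
  { rewrite Hg. apply rect_bound; try lra.
    - split; intros t Tt; split; apply ccont_minus;
        first [exact (Cg _) | apply Hcc; lra].
    - intros x' y' Hx' Hy' _.
      assert (Hm : Cmod ((x', y') - (px, py)) <= w + h).
      { eapply Rle_trans; [apply Cmod_le_Rabs|]. simpl.
        apply Rplus_le_compat; apply Rabs_le; lra. }
      replace (f (x', y') - g (x', y'))%C with
        (f (x', y') - (f (px, py) + l * ((x', y') - (px, py))))%C by (unfold g; ring).
      eapply Rle_trans; [apply Hb; lra|].
      apply Rmult_le_compat_l; lra. }
  replace (2 * (x + w - x + (y + h - y)) * (eps * (w + h))) with
    (2 * eps * ((w + h) * (w + h))) in Hfin by ring.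
  assert (E4 : 4 ^ N = 2 ^ N * 2 ^ N) by (rewrite <- Rpow_mult_distr; f_equal; lra).
  assert (Hlt : 2 * eps * ((w + h) * (w + h)) < eta / 4 ^ N).
  { rewrite Hwh, E4. unfold eps.
    replace (2 * (eta / (4 * (P * P + 1))) * (P / 2 ^ N * (P / 2 ^ N))) with
      (eta / (2 ^ N * 2 ^ N) * (2 * (P * P) / (4 * (P * P + 1))))
      by (field; split; [apply Rgt_not_eq, P2n|nra]).
    rewrite <- (Rmult_1_r (eta / (2 ^ N * 2 ^ N))) at 2.
    apply Rmult_lt_compat_l.
    - apply Rdiv_lt_0_compat; auto. apply Rmult_lt_0_compat; auto.
    - apply Rlt_div_l; nra. }
  lra.
Qed.

(* The sides of the subrectangles used avoid the exceptional point, so nothing is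
   needed there except boundedness nearby. *)
Theorem goursat_punctured (f : C -> C) (x1 x2 y1 y2 px py M r : R) :
  x1 < px < x2 -> y1 < py < y2 -> 0 < r ->
  (forall x y, x1 <= x <= x2 -> y1 <= y <= y2 -> (x, y) <> (px, py) -> cdiff f (x, y)) ->
  (forall x y, Rabs (x - px) < r -> Rabs (y - py) < r -> (x, y) <> (px, py) ->
     Cmod (f (x, y)) <= M) ->
  rect f x1 x2 y1 y2 = 0%C.
Proof.
  intros Hx Hy Hr Hf HM.
  assert (Hcx : forall x y, x1 <= x <= x2 -> y1 <= y <= y2 -> x <> px -> ccont f (x, y)).
  { intros x y A B N. apply cdiff_ccont, Hf; auto. intros E; inversion E; auto. }
  assert (Hcy : forall x y, x1 <= x <= x2 -> y1 <= y <= y2 -> y <> py -> ccont f (x, y)).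
  { intros x y A B N. apply cdiff_ccont, Hf; auto. intros E; inversion E; auto. }
  (* [8 * e] is the perimeter of the square of half-side [e] around the point; the four other pieces
     vanish by [goursat]. *)
  assert (Hs : forall e, 0 < e -> e < r -> e < px - x1 -> e < x2 - px -> e < py - y1 ->
    e < y2 - py -> Cmod (rect f x1 x2 y1 y2) <= 8 * e * M).
  { intros e He1 He2 He3 He4 He5 He6.
    rewrite (rect_split_x f x1 (px - e) x2) by
      (try lra; intros t Tt; split; apply Hcy; lra).
    rewrite (rect_split_x f (px - e) (px + e) x2) by
      (try lra; intros t Tt; split; apply Hcy; lra).
    rewrite (rect_split_y f (px - e) (px + e) y1 (py - e) y2) by
      (try lra; intros t Tt; split; apply Hcx; lra).
    rewrite (rect_split_y f (px - e) (px + e) (py - e) (py + e) y2) by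
      (try lra; intros t Tt; split; apply Hcx; lra).
    rewrite (goursat f x1 (px - e) y1 y2), (goursat f (px + e) x2 y1 y2),
      (goursat f (px - e) (px + e) y1 (py - e)), (goursat f (px - e) (px + e) (py + e) y2)
      by (try lra; intros x y A B; apply Hf; try lra; intros E; inversion E; lra).
    replace (0 + (0 + (rect f (px - e) (px + e) (py - e) (py + e) + 0) + 0))%C
      with (rect f (px - e) (px + e) (py - e) (py + e)) by ring.
    eapply Rle_trans; [apply (rect_bound f _ _ _ _ M); try lra|right; ring].
    - split; intros t Tt; split; (apply Hcx; lra) || (apply Hcy; lra).
    - intros x y A B D. apply HM; try (apply Rabs_def1; lra).
      intros E; inversion E; subst. lra. }
  apply Cmod_eq_0. apply Rle_antisym; [|apply Cmod_ge_0].
  apply Rnot_lt_le. intros Hpos. set (k := Cmod (rect f x1 x2 y1 y2)) in *.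
  set (e0 := Rmin (Rmin r (Rmin (px - x1) (x2 - px))) (Rmin (py - y1) (y2 - py))).
  assert (He0 : 0 < e0) by (unfold e0; repeat apply Rmin_pos; lra).
  assert (Hq : e0 <= r /\ e0 <= px - x1 /\ e0 <= x2 - px /\ e0 <= py - y1 /\ e0 <= y2 - py).
  { unfold e0. set (a := Rmin (px - x1) (x2 - px)). set (b := Rmin (py - y1) (y2 - py)).
    pose proof (Rmin_l (px - x1) (x2 - px)). pose proof (Rmin_r (px - x1) (x2 - px)).
    pose proof (Rmin_l (py - y1) (y2 - py)). pose proof (Rmin_r (py - y1) (y2 - py)).
    pose proof (Rmin_l r a). pose proof (Rmin_r r a).
    pose proof (Rmin_l (Rmin r a) b). pose proof (Rmin_r (Rmin r a) b).
    fold a in H, H0. fold b in H1, H2. repeat split; lra. }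
  set (M' := Rabs M + 1). assert (HM' : M <= M' /\ 0 < M').
  { unfold M'. pose proof (Rle_abs M). pose proof (Rabs_pos M). lra. }
  set (e := Rmin (e0 / 2) (k / (16 * M'))).
  assert (He : 0 < e) by (apply Rmin_pos; [lra|apply Rdiv_lt_0_compat; lra]).
  assert (He1 : e <= e0 / 2) by apply Rmin_l.
  assert (He2 : e <= k / (16 * M')) by apply Rmin_r.
  specialize (Hs e He ltac:(lra) ltac:(lra) ltac:(lra) ltac:(lra) ltac:(lra) ).
  assert (e * M' <= k / 16).
  { apply Rle_trans with (k / (16 * M') * M').
    - apply Rmult_le_compat_r; lra.
    - right; field; lra. }
  nra.
Qed.

(** * The complex exponential *)

Lemma Cexp_plus (z w : C) : Cexp (z + w) = (Cexp z * Cexp w)%C.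
Proof.
  destruct z, w. apply Ceq; unfold Cexp; simpl; rewrite exp_plus; [rewrite cos_plus|rewrite sin_plus]; ring.
Qed.

Lemma Cexp_RtoC (x : R) : Cexp (RtoC x) = RtoC (exp x).
Proof. apply Ceq; unfold Cexp; simpl; rewrite ?cos_0, ?sin_0; ring. Qed.

Lemma Cexp_0 : Cexp 0 = 1%C.
Proof. rewrite Cexp_RtoC, exp_0. reflexivity. Qed.

Lemma Cmod_Cexp (z : C) : Cmod (Cexp z) = exp (Re z).
Proof.
  unfold Cmod, Cexp; simpl.
  replace (exp (Re z) * cos (Im z) * (exp (Re z) * cos (Im z) * 1) +
    exp (Re z) * sin (Im z) * (exp (Re z) * sin (Im z) * 1)) with ((exp (Re z))²).
  - apply sqrt_Rsqr. left; apply exp_pos.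
  - pose proof (sin2_cos2 (Im z)) as E. unfold Rsqr in *.
    transitivity (exp (Re z) * exp (Re z) *
      (sin (Im z) * sin (Im z) + cos (Im z) * cos (Im z))); [rewrite E|]; ring.
Qed.

Lemma Cexp_neq0 (z : C) : Cexp z <> 0%C.
Proof. apply Cmod_gt_0. rewrite Cmod_Cexp. apply exp_pos. Qed.

Lemma Cexp_nat (n : nat) (z : C) : Cexp (RtoC (INR n) * z) = (Cexp z ^ n)%C.
Proof.
  induction n as [|n IH].
  - simpl. replace (0 * z)%C with (RtoC 0) by ring. apply Cexp_0.
  - rewrite S_INR, RtoC_plus. replace ((INR n + 1) * z)%C with (z + INR n * z)%C by ring.
    rewrite Cexp_plus, IH. reflexivity.
Qed.

Lemma Cexp_period (z : C) (k : nat) : Cexp (z + (0, 2 * INR k * PI)) = Cexp z.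
Proof.
  apply Ceq; unfold Cexp; simpl; rewrite Rplus_0_r; [rewrite cos_period|rewrite sin_period];
    reflexivity.
Qed.

(** * Quadratic bounds and the derivative of the exponential *)

Lemma Rabs_sin_le (y : R) : Rabs (sin y) <= Rabs y.
Proof.
  assert (P : forall y, 0 < y -> Rabs (sin y) <= Rabs y).
  { clear y. intros y L. rewrite (Rabs_pos_eq y) by lra.
    destruct (Rle_lt_dec y 1) as [L1|L1].
    - assert (0 <= sin y) by (apply sin_ge_0; pose proof PI2_1; lra).
      rewrite Rabs_pos_eq by lra. left; apply sin_lt_x; lra.
    - pose proof (SIN_bound y). apply Rabs_le; lra. }
  destruct (Rtotal_order y 0) as [L|[->|L]]; [|rewrite sin_0; lra|now apply P].
  rewrite <- (Rabs_Ropp y), <- (Rabs_Ropp (sin y)), <- sin_neg. apply P. lra.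
Qed.

Lemma cos_ge_quadratic (y : R) : 1 - y * y / 2 <= cos y.
Proof.
  replace (cos y) with (1 - 2 * sin (y / 2) * sin (y / 2))
    by (rewrite <- cos_2a_sin; f_equal; field).
  pose proof (Rabs_sin_le (y / 2)) as H.
  apply Rsqr_le_abs_1 in H. unfold Rsqr in H. lra.
Qed.

Lemma Rabs_sin_sub_le (y : R) : Rabs (y - sin y) <= Rabs y * (y * y).
Proof.
  destruct (MVT_gen (fun t => t - sin t) 0 y (fun t => 1 - cos t)) as [c [Hc E]].
  - intros t _. auto_derive; auto. ring.
  - intros t _. apply derivable_continuous_pt. reg.
  - rewrite sin_0, !Rminus_0_r in E. rewrite E, Rabs_mult, Rmult_comm.
    apply Rmult_le_compat_l; [apply Rabs_pos|].
    pose proof (cos_ge_quadratic c). pose proof (COS_bound c).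
    rewrite Rabs_pos_eq by lra.
    assert (c * c <= y * y); [|nra].
    destruct (Rle_dec 0 y).
    + rewrite Rmin_left, Rmax_right in Hc by lra. nra.
    + rewrite Rmin_right, Rmax_left in Hc by lra. nra.
Qed.

Lemma Rabs_exp_sub_le (x : R) : Rabs x <= / 2 -> Rabs (exp x - 1 - x) <= 2 * (x * x).
Proof.
  intros H. assert (H' : - / 2 <= x <= / 2) by (apply Rabs_le_between; exact H).
  pose proof (exp_ineq1_le x). pose proof (exp_ineq1_le (- x)) as H1.
  rewrite exp_Ropp in H1. pose proof (exp_pos x) as Hp.
  assert (H2 : exp x * (1 - x) <= 1).
  { apply Rle_trans with (exp x * / exp x); [apply Rmult_le_compat_l; lra|].
    right; field; lra. }
  apply Rabs_le. split; [nra|]. nra.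
Qed.

(** On real and imaginary parts this reduces to the remainders of [exp], [cos] and [sin]. It yields
    the derivative of [Cexp] and, later, the comparison of [t] with [Lam t]. *)
Lemma Cexp_quadratic (h : C) : Cmod h <= / 2 ->
  Cmod (Cexp h - 1 - h) <= 12 * (Cmod h * Cmod h).
Proof.
  intros H. destruct h as [x y]. set (r := Cmod (x, y)) in *.
  assert (Hx : Rabs x <= r) by apply (re_le_Cmod (x, y)).
  assert (Hy : Rabs y <= r) by apply (im_le_Cmod (x, y)).
  assert (Hr : 0 <= r) by apply Cmod_ge_0.
  assert (Hxx : x * x <= r * r) by (apply Rabs_le_between in Hx; nra).
  assert (Hyy : y * y <= r * r) by (apply Rabs_le_between in Hy; nra).
  assert (He : Rabs (exp x - 1 - x) <= 2 * (r * r)).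
  { eapply Rle_trans; [apply Rabs_exp_sub_le; lra|]. lra. }
  assert (He1 : Rabs (exp x - 1) <= 2 * r).
  { replace (exp x - 1) with ((exp x - 1 - x) + x) by ring.
    eapply Rle_trans; [apply Rabs_triang|]. nra. }
  assert (He2 : Rabs (exp x) <= 2).
  { replace (exp x) with ((exp x - 1) + 1) by ring.
    eapply Rle_trans; [apply Rabs_triang|]. rewrite (Rabs_pos_eq 1) by lra. lra. }
  assert (Hc : Rabs (cos y - 1) <= r * r).
  { pose proof (cos_ge_quadratic y). pose proof (COS_bound y). apply Rabs_le; lra. }
  assert (Hs : Rabs (sin y - y) <= r * r).
  { rewrite Rabs_minus_sym. eapply Rle_trans; [apply Rabs_sin_sub_le|].
    pose proof (Rabs_pos y). nra. }
  eapply Rle_trans; [apply Cmod_le_Rabs|]. simpl.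
  replace (exp x * cos y + - (1) + - x) with (exp x * (cos y - 1) + (exp x - 1 - x)) by ring.
  replace (exp x * sin y + - 0 + - y) with (exp x * (sin y - y) + (exp x - 1) * y) by ring.
  assert (A1 : Rabs (exp x * (cos y - 1)) <= 2 * (r * r)).
  { rewrite Rabs_mult. apply Rmult_le_compat; auto; apply Rabs_pos. }
  assert (A2 : Rabs (exp x * (sin y - y)) <= 2 * (r * r)).
  { rewrite Rabs_mult. apply Rmult_le_compat; auto; apply Rabs_pos. }
  assert (A3 : Rabs ((exp x - 1) * y) <= 2 * r * r).
  { rewrite Rabs_mult. apply Rmult_le_compat; auto; apply Rabs_pos. }
  pose proof (Rabs_triang (exp x * (cos y - 1)) (exp x - 1 - x)).
  pose proof (Rabs_triang (exp x * (sin y - y)) ((exp x - 1) * y)).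
  nra.
Qed.

(** The slope function is exposed together with its nonvanishing at [z]: [cdiff_inverse] needs this
    for the logarithm, and the Cauchy quotient needs it near its base point. *)
Lemma Cexp_caratheodory (z : C) :
  exists phi : C -> C, ccont phi z /\ phi z <> 0%C /\
    locally (T := CU) z (fun w => Cexp w = Cexp z + phi w * (w - z))%C.
Proof.
  exists (fun w => Cexp z * (if Req_EM_T (Cmod (w - z)) 0 then 1 else
    (Cexp (w - z) - 1) / (w - z)))%C.
  assert (Hz : Cmod (z - z) = 0) by (replace (z - z)%C with (RtoC 0) by ring; apply Cmod_0).
  split; [|split].
  - apply ccont_mult; [apply ccont_const|]. apply ccont_eps. intros eps He.
    exists (Rmin (/ 2) (eps / 13)). split; [apply Rmin_pos; lra|].
    intros w Hw. pose proof (Rmin_l (/ 2) (eps / 13)). pose proof (Rmin_r (/ 2) (eps / 13)).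
    destruct (Req_EM_T (Cmod (z - z)) 0) as [_|N]; [|contradiction].
    destruct (Req_EM_T (Cmod (w - z)) 0) as [E|N].
    + replace (1 - 1)%C with (RtoC 0) by ring. rewrite Cmod_0. lra.
    + assert (Hn : (w - z <> 0)%C) by (intros E2; apply N; rewrite E2; apply Cmod_0).
      replace ((Cexp (w - z) - 1) / (w - z) - 1)%C with
        ((Cexp (w - z) - 1 - (w - z)) / (w - z))%C by (field; exact Hn).
      rewrite Cmod_div by exact Hn. pose proof (Cmod_ge_0 (w - z)).
      apply Rle_lt_trans with (12 * Cmod (w - z)); [|lra].
      apply Rle_div_l; [lra|]. rewrite Rmult_assoc. apply Cexp_quadratic. lra.
  - destruct (Req_EM_T (Cmod (z - z)) 0) as [_|N]; [|contradiction].
    rewrite Cmult_1_r. apply Cexp_neq0.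
  - apply filter_forall. intros w. destruct (Req_EM_T (Cmod (w - z)) 0) as [E|N].
    + apply Cmod_eq_0 in E.
      assert (w = z) by (replace w with (w - z + z)%C by cring; rewrite E; cring).
      subst w. cring.
    + replace (Cexp w) with (Cexp z * Cexp (w - z))%C
        by (rewrite <- Cexp_plus; f_equal; cring).
      cfield. intros E2; apply N; rewrite E2; apply Cmod_0.
Qed.

Lemma cdiff_Cexp (z : C) : cdiff Cexp z.
Proof.
  destruct (Cexp_caratheodory z) as [phi [H1 [_ H2]]]. exists phi; auto.
Qed.

Lemma cdiff_minus (f g : C -> C) (z : C) :
  cdiff f z -> cdiff g z -> cdiff (fun w => f w - g w)%C z.
Proof.
  intros Hf Hg. apply (cdiff_ext (fun w => f w + (- (1)) * g w)%C); [intros w; ring|].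
  apply cdiff_plus; auto. apply cdiff_mult; auto. apply cdiff_const.
Qed.

Lemma cos_eq_1 (y : R) : - PI <= y <= PI -> cos y = 1 -> y = 0.
Proof.
  intros H E.
  assert (E2 : sin (y / 2) * sin (y / 2) = 0).
  { replace (cos y) with (1 - 2 * sin (y / 2) * sin (y / 2)) in E
      by (rewrite <- cos_2a_sin; f_equal; field). lra. }
  assert (E3 : sin (y / 2) = 0) by (destruct (Rmult_integral _ _ E2); auto).
  pose proof PI_RGT_0.
  destruct (Rtotal_order y 0) as [L|[L|L]]; auto; exfalso.
  - assert (0 < sin (- (y / 2))) by (apply sin_gt_0; lra). rewrite sin_neg in H1. lra.
  - assert (0 < sin (y / 2)) by (apply sin_gt_0; lra). lra.
Qed.

(** In a period strip the denominator of Cauchy's kernel vanishes only at the base point. That point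
    being real, the closed strip is allowed: its two edges are mapped to the negative axis. *)
Lemma Cexp_sub_neq0 (x y x0 : R) : - PI <= y <= PI -> (x, y) <> (x0, 0) ->
  (Cexp (x, y) - Cexp (RtoC x0) <> 0)%C.
Proof.
  intros Hy Hn E.
  assert (E1 : Cexp (x, y) = Cexp (RtoC x0)).
  { replace (Cexp (x, y)) with (Cexp (x, y) - Cexp (RtoC x0) + Cexp (RtoC x0))%C by ring.
    rewrite E. ring. }
  assert (E2 : x = x0).
  { apply exp_inv.
    pose proof (Cmod_Cexp (x, y)) as A. pose proof (Cmod_Cexp (RtoC x0)) as B.
    simpl in A, B. rewrite <- B, <- E1. simpl. symmetry; exact A. }
  subst x0. apply Hn. f_equal. apply cos_eq_1; auto.
  assert (E3 : Re (Cexp (x, y)) = Re (Cexp (RtoC x))) by (rewrite E1; reflexivity).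
  unfold Cexp in E3; simpl in E3. rewrite cos_0 in E3. pose proof (exp_pos x). nra.
Qed.

(** * Expansion of a periodic holomorphic function *)

Lemma is_series_C_eps (f : nat -> C) (l : C) :
  is_series (V := C_NormedModule) f l <->
  forall eps, 0 < eps -> exists N, forall n, (N <= n)%nat ->
    Cmod (sum_n (G := C_AbelianMonoid) f n - l) < eps.
Proof.
  split.
  - intros H eps He.
    assert (H2 : 0 < sqrt 2) by (apply sqrt_lt_R0; lra).
    assert (Hp : 0 < eps / sqrt 2) by (apply Rdiv_lt_0_compat; lra).
    destruct (proj1 (filterlim_locally _ _) H (mkposreal _ Hp)) as [N HN].
    exists N. intros n Hn. specialize (HN n Hn).
    pose proof (C_NormedModule_mixin_compat2 l _ _ HN) as K. simpl in K.
    replace (sqrt 2 * (eps / sqrt 2)) with eps in K by (field; lra). exact K.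
  - intros H. apply filterlim_locally. intros eps.
    destruct (H eps (cond_pos eps)) as [N HN]. exists N. intros n Hn.
    apply C_NormedModule_mixin_compat1. exact (HN n Hn).
Qed.

Lemma is_RInt_primitive (F f : R -> R) (a b l : R) :
  (forall x, Rmin a b <= x <= Rmax a b -> is_derive F x (f x)) ->
  (forall x, Rmin a b <= x <= Rmax a b -> continuous f x) ->
  F b - F a = l -> is_RInt f a b l.
Proof.
  intros H1 H2 <-. exact (is_RInt_derive (V := R_CompleteNormedModule) F f a b H1 H2).
Qed.

Lemma CInt_Cexp_zero (n : nat) : (1 <= n)%nat ->
  CInt (fun th => Cexp (0, - (INR n * th))) (- PI) PI = RtoC 0.
Proof.
  intros Hn. assert (Hp : 0 < INR n) by (apply lt_0_INR; lia).
  apply (is_RInt_unique (V := CV)).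
  apply (is_RInt_fct_extend_pair (U := R_NormedModule) (V := R_NormedModule)
    (fun th => Cexp (0, - (INR n * th))) (- PI) PI 0 0).
  - apply (is_RInt_primitive (fun t => sin (INR n * t) / INR n)); simpl.
    + intros t _. auto_derive; [lra|]. rewrite exp_0, cos_neg. field. lra.
    + intros t _. apply (ex_derive_continuous (K := R_AbsRing) (V := R_NormedModule)).
      auto_derive. auto.
    + replace (INR n * - PI) with (- (INR n * PI)) by ring. rewrite sin_neg.
      rewrite (sin_eq_0_1 (INR n * PI)); [field; lra|].
      exists (Z.of_nat n). rewrite <- INR_IZR_INZ. reflexivity.
  - apply (is_RInt_primitive (fun t => cos (INR n * t) / INR n)); simpl.
    + intros t _. auto_derive; [lra|]. rewrite exp_0, sin_neg. field. lra.
    + intros t _. apply (ex_derive_continuous (K := R_AbsRing) (V := R_NormedModule)).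
      auto_derive. auto.
    + replace (INR n * - PI) with (- (INR n * PI)) by ring. rewrite cos_neg. ring.
Qed.

(* In terms of [tau = exp w], the [n]-th Taylor coefficient by Cauchy's formula on
   [|tau| = exp x1]. *)
Definition cauchy_coef (H : C -> C) (x1 : R) (n : nat) : C :=
  (RtoC (/ (2 * PI)) *
   CInt (fun th => H (x1, th) * Cexp (- (RtoC (INR n) * (x1, th))))%C (- PI) PI)%C.

Section Expansion.

Variables (H : C -> C) (x0 x1 X M : R).
Hypothesis x01 : x0 < x1.
Hypothesis Hdiff : forall w, Re w <= x1 -> cdiff H w.
Hypothesis Hper : forall w, H (Cplus w (0, 2 * PI)) = H w.
Hypothesis Hbnd : forall w, Re w <= X -> Cmod (H w) <= M.

Let c0 := RtoC x0.
(** Cauchy's integrand: with [tau = exp w], [Q dw] is [(H(tau) - H(tau0)) / (tau - tau0) dtau].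
    Subtracting [H c0] makes it bounded at [c0]. *)
Let Q (w : C) : C := ((H w - H c0) * (Cexp w * / (Cexp w - Cexp c0)))%C.

Lemma quot_cdiff (x y : R) : x <= x1 -> - PI <= y <= PI -> (x, y) <> (x0, 0) ->
  cdiff Q (x, y).
Proof.
  intros Hx Hy Hn. unfold Q. apply cdiff_mult.
  - apply cdiff_minus; [now apply Hdiff|apply cdiff_const].
  - apply cdiff_mult; [apply cdiff_Cexp|].
    apply (cdiff_comp Cinv (fun w => Cexp w - Cexp c0)%C).
    + apply cdiff_minus; [apply cdiff_Cexp|apply cdiff_const].
    + apply cdiff_inv. now apply Cexp_sub_neq0.
Qed.

(** Near [c0] numerator and denominator are both a slope times [w - c0], so the quotient is a ratio
    of slopes and extends continuously. *)
Lemma quot_bounded : exists r M', 0 < r /\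
  forall x y, Rabs (x - x0) < r -> Rabs (y - 0) < r -> (x, y) <> (x0, 0) ->
    Cmod (Q (x, y)) <= M'.
Proof.
  destruct (Hdiff c0) as [phi [Cphi Lphi]]; [simpl; lra|].
  destruct (Cexp_caratheodory c0) as [psi [Cpsi [Npsi Lpsi]]].
  assert (Cg : ccont (fun w => phi w * (Cexp w * / psi w))%C c0).
  { apply ccont_mult; auto. apply ccont_mult; [apply cdiff_ccont, cdiff_Cexp|].
    now apply ccont_inv. }
  destruct (proj1 (ccont_eps _ _) Cg 1 Rlt_0_1) as [d1 [Hd1 B1]].
  destruct (proj1 (locally_CU _ _) (filter_and _ _ (filter_and _ _ Lphi Lpsi)
    (ccont_neq0 _ _ Cpsi Npsi))) as [d2 [Hd2 B2]].
  exists (Rmin d1 d2 / 2), (Cmod (phi c0 * (Cexp c0 * / psi c0)) + 1).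
  assert (Hd : 0 < Rmin d1 d2) by now apply Rmin_pos.
  split; [lra|]. intros x y Hx Hy Hn.
  assert (Hw : Cmod ((x, y) - c0) < Rmin d1 d2).
  { eapply Rle_lt_trans; [apply Cmod_le_Rabs|]. simpl.
    replace (x + - x0) with (x - x0) by ring. replace (y + - 0) with (y - 0) by ring. lra. }
  pose proof (Rmin_l d1 d2). pose proof (Rmin_r d1 d2).
  specialize (B1 (x, y) ltac:(lra)). destruct (B2 (x, y) ltac:(lra)) as [[E1 E2] E3].
  assert (Hz : ((x, y) - c0 <> 0)%C).
  { intros E. apply Hn. injection E. intros E4 E5. f_equal; lra. }
  replace (Q (x, y)) with (phi (x, y) * (Cexp (x, y) * / psi (x, y)))%C.
  - pose proof (Cmod_sub_le (phi (x, y) * (Cexp (x, y) * / psi (x, y)))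
      (phi c0 * (Cexp c0 * / psi c0))). lra.
  - unfold Q. rewrite E1.
    assert (ED : (Cexp (x, y) - Cexp c0 = psi (x, y) * ((x, y) - c0))%C)
      by (rewrite E2; ring).
    rewrite ED. field. split; auto.
Qed.

Lemma quot_periodic (x : R) : Q (x, PI) = Q (x, - PI).
Proof.
  assert (E1 : (x, PI) = Cplus (x, - PI) (0, 2 * PI)) by (apply Ceq; simpl; ring).
  unfold Q. rewrite E1, Hper.
  replace (2 * PI) with (2 * INR 1 * PI) by (simpl; ring). rewrite Cexp_period. reflexivity.
Qed.

(** The horizontal sides cancel by periodicity, so the punctured form of Goursat's theorem equates
    the integrals over a period on the two sides of [c0]. *)
Lemma quot_vint_const (x2 : R) : x2 < x0 -> vint Q x2 (- PI) PI = vint Q x1 (- PI) PI.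
Proof.
  intros H2. destruct quot_bounded as [r [M' [Hr B]]]. pose proof PI_RGT_0.
  assert (E : rect Q x2 x1 (- PI) PI = RtoC 0).
  { apply (goursat_punctured Q x2 x1 (- PI) PI x0 0 M' r); auto; try lra.
    intros x y Hx Hy Hn. apply quot_cdiff; auto; lra. }
  unfold rect in E.
  assert (Eh : hint Q x2 x1 PI = hint Q x2 x1 (- PI)).
  { apply CInt_ext. intros t _. apply quot_periodic. }
  rewrite Eh in E.
  replace (vint Q x2 (- PI) PI) with (vint Q x1 (- PI) PI + Ci *
    (hint Q x2 x1 (- PI) + Ci * vint Q x1 (- PI) PI - hint Q x2 x1 (- PI)
     - Ci * vint Q x2 (- PI) PI))%C.
  - rewrite E. ring.
  - assert (I2 : (Ci * Ci = - (1))%C) by (apply Ceq; simpl; ring).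
    transitivity (vint Q x1 (- PI) PI + (Ci * Ci) * (vint Q x1 (- PI) PI
      - vint Q x2 (- PI) PI))%C; [ring|]. rewrite I2. ring.
Qed.

Lemma ex_quot_vint (x : R) : x <= x1 -> x <> x0 -> ex_CInt (fun y => Q (x, y)) (- PI) PI.
Proof.
  intros Hx Hn. pose proof PI_RGT_0. apply ex_vint; [lra|]. intros y Hy.
  apply cdiff_ccont, quot_cdiff; auto. intros E; inversion E; auto.
Qed.

(** Moving the segment to [Re w = - infinity], that is shrinking the circle to [tau = 0], lets the
    factor [Cexp w] kill the rest, which stays bounded. Boundedness of [H] takes the place of
    holomorphy at [tau = 0]. *)
Lemma quot_vint_zero : vint Q x1 (- PI) PI = RtoC 0.
Proof.
  pose proof PI_RGT_0 as HPI.
  apply Cmod_eq_0. apply Rle_antisym; [|apply Cmod_ge_0]. apply Rnot_lt_le. intros Hpos.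
  set (k := Cmod (vint Q x1 (- PI) PI)) in *.
  set (M' := M + Cmod (H c0) + 1).
  assert (HM : 0 <= M).
  { eapply Rle_trans; [apply Cmod_ge_0|apply (Hbnd (RtoC X))]. simpl; lra. }
  assert (HM' : 0 < M') by (pose proof (Cmod_ge_0 (H c0)); unfold M'; lra).
  pose proof (exp_pos x0) as He0.
  (* With [exp x2 <= exp x0 * e], the bound [/ 2] keeps the denominator above [exp x0 / 2], and the
     other one makes the integral at most [k / 2]. *)
  set (e := Rmin (/ 2) (k / (8 * PI * M'))).
  assert (Hk : 0 < k / (8 * PI * M')).
  { apply Rdiv_lt_0_compat; auto. apply Rmult_lt_0_compat; lra. }
  assert (He : 0 < e) by (apply Rmin_pos; lra).
  assert (He1 : e <= / 2) by apply Rmin_l.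
  assert (He2 : e <= k / (8 * PI * M')) by apply Rmin_r.
  set (x2 := Rmin X (x0 + ln e)).
  assert (Hln : ln e < 0) by (rewrite <- ln_1; apply ln_increasing; lra).
  assert (H2X : x2 <= X) by apply Rmin_l.
  assert (H2e : x2 <= x0 + ln e) by apply Rmin_r.
  assert (Hexp : exp x2 <= exp x0 * e).
  { rewrite <- (exp_ln e) at 1 by auto. rewrite <- exp_plus.
    destruct H2e as [L|E]; [left; now apply exp_increasing|rewrite E; lra]. }
  assert (Hb : k <= (PI - - PI) * (M' * (2 * e))).
  { unfold k. rewrite <- (quot_vint_const x2) by lra.
    apply Cmod_CInt_le_const; [lra| |].
    - apply ex_quot_vint; lra.
    - intros t Ht. unfold Q. rewrite !Cmod_mult.
      apply Rmult_le_compat; try apply Cmod_ge_0.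
      + apply Rmult_le_pos; apply Cmod_ge_0.
      + eapply Rle_trans; [apply Cmod_sub_triangle|].
        pose proof (Hbnd (x2, t) H2X). unfold M'. lra.
      + assert (Hn : (Cexp (x2, t) - Cexp c0 <> 0)%C).
        { apply Cexp_sub_neq0; auto. intros E; inversion E; lra. }
        rewrite Cmod_inv by exact Hn. rewrite Cmod_Cexp. simpl.
        assert (Hd : exp x0 / 2 <= Cmod (Cexp (x2, t) - Cexp c0)).
        { rewrite Cmod_sub_sym. pose proof (Cmod_sub_le (Cexp c0) (Cexp (x2, t))) as K.
          rewrite !Cmod_Cexp in K. simpl in K.
          assert (exp x0 * e <= exp x0 * / 2) by (apply Rmult_le_compat_l; lra). lra. }
        apply Rle_trans with (exp x0 * e * / (exp x0 / 2)).
        * apply Rmult_le_compat; auto; [left; apply exp_pos| |].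
          -- left; apply Rinv_0_lt_compat; lra.
          -- apply Rinv_le_contravar; lra.
        * right; field; lra. }
  assert (Hc : (PI - - PI) * (M' * (2 * e)) <= k / 2).
  { replace ((PI - - PI) * (M' * (2 * e))) with (4 * PI * M' * e) by ring.
    apply Rle_trans with (4 * PI * M' * (k / (8 * PI * M'))).
    - apply Rmult_le_compat_l; auto. left. apply Rmult_lt_0_compat; lra.
    - right; field; lra. }
  lra.
Qed.

(* [rem_int N] is [- 2 pi] times the error of the [N]-th partial sum. *)
Let q (th : R) : C := Cexp (c0 - (x1, th)).
Let rem_int (N : nat) : C := CInt (fun th => q th ^ N * Q (x1, th))%C (- PI) PI.

Lemma ratio_neq1 (th : R) : (1 - q th <> 0)%C.
Proof.
  intros E. assert (E1 : q th = 1%C).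
  { replace (q th) with (1 - (1 - q th))%C by ring. rewrite E. ring. }
  assert (E2 : Cmod (q th) = 1) by (rewrite E1; apply Cmod_1).
  unfold q in E2. rewrite Cmod_Cexp in E2. simpl in E2.
  assert (exp (x0 + - x1) < exp 0) by (apply exp_increasing; lra).
  rewrite exp_0 in H0. lra.
Qed.

(** Here [q] is [tau0 / tau] on the outer circle. The kernel becomes [1 / (1 - q)], and cutting its
    geometric series at order [N] leaves the factor [q ^ N] of [rem_int]. *)
Lemma quot_ratio (th : R) : Q (x1, th) = ((H (x1, th) - H c0) / (1 - q th))%C.
Proof.
  unfold Q. pose proof (ratio_neq1 th) as Hn.
  assert (E : Cexp c0 = (q th * Cexp (x1, th))%C).
  { unfold q. rewrite <- Cexp_plus. f_equal. ring. }
  pose proof (Cexp_neq0 (x1, th)) as Hn2.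
  rewrite E. field. split; auto.
  replace (Cexp (x1, th) - q th * Cexp (x1, th))%C with (Cexp (x1, th) * (1 - q th))%C by ring.
  now apply Cmult_neq_0.
Qed.

Lemma rcont_line (f : C -> C) (th : R) : cdiff f (x1, th) -> rcont (fun t => f (x1, t)) th.
Proof. intros D. apply rcont_vline, cdiff_ccont, D. Qed.

Lemma cdiff_exp_affine (a b z : C) : cdiff (fun w => Cexp (a + b * w)) z.
Proof.
  apply (cdiff_comp Cexp (fun w => a + b * w)%C); [|apply cdiff_Cexp].
  apply cdiff_plus; [apply cdiff_const|].
  apply cdiff_mult; [apply cdiff_const|apply cdiff_id].
Qed.

Lemma cdiff_line_pow (n : nat) (z : C) : cdiff (fun w => Cexp (c0 - w) ^ n)%C z.
Proof.
  apply (cdiff_ext (fun w => Cexp (RtoC (INR n) * c0 + - RtoC (INR n) * w))).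
  - intros w. rewrite <- Cexp_nat. f_equal. ring.
  - apply cdiff_exp_affine.
Qed.

(** The factor [1 - q] produced by the difference cancels the denominator. What remains is a Cauchy
    coefficient minus a Fourier mode of the constant [H c0], which survives for [N = 0] only. *)
Lemma rem_int_step (N : nat) :
  (rem_int N - rem_int (S N) =
   RtoC (2 * PI) * (cauchy_coef H x1 N * RtoC (exp (INR N * x0))
     - (if Nat.eqb N 0 then H c0 else 0)))%C.
Proof.
  pose proof PI_RGT_0 as HPI.
  assert (DQ : forall th, - PI <= th <= PI -> cdiff Q (x1, th)).
  { intros th Hth. apply quot_cdiff; auto; [lra|]. intros E; inversion E; lra. }
  assert (DH : forall th, cdiff H (x1, th)) by (intros th; apply Hdiff; simpl; lra).
  assert (exq : forall n, ex_CInt (fun th => q th ^ n * Q (x1, th))%C (- PI) PI).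
  { intros n. apply ex_CInt_cont; [lra|]. intros th Hth. apply rcont_mult.
    - apply (rcont_line (fun w => Cexp (c0 - w) ^ n)%C). apply cdiff_line_pow.
    - apply rcont_line. now apply DQ. }
  unfold rem_int. rewrite <- CInt_minus by apply exq.
  assert (E : CInt (fun th => q th ^ N * Q (x1, th) - q th ^ S N * Q (x1, th))%C (- PI) PI =
    CInt (fun th => RtoC (exp (INR N * x0)) * (H (x1, th) * Cexp (- (RtoC (INR N) * (x1, th))))
      - (H c0 * RtoC (exp (INR N * (x0 - x1)))) * Cexp (0, (- (INR N * th))%R))%C (- PI) PI).
  { apply CInt_ext. intros th _. rewrite quot_ratio.
    transitivity (q th ^ N * (H (x1, th) - H c0))%C.
    { simpl. field. apply ratio_neq1. }
    (* Two writings of the same power: one isolates Cauchy's kernel, to be paired with [H], the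
       other a pure Fourier mode, to be paired with the constant. *)
    assert (E1 : (q th ^ N)%C = (RtoC (exp (INR N * x0)) * Cexp (- (RtoC (INR N) * (x1, th))))%C).
    { unfold q. rewrite <- Cexp_nat, <- Cexp_RtoC, <- Cexp_plus. f_equal.
      unfold c0. rewrite RtoC_mult. ring. }
    assert (E2 : (q th ^ N)%C = (RtoC (exp (INR N * (x0 - x1))) * Cexp (0, (- (INR N * th))%R))%C).
    { unfold q. rewrite <- Cexp_nat, <- Cexp_RtoC, <- Cexp_plus. f_equal.
      apply Ceq; simpl; ring. }
    transitivity (q th ^ N * H (x1, th) - q th ^ N * H c0)%C; [ring|].
    rewrite E1 at 1. rewrite E2. ring. }
  rewrite E.
  assert (ex1 : ex_CInt (fun th => H (x1, th) * Cexp (- (RtoC (INR N) * (x1, th))))%C (- PI) PI).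
  { apply ex_CInt_cont; [lra|]. intros th Hth.
    apply (rcont_line (fun w => H w * Cexp (- (RtoC (INR N) * w)))%C).
    apply cdiff_mult; auto.
    apply (cdiff_ext (fun w => Cexp (0 + - RtoC (INR N) * w))).
    - intros w. f_equal. ring.
    - apply cdiff_exp_affine. }
  assert (ex2 : ex_CInt (fun th => Cexp (0, - (INR N * th))) (- PI) PI).
  { apply ex_CInt_cont; [lra|]. intros th Hth.
    apply (rcont_comp Cexp (fun th => (0, - (INR N * th)))); [|apply cdiff_ccont, cdiff_Cexp].
    apply rcont_pair; [apply continuous_const|].
    apply (ex_derive_continuous (K := R_AbsRing) (V := R_NormedModule)). auto_derive. auto. }
  rewrite CInt_minus by (apply ex_CInt_mult; assumption).
  rewrite (CInt_mult _ _ _ _ ex1), (CInt_mult _ _ _ _ ex2).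
  unfold cauchy_coef.
  set (J := CInt (fun th => (H (x1, th) * Cexp (- (RtoC (INR N) * (x1, th))))%C) (- PI) PI).
  assert (HP : (RtoC (2 * PI) * RtoC (/ (2 * PI)) = 1)%C).
  { rewrite <- RtoC_mult. f_equal. field. lra. }
  replace (RtoC (2 * PI) * (RtoC (/ (2 * PI)) * J * RtoC (exp (INR N * x0))
    - (if (N =? 0)%nat then H c0 else 0)))%C with
    ((RtoC (2 * PI) * RtoC (/ (2 * PI))) * (RtoC (exp (INR N * x0)) * J)
     - RtoC (2 * PI) * (if (N =? 0)%nat then H c0 else 0))%C by ring.
  rewrite HP, Cmult_1_l.
  assert (E3 : (H c0 * RtoC (exp (INR N * (x0 - x1)))
      * CInt (fun th => Cexp (0, (- (INR N * th))%R)) (- PI) PI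
    = RtoC (2 * PI) * (if (N =? 0)%nat then H c0 else 0))%C).
  { destruct N as [|N].
    - rewrite (CInt_ext _ (fun _ => RtoC 1)).
      + rewrite CInt_const. simpl Nat.eqb. cbv iota. simpl INR. rewrite Rmult_0_l, exp_0.
        replace (PI - - PI) with (2 * PI) by ring. ring.
      + intros t _. simpl INR. rewrite Rmult_0_l, Ropp_0. exact Cexp_0.
    - rewrite CInt_Cexp_zero by lia. simpl Nat.eqb. cbv iota. ring. }
  rewrite E3. reflexivity.
Qed.

Lemma partial_sum_rem (N : nat) :
  (RtoC (2 * PI) * (sum_n (G := C_AbelianMonoid)
     (fun n => cauchy_coef H x1 n * RtoC (exp (INR n * x0)))%C N - H c0)
   = - rem_int (S N))%C.
Proof.
  induction N as [|N IH].
  - rewrite sum_O. pose proof (rem_int_step 0) as E. simpl Nat.eqb in E. cbv iota in E.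
    rewrite <- E.
    (* [rem_int 0] is the full integral of [Q], zero by the contour shift: this is Cauchy's formula
       itself. *)
    assert (E0 : rem_int 0 = RtoC 0).
    { unfold rem_int. rewrite <- quot_vint_zero. apply CInt_ext. intros t _. simpl. ring. }
    rewrite E0. ring.
  - rewrite sum_Sn. pose proof (rem_int_step (S N)) as E. simpl Nat.eqb in E. cbv iota in E.
    match goal with |- context [plus ?a ?b] => change (plus a b) with (Cplus a b) end.
    set (S0 := sum_n _ _) in IH |- *. set (T := (cauchy_coef H x1 (S N) * _)%C) in E |- *.
    transitivity (RtoC (2 * PI) * (S0 - H c0) + RtoC (2 * PI) * (T - 0))%C; [cring|].
    rewrite IH, <- E. ring.
Qed.

Theorem cauchy_expansion :
  is_series (V := C_NormedModule)
    (fun n => cauchy_coef H x1 n * RtoC (exp (INR n * x0)))%C (H c0).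
Proof.
  pose proof PI_RGT_0 as HPI.
  set (rho := exp (x0 - x1)).
  assert (Hrho : 0 < rho < 1).
  { split; [apply exp_pos|]. unfold rho. rewrite <- exp_0. apply exp_increasing. lra. }
  assert (DQ : forall th, - PI <= th <= PI -> cdiff Q (x1, th)).
  { intros th Hth. apply quot_cdiff; auto; [lra|]. intros E; inversion E; lra. }
  assert (CQ : forall th, - PI <= th <= PI -> continuous (fun t => Cmod (Q (x1, t))) th).
  { intros th Hth. apply rcont_Cmod, rcont_line. now apply DQ. }
  assert (exQ : ex_RInt (fun t => Cmod (Q (x1, t))) (- PI) PI).
  { apply (ex_RInt_continuous (V := R_CompleteNormedModule)). intros t Ht.
    rewrite Rmin_left, Rmax_right in Ht by lra. now apply CQ. }
  set (K := RInt (fun t => Cmod (Q (x1, t))) (- PI) PI).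
  assert (HK : 0 <= K).
  { apply RInt_ge_0; auto; [lra|]. intros; apply Cmod_ge_0. }
  assert (Hrem : forall N, Cmod (rem_int N) <= rho ^ N * K).
  { intros N. unfold K. rewrite <- (RInt_scal (V := R_CompleteNormedModule) _ _ _ (rho ^ N)) by exact exQ.
    apply Cmod_CInt_le; [lra| |exact (ex_RInt_scal (V := R_CompleteNormedModule) _ _ _ _ exQ)|].
    - apply ex_CInt_cont; [lra|]. intros th Hth. apply rcont_mult.
      + apply (rcont_line (fun w => Cexp (c0 - w) ^ N)%C). apply cdiff_line_pow.
      + apply rcont_line. now apply DQ.
    - intros t Ht. rewrite Cmod_mult, Cmod_pow. unfold q. rewrite Cmod_Cexp.
      right. reflexivity. }
  apply is_series_C_eps. intros eps He.
  destruct (pow_lt_1_zero rho ltac:(rewrite Rabs_pos_eq; lra) (eps / (K + 1))) as [N HN].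
  { apply Rdiv_lt_0_compat; lra. }
  exists N. intros n Hn. specialize (HN (S n) ltac:(lia)).
  rewrite Rabs_pos_eq in HN by (apply pow_le; lra).
  pose proof (partial_sum_rem n) as E. apply (f_equal Cmod) in E.
  rewrite Cmod_mult, Cmod_opp, Cmod_R, Rabs_pos_eq in E by lra.
  specialize (Hrem (S n)).
  set (d := Cmod _) in E |- *.
  assert (Hd : 0 <= d) by apply Cmod_ge_0.
  assert (H2 : rho ^ S n * (K + 1) < eps).
  { apply Rmult_lt_reg_r with (/ (K + 1)); [apply Rinv_0_lt_compat; lra|].
    replace (rho ^ S n * (K + 1) * / (K + 1)) with (rho ^ S n) by (field; lra). exact HN. }
  assert (0 <= rho ^ S n) by (apply pow_le; lra).
  pose proof PI2_1. nra.
Qed.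

Lemma cauchy_coef_bound (n : nat) (g : R -> R) (L : R) :
  is_RInt g (- PI) PI L ->
  (forall th, - PI <= th <= PI -> Cmod (H (x1, th)) <= g th) ->
  Cmod (cauchy_coef H x1 n) <= / (2 * PI) * (exp (- (INR n * x1)) * L).
Proof.
  intros HL Hg. pose proof PI_RGT_0 as HPI. unfold cauchy_coef.
  rewrite Cmod_mult, Cmod_R, Rabs_pos_eq by (left; apply Rinv_0_lt_compat; lra).
  apply Rmult_le_compat_l; [left; apply Rinv_0_lt_compat; lra|].
  pose proof (is_RInt_scal (V := R_NormedModule) _ _ _ (exp (- (INR n * x1))) _ HL) as HS.
  replace (exp (- (INR n * x1)) * L) with
    (RInt (fun th => exp (- (INR n * x1)) * g th) (- PI) PI)
    by (apply (is_RInt_unique (V := R_CompleteNormedModule)); exact HS).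
  apply Cmod_CInt_le; [lra| | |].
  - apply ex_CInt_cont; [lra|]. intros th Hth.
    apply (rcont_line (fun w => H w * Cexp (- (RtoC (INR n) * w)))%C).
    apply cdiff_mult; [apply Hdiff; simpl; lra|].
    apply (cdiff_ext (fun w => Cexp (0 + - RtoC (INR n) * w))).
    + intros w. f_equal. ring.
    + apply cdiff_exp_affine.
  - eexists. exact HS.
  - intros t Ht. rewrite Cmod_mult, Cmod_Cexp. simpl.
    replace (- (INR n * x1 - 0 * t)) with (- (INR n * x1)) by ring.
    rewrite Rmult_comm. apply Rmult_le_compat_l; [left; apply exp_pos|]. now apply Hg.
Qed.

End Expansion.

(** * The principal logarithm on the right half-plane *)

Lemma Cln_right (s : C) : 0 < Re s -> Cln s = (ln (Cmod s), atan (Im s / Re s)).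
Proof.
  intros H. unfold Cln, Arg. destruct (Rlt_dec 0 (Re s)) as [_|N]; [reflexivity|lra].
Qed.

Lemma Cln_RtoC (x : R) : 0 < x -> Cln (RtoC x) = RtoC (ln x).
Proof.
  intros H. rewrite Cln_right by exact H. simpl. rewrite Cmod_R, Rabs_pos_eq by lra.
  unfold Rdiv. rewrite Rmult_0_l, atan_0. reflexivity.
Qed.

Lemma Re_pos_neq0 (s : C) : 0 < Re s -> s <> 0%C.
Proof. intros H E. rewrite E in H. simpl in H. lra. Qed.

Lemma Cexp_Cln (s : C) : 0 < Re s -> Cexp (Cln s) = s.
Proof.
  intros H. pose proof (Re_pos_neq0 s H) as Hn. rewrite Cln_right by exact H.
  unfold Cexp. simpl. rewrite exp_ln by (now apply Cmod_gt_0).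
  destruct s as [x y]; simpl in *.
  set (v := y / x).
  assert (Hs : 0 < sqrt (1 + v²)).
  { apply sqrt_lt_R0. pose proof (Rle_0_sqr v). lra. }
  assert (E : Cmod (x, y) = x * sqrt (1 + v²)).
  { unfold Cmod; simpl. rewrite <- (sqrt_Rsqr x) at 3 by lra.
    rewrite <- sqrt_mult_alt by apply Rle_0_sqr. f_equal. unfold Rsqr, v. field. lra. }
  rewrite cos_atan, sin_atan, E. f_equal.
  - field. lra.
  - unfold v at 2. field. split; lra.
Qed.

Lemma ccont_of_parts (f : C -> C) (z : C) :
  continuous (T := CV) (U := R_UniformSpace) (fun w => Re (f w)) z ->
  continuous (T := CV) (U := R_UniformSpace) (fun w => Im (f w)) z -> ccont f z.
Proof.
  intros H1 H2.
  apply (continuous_comp (U := CU) (V := CV) (W := CU) (fun w => w) f);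
    [apply CU_to_CV|].
  apply (continuous_comp (U := CV) (V := CV) (W := CU) f (fun w => w)); [|apply CV_to_CU].
  apply (continuous_ext (T := CV) (U := CV) (fun w : C => (Re (f w), Im (f w)))).
  { intros w. destruct (f w); reflexivity. }
  apply (continuous_comp_2 (U := CV) (V := R_UniformSpace) (W := R_UniformSpace) (X := CV)
    (fun w => Re (f w)) (fun w => Im (f w)) (fun a b => (a, b))); auto.
  apply continuous_ext with (f := fun x : prod_UniformSpace R_UniformSpace R_UniformSpace => x).
  - intros [x y]; reflexivity.
  - apply continuous_id.
Qed.

Lemma continuous_Re (z : C) : continuous (T := CV) (U := R_UniformSpace) (fun w : C => Re w) z.
Proof. apply (@continuous_fst R_UniformSpace R_UniformSpace). Qed.

Lemma continuous_Im (z : C) : continuous (T := CV) (U := R_UniformSpace) (fun w : C => Im w) z.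
Proof. apply (@continuous_snd R_UniformSpace R_UniformSpace). Qed.

Lemma Re_pos_locally (z : C) : 0 < Re z -> locally (T := CU) z (fun w => 0 < Re w).
Proof.
  intros H. apply locally_CU. exists (Re z). split; auto. intros w Hw.
  pose proof (re_le_Cmod (w - z)) as K. destruct w, z; simpl in *.
  assert (K2 : Rabs (r + - r1) < r1) by lra. apply Rabs_def2 in K2. lra.
Qed.

Lemma ccont_Cln (s : C) : 0 < Re s -> ccont Cln s.
Proof.
  intros H.
  apply (continuous_ext_loc (T := CU) (U := CU) Cln
    (fun w => (ln (Cmod w), atan (Im w / Re w)))).
  { generalize (Re_pos_locally s H). apply filter_imp. intros w Hw. symmetry.
    now apply Cln_right. }
  apply ccont_of_parts; simpl.
  - apply (continuous_comp (U := CV) (V := R_UniformSpace) (W := R_UniformSpace) Cmod ln).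
    + apply (continuous_ext (T := CV) (U := R_UniformSpace) (fun w => @norm R_AbsRing CV w)).
      * intros w. symmetry. apply Cmod_norm.
      * apply (filterlim_norm (V := CV)).
    + apply continuous_ln. apply Cmod_gt_0. now apply Re_pos_neq0.
  - apply (continuous_comp (U := CV) (V := R_UniformSpace) (W := R_UniformSpace)
      (fun w => Im w / Re w) atan).
    + apply (continuous_mult (U := CV) (K := R_AbsRing) (fun w => Im w) (fun w => / Re w)).
      * apply continuous_Im.
      * apply (continuous_comp (U := CV) (V := R_UniformSpace) (W := R_UniformSpace)
          (fun w => Re w) Rinv); [apply continuous_Re|].
        apply continuous_Rinv. lra.
    + apply (ex_derive_continuous (K := R_AbsRing) (V := R_NormedModule)).
      eexists. apply is_derive_atan.
Qed.

Lemma cdiff_Cln (s : C) : 0 < Re s -> cdiff Cln s.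
Proof.
  intros H. apply (cdiff_inverse Cexp).
  - now apply ccont_Cln.
  - generalize (Re_pos_locally s H). apply filter_imp. intros w. apply Cexp_Cln.
  - apply Cexp_caratheodory.
Qed.

(** * The conformal coordinate *)

(** With [t = 1 - s] the unit disc is the source of [Delta], and the puncture of [Delta] sits at
    [t = 0]. *)
Definition Lam (t : C) : C := (- Cln (1 - t))%C.

Lemma Re_1_sub (t : C) : Cmod t < 1 -> 0 < Re (1 - t)%C.
Proof.
  intros H. pose proof (re_le_Cmod t). pose proof (Rle_abs (Re t)).
  destruct t; simpl in *. lra.
Qed.

Lemma Cexp_Lam (t : C) : Cmod t < 1 -> Cexp (- Lam t) = (1 - t)%C.
Proof.
  intros H. unfold Lam. replace (- - Cln (1 - t))%C with (Cln (1 - t)) by ring.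
  now apply Cexp_Cln, Re_1_sub.
Qed.

(** The crude bound [- 1], which amounts to [ln 2 < 1], makes [p + 1] positive in [Lam_ratio_pos];
    the bound on the imaginary part feeds [q_sin_ge]. *)
Lemma Lam_bounds (t : C) : Cmod t < 1 ->
  - 1 < Re (Lam t) /\ - (PI / 2) < Im (Lam t) < PI / 2 /\ Re (Lam t) = - ln (Cmod (1 - t)).
Proof.
  intros H. pose proof (Re_1_sub t H) as Hr. unfold Lam. rewrite Cln_right by exact Hr.
  pose proof (atan_bound (Im (1 - t) / Re (1 - t))) as Hb.
  assert (Hc : 0 < Cmod (1 - t)) by (apply Cmod_gt_0, Re_pos_neq0, Hr).
  assert (H2 : Cmod (1 - t) < 2).
  { eapply Rle_lt_trans; [apply Cmod_sub_triangle|]. rewrite Cmod_1. lra. }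
  assert (Hl : ln (Cmod (1 - t)) < 1).
  { apply Rlt_le_trans with (ln (exp 1)); [|rewrite ln_exp; lra]. apply ln_increasing; auto.
    pose proof (exp_ineq1_le 1). lra. }
  set (l := ln (Cmod (1 - t))) in *. set (th := atan _) in *.
  unfold Copp, Re, Im; simpl. repeat split; lra.
Qed.

(** [1 - cos q <= sin q ^ 2 <= q * sin q], the first inequality because [0 < cos q <= 1]. *)
Lemma q_sin_ge (q : R) : - (PI / 2) < q < PI / 2 -> 1 - cos q <= q * sin q.
Proof.
  intros H. pose proof (cos_gt_0 q ltac:(lra) ltac:(lra)) as Hc.
  pose proof (COS_bound q). pose proof (sin2_cos2 q) as E. unfold Rsqr in E.
  assert (K : sin q * sin q <= q * sin q).
  { pose proof (Rabs_sin_le q) as B. pose proof PI_RGT_0.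
    destruct (Rle_dec 0 q).
    - assert (0 <= sin q) by (apply sin_ge_0; lra).
      rewrite !Rabs_pos_eq in B by lra. nra.
    - assert (S : 0 <= sin (- q)) by (apply sin_ge_0; lra). rewrite sin_neg in S.
      rewrite !Rabs_left1 in B by lra. nra. }
  nra.
Qed.

(** With [p + i q = Lam t] and [t = 1 - exp (- (p + i q))], the sign is that of [p * (exp p - 1) + p
    * (1 - cos q) + q * sin q]. The first term is nonnegative, and the other two add up to at least
    [(p + 1) * (1 - cos q)]; they cannot all vanish since [t] is nonzero. *)
Lemma Lam_ratio_pos (t : C) : t <> 0%C -> Cmod t < 1 -> 0 < Re (Lam t / t)%C.
Proof.
  intros Hn H. destruct (Lam_bounds t H) as [Hp [Hq _]]. pose proof (Cexp_Lam t H) as E.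
  destruct (Lam t) as [p q] eqn:EL. simpl in Hp, Hq.
  assert (Et : t = (1 - Cexp (- (p, q)))%C) by (rewrite E; ring).
  assert (Hpq : p <> 0 \/ q <> 0).
  { destruct (Req_dec p 0) as [->|]; auto. destruct (Req_dec q 0) as [->|]; auto.
    exfalso. apply Hn. rewrite Et. apply Ceq; unfold Cexp; simpl;
    rewrite ?Ropp_0, ?exp_0, ?cos_0, ?sin_0; ring. }
  set (a := exp (- p)). assert (Ha : 0 < a) by apply exp_pos.
  assert (Ea : exp p * a = 1) by (unfold a; rewrite <- exp_plus, Rplus_opp_r; apply exp_0).
  assert (E1 : Re t = 1 - a * cos q)
    by (rewrite Et; unfold Cexp; simpl; rewrite cos_neg; unfold a; ring).
  assert (E2 : Im t = a * sin q)
    by (rewrite Et; unfold Cexp; simpl; rewrite sin_neg; unfold a; ring).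
  destruct t as [x y]. simpl in E1, E2.
  assert (Hd : 0 < x * x + y * y).
  { destruct (Rlt_dec 0 (x * x + y * y)) as [L|L]; auto. exfalso. apply Hn.
    assert (x = 0 /\ y = 0) as [-> ->] by (split; nra). reflexivity. }
  replace (Re ((p, q) / (x, y))%C) with ((p * x + q * y) / (x * x + y * y))
    by (simpl; field; simpl; nra).
  apply Rdiv_lt_0_compat; auto.
  assert (Hmain : 0 < p * (exp p - cos q) + q * sin q).
  { pose proof (q_sin_ge q Hq) as Hs. pose proof (COS_bound q) as Hc.
    assert (H1 : 0 <= p * (exp p - 1) /\ (p <> 0 -> 0 < p * (exp p - 1))).
    { pose proof (exp_ineq1_le p) as G.
      destruct (Rtotal_order p 0) as [L|[->|L]].
      - assert (exp p < 1) by (rewrite <- exp_0; now apply exp_increasing). split; nra.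
      - split; [lra|intros; lra].
      - split; nra. }
    assert (H2 : 0 <= (p + 1) * (1 - cos q)) by nra.
    destruct Hpq as [Hpn|Hqn]; [nra|].
    assert (cos q < 1).
    { destruct (Req_dec (cos q) 1) as [E1'|]; [|lra]. exfalso. apply Hqn.
      apply cos_eq_1; auto. pose proof PI_RGT_0. lra. }
    assert (0 < (p + 1) * (1 - cos q)) by (apply Rmult_lt_0_compat; lra). nra. }
  rewrite E1, E2.
  replace (p * (1 - a * cos q) + q * (a * sin q)) with
    (a * (p * (exp p - cos q) + q * sin q)).
  - now apply Rmult_lt_0_compat.
  - transitivity (p * (exp p * a) + a * (- p * cos q + q * sin q)); [ring|]. rewrite Ea. ring.
Qed.

Lemma Lam_neq0 (t : C) : t <> 0%C -> Cmod t < 1 -> Lam t <> 0%C.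
Proof.
  intros Hn H E. pose proof (Lam_ratio_pos t Hn H) as K. rewrite E in K.
  replace (0 / t)%C with (RtoC 0) in K by (field; auto). simpl in K. lra.
Qed.

(* [v = log t] is sent to [log zeta], [zeta = - lam ln (1 - t)]; the quotient
   [- ln (1 - t) / t] has positive real part, so its principal logarithm is holomorphic. *)
Definition wmap (lam : R) (v : C) : C :=
  (v + RtoC (ln lam) + Cln (Lam (Cexp v) / Cexp v))%C.

Lemma Cmod_Cexp_lt1 (v : C) : Re v < 0 -> Cmod (Cexp v) < 1.
Proof. intros H. rewrite Cmod_Cexp, <- exp_0. now apply exp_increasing. Qed.

Lemma Cexp_wmap (lam : R) (v : C) : 0 < lam -> Re v < 0 ->
  Cexp (wmap lam v) = (RtoC lam * Lam (Cexp v))%C.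
Proof.
  intros Hl Hv. unfold wmap. rewrite !Cexp_plus, Cexp_RtoC, exp_ln by exact Hl.
  rewrite Cexp_Cln by (apply Lam_ratio_pos; [apply Cexp_neq0|now apply Cmod_Cexp_lt1]).
  field. apply Cexp_neq0.
Qed.

Lemma Omega_wmap (lam : R) (v : C) : 0 < lam -> Re v < 0 -> Omega_star lam (wmap lam v).
Proof.
  intros Hl Hv. split; [|apply Cexp_neq0]. rewrite Cexp_wmap by auto.
  exists (1 - Cexp v)%C. split; [|reflexivity].
  replace (1 - Cexp v - 1)%C with (- Cexp v)%C by ring. rewrite Cmod_opp.
  now apply Cmod_Cexp_lt1.
Qed.

Lemma cdiff_wmap (lam : R) (v : C) : Re v < 0 -> cdiff (wmap lam) v.
Proof.
  intros Hv. pose proof (Cmod_Cexp_lt1 v Hv) as H1. unfold wmap. apply cdiff_plus.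
  - apply cdiff_plus; [apply cdiff_id|apply cdiff_const].
  - apply (cdiff_comp Cln (fun v => Lam (Cexp v) / Cexp v)%C).
    + apply (cdiff_mult (fun v => Lam (Cexp v)) (fun v => / Cexp v)%C).
      * apply (cdiff_comp Lam Cexp); [apply cdiff_Cexp|].
        apply (cdiff_ext (fun t => (- (1)) * Cln (1 - t))%C); [intros w; unfold Lam; ring|].
        apply cdiff_mult; [apply cdiff_const|].
        apply (cdiff_comp Cln (fun t => 1 - t)%C).
        -- apply cdiff_minus; [apply cdiff_const|apply cdiff_id].
        -- now apply cdiff_Cln, Re_1_sub.
      * apply (cdiff_comp Cinv Cexp); [apply cdiff_Cexp|].
        apply cdiff_inv, Cexp_neq0.
    + apply cdiff_Cln, Lam_ratio_pos; auto. apply Cexp_neq0.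
Qed.

(** Only the summand [v] sees the translation, the logarithm depending on [Cexp v] alone: a turn
    around [t = 0] is a turn around [zeta = 0], so the map lifts to the covering. *)
Lemma wmap_period (lam : R) (v : C) (m : nat) :
  wmap lam (v + (0, 2 * INR m * PI)) = Cplus (wmap lam v) (0, 2 * PI * INR m).
Proof.
  unfold wmap. rewrite Cexp_period. replace (2 * PI * INR m) with (2 * INR m * PI) by ring.
  ring.
Qed.

(** The segment [0 < t < 1] lands on the ray of argument [0], the path of the Laplace integral. *)
Lemma wmap_RtoC (lam x : R) : 0 < lam -> x < 0 ->
  wmap lam (RtoC x) = RtoC (ln (lam * - ln (1 - exp x))).
Proof.
  intros Hl Hx. pose proof (exp_pos x) as Hp.
  assert (H1 : exp x < 1) by (rewrite <- exp_0; now apply exp_increasing).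
  assert (Hln : 0 < - ln (1 - exp x)).
  { assert (ln (1 - exp x) < ln 1) by (apply ln_increasing; lra). rewrite ln_1 in H. lra. }
  unfold wmap, Lam. rewrite Cexp_RtoC, <- RtoC_minus, Cln_RtoC by lra.
  rewrite <- RtoC_opp, <- RtoC_div by lra.
  rewrite Cln_RtoC by (apply Rdiv_lt_0_compat; lra).
  rewrite <- !RtoC_plus. f_equal.
  unfold Rdiv. rewrite (ln_mult lam), ln_mult, ln_Rinv, ln_exp; try lra.
  now apply Rinv_0_lt_compat.
Qed.

(** For [L = Cmod (Lam t)] at most [/ 2], the quadratic remainder gives [L + 12 * L ^ 2 <= 7 * L];
    otherwise [Cmod t < 1] suffices. It bounds [t / zeta] in [Hfun_bound]. *)
Lemma Cmod_le_Lam (t : C) : Cmod t < 1 -> Cmod t <= 7 * Cmod (Lam t).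
Proof.
  intros H. destruct (Rle_dec (Cmod (Lam t)) (/ 2)) as [L|L]; [|lra].
  pose proof (Cexp_Lam t H) as E.
  pose proof (Cexp_quadratic (- Lam t)) as Q. rewrite Cmod_opp in Q. specialize (Q L).
  rewrite E in Q.
  replace t with (Lam t + - (1 - t - 1 - - Lam t))%C at 1 by ring.
  eapply Rle_trans; [apply Cmod_triangle|]. rewrite Cmod_opp.
  pose proof (Cmod_ge_0 (Lam t)). nra.
Qed.

(** * The Borel transform in the uniformizing coordinate *)

(* [F(zeta) tau^(m-1)] at [tau = exp y], where [zeta = - lam ln (1 - tau^m)]. *)
Definition Hfun (m : nat) (lam : R) (F : C -> C) (y : C) : C :=
  (F (wmap lam (RtoC (INR m) * y)) * Cexp (RtoC (INR m - 1) * y))%C.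

Section Uniformization.

Variables (m : nat) (lam A B : R) (F : C -> C).
Hypothesis m_pos : (1 <= m)%nat.
Hypothesis lam_pos : 0 < lam.
Hypothesis F_per : forall w : C, F (Cplus w (0, 2 * PI * INR m)) = F w.
Hypothesis F_diff : forall w : C, Omega_star lam w -> @ex_derive C_AbsRing C_NormedModule F w.
Hypothesis A_pos : 0 < A.
Hypothesis B_pos : 0 < B.
Hypothesis F_bound : forall w : C, Omega_star lam w ->
  Cmod (F w * Cexp (RtoC ((INR m - 1) / INR m) * w))%C <= A * exp (B * Cmod (Cexp w)).

Lemma m_INR : 1 <= INR m.
Proof. replace 1 with (INR 1) by reflexivity. now apply le_INR. Qed.

Lemma Re_scaled (y : C) : Re y < 0 -> Re (RtoC (INR m) * y)%C < 0.
Proof. intros H. pose proof m_INR. destruct y; simpl in *. nra. Qed.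

Lemma Hfun_cdiff (y : C) : Re y < 0 -> cdiff (Hfun m lam F) y.
Proof.
  intros H. pose proof (Re_scaled y H) as Hm. unfold Hfun. apply cdiff_mult.
  - apply (cdiff_comp F (fun y => wmap lam (RtoC (INR m) * y)%C)).
    + apply (cdiff_comp (wmap lam) (fun y => RtoC (INR m) * y)%C).
      * apply cdiff_mult; [apply cdiff_const|apply cdiff_id].
      * now apply cdiff_wmap.
    + apply cdiff_of_ex_derive, F_diff, Omega_wmap; auto.
  - apply (cdiff_comp Cexp (fun y => RtoC (INR m - 1) * y)%C); [|apply cdiff_Cexp].
    apply cdiff_mult; [apply cdiff_const|apply cdiff_id].
Qed.

(** A turn of [tau] is [m] turns of [zeta], exactly the period of the covering, and [tau ^ (m - 1)]
    is single-valued because [m - 1] is a natural number. *)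
Lemma Hfun_period (y : C) : Hfun m lam F (Cplus y (0, 2 * PI)) = Hfun m lam F y.
Proof.
  unfold Hfun.
  replace (RtoC (INR m) * (Cplus y (0, (2 * PI)%R)))%C with
    (RtoC (INR m) * y + (0, (2 * INR m * PI)%R))%C by (apply Ceq; destruct y; simpl; ring).
  rewrite wmap_period, F_per. f_equal.
  replace (INR m - 1) with (INR (m - 1)) by (rewrite minus_INR by exact m_pos; reflexivity).
  replace (RtoC (INR (m - 1)) * (Cplus y (0, (2 * PI)%R)))%C with
    (RtoC (INR (m - 1)) * y + (0, (2 * INR (m - 1) * PI)%R))%C
    by (apply Ceq; destruct y; simpl; ring).
  apply Cexp_period.
Qed.

Lemma Hfun_RtoC (x : R) : x < 0 ->
  Hfun m lam F (RtoC x) = (F (RtoC (ln (lam * - ln (1 - exp (INR m * x)))))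
    * RtoC (exp ((INR m - 1) * x)))%C.
Proof.
  intros H. pose proof m_INR. unfold Hfun.
  rewrite <- !RtoC_mult, Cexp_RtoC, wmap_RtoC; auto. nra.
Qed.

(** The bound on [F] carries [zeta ^ k] with [k = (m - 1) / m], whereas [Hfun] carries [t ^ k]; as
    [0 <= k <= 1] and [t / zeta] is at most [7 / lam], the exchange costs [1 + 7 / lam]. Exponential
    growth turns into a power because [Re (Lam t) = - ln (Cmod (1 - t))] while [Im (Lam t)] is
    bounded. *)
Lemma Hfun_bound (b : R) : lam * B <= b -> exists K, 0 < K /\ forall y, Re y < 0 ->
  Cmod (Hfun m lam F y) <= K * exp (- b * ln (Cmod (1 - Cexp (RtoC (INR m) * y)))).
Proof.
  intros Hb. set (be := lam * B) in *. assert (Hbe : 0 < be) by now apply Rmult_lt_0_compat.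
  (* With [l = ln (Cmod (1 - t)) <= ln 2]: [PI / 2] bounds the imaginary part of [Lam t],
     [2 * be * ln 2] pays for [Rabs l <= - l + 2 * ln 2], and [(b - be) * ln 2] for raising the
     exponent from [be] to [b]. *)
  exists (A * (1 + 7 / lam) * exp (be * (PI / 2) + 2 * be * ln 2 + (b - be) * ln 2)).
  assert (H7 : 0 < 7 / lam) by (apply Rdiv_lt_0_compat; lra).
  split. { repeat apply Rmult_lt_0_compat; try lra. apply exp_pos. }
  intros y Hy. pose proof (Re_scaled y Hy) as Hv. pose proof m_INR as Hm.
  set (v := (RtoC (INR m) * y)%C) in *. set (t := Cexp v).
  assert (Ht : Cmod t < 1) by now apply Cmod_Cexp_lt1.
  assert (Hn : t <> 0%C) by apply Cexp_neq0.
  set (w := wmap lam v). pose proof (F_bound w (Omega_wmap lam v lam_pos Hv)) as HF.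
  assert (EW : Cexp w = (RtoC lam * Lam t)%C) by now apply Cexp_wmap.
  rewrite Cmod_mult, Cmod_Cexp, EW, Cmod_mult, Cmod_R, Rabs_pos_eq in HF by lra.
  set (k := (INR m - 1) / INR m) in *.
  assert (Hk : 0 <= k <= 1).
  { unfold k. split; [apply Rdiv_le_0_compat; lra|]. apply Rle_div_l; lra. }
  replace (Re (RtoC k * w)%C) with (k * Re w) in HF by (destruct w; simpl; ring).
  assert (Eu : exp (Re w) = lam * Cmod (Lam t)).
  { rewrite <- Cmod_Cexp, EW, Cmod_mult, Cmod_R, Rabs_pos_eq; lra. }
  assert (HL : 0 < Cmod (Lam t)) by (apply Cmod_gt_0; now apply Lam_neq0).
  assert (E1 : exp ((INR m - 1) * Re y) = exp (k * Re w) * exp (k * (Re v - Re w))).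
  { rewrite <- exp_plus. f_equal. unfold k, v. destruct y; simpl. field. lra. }
  assert (E2 : exp (k * (Re v - Re w)) <= 1 + 7 / lam).
  { destruct (Rle_dec (Re v - Re w) 0) as [L|L].
    - apply Rle_trans with (exp 0); [|rewrite exp_0; lra].
      destruct (Req_dec (k * (Re v - Re w)) 0) as [->|N]; [lra|].
      left. apply exp_increasing. nra.
    - apply Rle_trans with (exp (Re v - Re w)).
      + destruct (Req_dec k 1) as [->|N]; [rewrite Rmult_1_l; lra|].
        left. apply exp_increasing. nra.
      + unfold Rminus. rewrite exp_plus, exp_Ropp, Eu.
        replace (exp (Re v)) with (Cmod t) by (unfold t; apply Cmod_Cexp).
        pose proof (Cmod_le_Lam t Ht).
        apply Rle_trans with (7 * Cmod (Lam t) * / (lam * Cmod (Lam t))).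
        * apply Rmult_le_compat_r; auto. left. apply Rinv_0_lt_compat.
          now apply Rmult_lt_0_compat.
        * replace (7 * Cmod (Lam t) * / (lam * Cmod (Lam t))) with (7 / lam) by (field; lra).
          lra. }
  unfold Hfun. fold v. fold w. rewrite Cmod_mult, Cmod_Cexp.
  replace (Re (RtoC (INR m - 1) * y)%C) with ((INR m - 1) * Re y) by (destruct y; simpl; ring).
  rewrite E1. pose proof (exp_pos (k * (Re v - Re w))) as P1.
  apply Rle_trans with (A * exp (B * (lam * Cmod (Lam t))) * (1 + 7 / lam)).
  { rewrite <- Rmult_assoc. apply Rmult_le_compat; auto.
    - apply Rmult_le_pos; [apply Cmod_ge_0|left; apply exp_pos].
    - lra. }
  replace (A * (1 + 7 / lam) * exp (be * (PI / 2) + 2 * be * ln 2 + (b - be) * ln 2) *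
    exp (- b * ln (Cmod (1 - t)))) with
    (A * (exp (be * (PI / 2) + 2 * be * ln 2 + (b - be) * ln 2) *
    exp (- b * ln (Cmod (1 - t)))) * (1 + 7 / lam)) by ring.
  apply Rmult_le_compat_r; [lra|]. apply Rmult_le_compat_l; [lra|].
  rewrite <- exp_plus.
  destruct (Lam_bounds t Ht) as [_ [Hq Hp]].
  assert (Hs : 0 < Cmod (1 - t)) by (apply Cmod_gt_0, Re_pos_neq0, Re_1_sub, Ht).
  assert (Hs2 : ln (Cmod (1 - t)) <= ln 2).
  { apply ln_le; auto. eapply Rle_trans; [apply Cmod_sub_triangle|]. rewrite Cmod_1. lra. }
  set (l := ln (Cmod (1 - t))) in *.
  assert (Hl2 : 0 < ln 2) by (rewrite <- ln_1; apply ln_increasing; lra).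
  assert (Hmod : Cmod (Lam t) <= Rabs l + PI / 2).
  { eapply Rle_trans; [apply Cmod_le_Rabs|]. rewrite Hp, Rabs_Ropp.
    assert (Rabs (Im (Lam t)) <= PI / 2) by (apply Rabs_le; lra). lra. }
  assert (Habs : Rabs l <= - l + 2 * ln 2).
  { unfold Rabs. destruct (Rcase_abs l); lra. }
  assert (Hfin : B * (lam * Cmod (Lam t)) <=
    be * (PI / 2) + 2 * be * ln 2 + (b - be) * ln 2 + - b * l).
  { replace (B * (lam * Cmod (Lam t))) with (be * Cmod (Lam t)) by (unfold be; ring).
    assert (be * Cmod (Lam t) <= be * (- l + 2 * ln 2 + PI / 2))
      by (apply Rmult_le_compat_l; lra).
    assert (0 <= (b - be) * (ln 2 - l)) by (apply Rmult_le_pos; lra). nra. }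
  destruct Hfin as [L|E]; [left; now apply exp_increasing|rewrite E; lra].
Qed.

End Uniformization.

(** * Growth of the Cauchy coefficients *)

Lemma ex_RInt_cont (f : R -> R) (a b : R) :
  (forall x, continuous f x) -> ex_RInt f a b.
Proof.
  intros H. apply (ex_RInt_continuous (V := R_CompleteNormedModule)). intros; apply H.
Qed.

Section Periodic.

Variables (f : R -> R) (T : R).
Hypothesis f_cont : forall x, continuous f x.
Hypothesis f_per : forall x, f (x + T) = f x.

Lemma RInt_translate (a b : R) : RInt f (a + T) (b + T) = RInt f a b.
Proof.
  pose proof (RInt_comp_lin (V := R_CompleteNormedModule) f 1 T a b) as E.
  rewrite !Rmult_1_l in E. rewrite <- E by now apply ex_RInt_cont.
  apply RInt_ext. intros x _. unfold scal; simpl; unfold mult; simpl.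
  rewrite !Rmult_1_l. apply f_per.
Qed.

Lemma RInt_period_shift (a b : R) : RInt f a (a + T) = RInt f b (b + T).
Proof.
  pose proof (RInt_Chasles (V := R_CompleteNormedModule) f a b (a + T)
    (ex_RInt_cont _ _ _ f_cont) (ex_RInt_cont _ _ _ f_cont)) as E1.
  pose proof (RInt_Chasles (V := R_CompleteNormedModule) f b (a + T) (b + T)
    (ex_RInt_cont _ _ _ f_cont) (ex_RInt_cont _ _ _ f_cont)) as E2.
  rewrite RInt_translate in E2. unfold plus in E1, E2; simpl in E1, E2. lra.
Qed.

Lemma RInt_period_multiple (n : nat) (a : R) :
  RInt f a (a + INR n * T) = INR n * RInt f a (a + T).
Proof.
  induction n as [|n IH].
  - simpl. rewrite !Rmult_0_l, Rplus_0_r. exact (RInt_point (V := R_CompleteNormedModule) a f).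
  - pose proof (RInt_Chasles (V := R_CompleteNormedModule) f a (a + INR n * T)
      (a + INR (S n) * T) (ex_RInt_cont _ _ _ f_cont) (ex_RInt_cont _ _ _ f_cont)) as E.
    rewrite <- E, IH. rewrite S_INR.
    replace (a + (INR n + 1) * T) with (a + INR n * T + T) by ring.
    rewrite (RInt_period_shift (a + INR n * T) a).
    unfold plus; simpl. ring.
Qed.

(** When [theta] makes one turn, [m * theta] makes [m]: the integral over the [tau] circle reduces
    to one over the [t] circle. *)
Lemma RInt_period_dilate (m : nat) (L : R) : (1 <= m)%nat -> T = 2 * L ->
  RInt (fun x => f (INR m * x)) (- L) L = RInt f (- L) L.
Proof.
  intros Hm HT. assert (Hp : 1 <= INR m) by (replace 1 with (INR 1) by reflexivity; now apply le_INR).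
  assert (E : INR m * RInt (fun x => f (INR m * x)) (- L) L = INR m * RInt f (- L) L).
  { pose proof (RInt_comp_lin (V := R_CompleteNormedModule) f (INR m) 0 (- L) L) as E1.
    rewrite !Rplus_0_r in E1. specialize (E1 (ex_RInt_cont _ _ _ f_cont)).
    pose proof (RInt_period_multiple m (INR m * - L)) as E2.
    replace (INR m * - L + INR m * T) with (INR m * L) in E2 by (rewrite HT; ring).
    rewrite E2 in E1.
    rewrite (RInt_period_shift (INR m * - L) (- L)) in E1.
    replace (- L + T) with L in E1 by (rewrite HT; ring).
    rewrite <- E1. symmetry.
    transitivity (RInt (fun y => scal (INR m) (f (INR m * y))) (- L) L).
    - apply RInt_ext. intros x _. rewrite Rplus_0_r. reflexivity.
    - apply (RInt_scal (V := R_CompleteNormedModule)).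
      apply ex_RInt_cont. intros x.
      apply (continuous_comp (U := R_UniformSpace) (V := R_UniformSpace) (fun x => INR m * x) f);
        [|apply f_cont].
      apply (continuous_scal_r (K := R_AbsRing) (V := R_NormedModule) (INR m) (fun x => x)).
      apply continuous_id. }
  apply Rmult_eq_reg_l in E; auto. lra.
Qed.

End Periodic.

(** * Integral of a power of [Cmod (1 - t)] over a circle *)

Lemma sin_ge_third (x : R) : 0 <= x <= 2 -> x / 3 <= sin x.
Proof.
  intros H. pose proof PI2_3_2.
  destruct (sin_bound x 0) as [L _]; [lra|lra|].
  unfold sin_approx, sin_term in L. simpl in L.
  assert (E : -1 * 1 * (x * (x * (x * 1)) / (1 + 1 + 1 + 1 + 1 + 1)) = - (x * x * x / 6)) by field.
  nra.
Qed.

Lemma one_sub_cos_ge (phi : R) : - PI <= phi <= PI -> phi * phi / 18 <= 1 - cos phi.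
Proof.
  intros H.
  replace (cos phi) with (1 - 2 * sin (phi / 2) * sin (phi / 2))
    by (rewrite <- cos_2a_sin; f_equal; field).
  pose proof PI_4.
  destruct (Rle_dec 0 phi) as [L|L].
  - pose proof (sin_ge_third (phi / 2) ltac:(lra)). nra.
  - pose proof (sin_ge_third (- (phi / 2)) ltac:(lra)) as K. rewrite sin_neg in K. nra.
Qed.

(** For [r = exp xi], the squared modulus is [(1 - r) ^ 2 + 2 * r * (1 - cos phi)], and [/ 2 <= r]
    makes it at least [(1 - r) ^ 2 + phi ^ 2 / 18]. Then [(u + v) ^ 2 <= 2 * u ^ 2 + 2 * v ^ 2]
    gives the denominator [36 = 6 ^ 2]. *)
Lemma Cmod_1_sub_lower (xi phi : R) : xi < 0 -> / 2 <= exp xi -> - PI <= phi <= PI ->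
  (1 - exp xi + Rabs phi) / 6 <= Cmod (1 - Cexp (xi, phi)).
Proof.
  intros Hx He Hp. set (r := exp xi) in *.
  assert (Hr : r < 1) by (unfold r; rewrite <- exp_0; now apply exp_increasing).
  pose proof (Rabs_pos phi) as Ha.
  rewrite <- (sqrt_Rsqr ((1 - r + Rabs phi) / 6)) by lra.
  unfold Cmod. apply sqrt_le_1_alt. unfold Cexp; simpl. fold r.
  pose proof (one_sub_cos_ge phi Hp) as K. pose proof (sin2_cos2 phi) as E. unfold Rsqr in *.
  assert (Eab : Rabs phi * Rabs phi = phi * phi) by (rewrite <- Rabs_mult, Rabs_pos_eq; nra).
  replace ((1 + - (r * cos phi)) * ((1 + - (r * cos phi)) * 1) +
    (0 + - (r * sin phi)) * ((0 + - (r * sin phi)) * 1)) with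
    (1 - 2 * r * cos phi + r * r * (sin phi * sin phi + cos phi * cos phi)) by ring.
  rewrite E.
  assert (K2 : phi * phi / 18 <= 2 * r * (1 - cos phi)) by (pose proof (COS_bound phi); nra).
  assert (K3 : (1 - r + Rabs phi) * (1 - r + Rabs phi)
    <= 2 * ((1 - r) * (1 - r)) + 2 * (phi * phi)).
  { rewrite <- Eab. pose proof (Rle_0_sqr (1 - r - Rabs phi)) as S. unfold Rsqr in S. nra. }
  pose proof (Rle_0_sqr (1 - r)) as S. unfold Rsqr in S. pose proof (Rle_0_sqr phi) as S'.
  unfold Rsqr in S'.
  replace (1 - 2 * r * cos phi + r * r * 1) with ((1 - r) * (1 - r) + 2 * r * (1 - cos phi))
    by ring.
  replace ((1 - r + Rabs phi) / 6 * ((1 - r + Rabs phi) / 6)) with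
    ((1 - r + Rabs phi) * (1 - r + Rabs phi) / 36) by field.
  lra.
Qed.

Definition circ (b xi phi : R) : R := exp (- b * ln (Cmod (1 - Cexp (xi, phi)))).

Lemma Cmod_1_sub_pos (xi phi : R) : xi < 0 -> 0 < Cmod (1 - Cexp (xi, phi)).
Proof.
  intros H. apply Cmod_gt_0, Re_pos_neq0, Re_1_sub, Cmod_Cexp_lt1. exact H.
Qed.

Lemma circ_cont (b xi phi : R) : xi < 0 -> continuous (circ b xi) phi.
Proof.
  intros H. unfold circ.
  apply (continuous_comp (fun p => - b * ln (Cmod (1 - Cexp (xi, p)))) exp).
  - apply (continuous_scal_r (K := R_AbsRing) (V := R_NormedModule) (- b)
      (fun p => ln (Cmod (1 - Cexp (xi, p))))).
    apply (continuous_comp (fun p => Cmod (1 - Cexp (xi, p))) ln).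
    + apply (rcont_Cmod (fun p => (1 - Cexp (xi, p))%C)).
      apply (rcont_minus (fun _ => RtoC 1) (fun p => Cexp (xi, p))); [apply rcont_const|].
      apply rcont_vline, cdiff_ccont, cdiff_Cexp.
    + apply continuous_ln. now apply Cmod_1_sub_pos.
  - apply (ex_derive_continuous (K := R_AbsRing) (V := R_NormedModule)).
    auto_derive. auto.
Qed.

Lemma circ_period (b xi phi : R) : circ b xi (phi + 2 * PI) = circ b xi phi.
Proof.
  unfold circ. do 4 f_equal. 
  replace (xi, phi + 2 * PI) with (Cplus (xi, phi) (0, 2 * INR 1 * PI))
    by (apply Ceq; simpl; ring).
  rewrite Cexp_period. reflexivity.
Qed.

(** The primitive is [- (d + p) ^ (1 - b) / (b - 1)], and [1 < b] gives the other endpoint a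
    favourable sign. For [b <= 1] no bound of order [d ^ (1 - b)] holds as [d] tends to [0], whence
    the restriction on [b] in the coefficient growth. *)
Lemma RInt_power_shift (b d : R) : 1 < b -> 0 < d ->
  RInt (fun p => exp (- b * ln (d + p))) 0 PI <= exp ((1 - b) * ln d) / (b - 1).
Proof.
  intros Hb Hd. pose proof PI_RGT_0 as HPI.
  assert (E : is_RInt (fun p => exp (- b * ln (d + p))) 0 PI
    ((exp ((1 - b) * ln d) - exp ((1 - b) * ln (d + PI))) / (b - 1))).
  { apply (is_RInt_primitive (fun p => - exp ((1 - b) * ln (d + p)) / (b - 1))).
    - intros x Hx. rewrite Rmin_left, Rmax_right in Hx by lra. auto_derive; [lra|].
      replace (exp (- b * ln (d + x))) with (exp ((1 - b) * ln (d + x)) * / (d + x)).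
      + field. lra.
      + rewrite <- (exp_ln (d + x)) at 2 by lra. rewrite <- exp_Ropp, <- exp_plus.
        f_equal. ring.
    - intros x Hx. rewrite Rmin_left, Rmax_right in Hx by lra.
      apply (ex_derive_continuous (K := R_AbsRing) (V := R_NormedModule)).
      auto_derive. lra.
    - rewrite Rplus_0_r. field. lra. }
  rewrite (is_RInt_unique (V := R_CompleteNormedModule) _ _ _ _ E).
  apply Rmult_le_compat_r; [left; apply Rinv_0_lt_compat; lra|].
  pose proof (exp_pos ((1 - b) * ln (d + PI))). lra.
Qed.

Lemma RInt_circ_bound (b xi : R) : 1 < b -> xi < 0 -> / 2 <= exp xi ->
  RInt (circ b xi) (- PI) PI <=
  2 * exp (b * ln 6) / (b - 1) * exp ((1 - b) * ln (1 - exp xi)).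
Proof.
  intros Hb Hx He. pose proof PI_RGT_0 as HPI. set (d := 1 - exp xi).
  assert (Hd : 0 < d) by (unfold d; pose proof (exp_increasing xi 0 Hx); rewrite exp_0 in *; lra).
  assert (Ex : forall a c, ex_RInt (circ b xi) a c)
    by (intros; apply ex_RInt_cont; intros; now apply circ_cont).
  assert (Pt : forall p, - PI <= p <= PI ->
    circ b xi p <= exp (b * ln 6) * exp (- b * ln (d + Rabs p))).
  { intros p Hp. rewrite <- exp_plus. unfold circ.
    pose proof (Cmod_1_sub_lower xi p Hx He Hp) as K. fold d in K.
    pose proof (Rabs_pos p).
    assert (L : ln ((d + Rabs p) / 6) <= ln (Cmod (1 - Cexp (xi, p)))) by (apply ln_le; lra).
    unfold Rdiv in L. rewrite ln_mult, ln_Rinv in L by lra.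
    assert (LL : - b * ln (Cmod (1 - Cexp (xi, p))) <= b * ln 6 + - b * ln (d + Rabs p)) by nra.
    destruct LL as [LL|LL]; [left; now apply exp_increasing|rewrite LL; lra]. }
  assert (Exd : ex_RInt (fun p => exp (- b * ln (d + p))) 0 PI).
  { apply (ex_RInt_continuous (V := R_CompleteNormedModule)). intros x Hx'.
    rewrite Rmin_left, Rmax_right in Hx' by lra.
    apply (ex_derive_continuous (K := R_AbsRing) (V := R_NormedModule)). auto_derive. lra. }
  set (V := exp ((1 - b) * ln d) / (b - 1)).
  assert (Half : RInt (fun p => exp (b * ln 6) * exp (- b * ln (d + p))) 0 PI <= exp (b * ln 6) * V).
  { pose proof (RInt_scal (V := R_CompleteNormedModule) (fun p => exp (- b * ln (d + p)))
      0 PI (exp (b * ln 6)) Exd) as E.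
    unfold scal in E; simpl in E; unfold mult in E; simpl in E. rewrite E.
    apply Rmult_le_compat_l; [left; apply exp_pos|]. now apply RInt_power_shift. }
  assert (H1 : RInt (circ b xi) 0 PI <= exp (b * ln 6) * V).
  { eapply Rle_trans; [|exact Half]. apply RInt_le; auto; [lra| |].
    - exact (ex_RInt_scal (V := R_CompleteNormedModule) _ _ _ (exp (b * ln 6)) Exd).
    - intros x Hxx. rewrite <- (Rabs_pos_eq x) at 2 by lra. apply Pt. lra. }
  assert (H2 : RInt (circ b xi) (- PI) 0 <= exp (b * ln 6) * V).
  { eapply Rle_trans; [|exact Half].
    pose proof (RInt_comp_lin (V := R_CompleteNormedModule) (circ b xi) (-1) 0 0 PI) as E.
    replace (-1 * 0 + 0) with 0 in E by ring. replace (-1 * PI + 0) with (- PI) in E by ring.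
    specialize (E (Ex _ _)).
    assert (E2 : RInt (circ b xi) (- PI) 0 = RInt (fun p => circ b xi (- p)) 0 PI).
    { rewrite <- (opp_RInt_swap (V := R_CompleteNormedModule)) by apply Ex.
      rewrite <- E, <- (RInt_opp (V := R_CompleteNormedModule)).
      - apply RInt_ext. intros x _. unfold opp, scal; simpl; unfold mult; simpl.
        replace (-1 * x + 0) with (- x) by ring. ring.
      - apply ex_RInt_cont. intros x.
        apply (continuous_scal_r (K := R_AbsRing) (V := R_NormedModule) (-1)).
        apply (continuous_comp (fun x => -1 * x + 0) (circ b xi)); [|now apply circ_cont].
        apply (ex_derive_continuous (K := R_AbsRing) (V := R_NormedModule)). auto_derive. auto. }
    rewrite E2. apply RInt_le; [lra| | |].
    - apply ex_RInt_cont. intros x.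
      apply (continuous_comp (fun x => - x) (circ b xi)); [|now apply circ_cont].
      apply (ex_derive_continuous (K := R_AbsRing) (V := R_NormedModule)). auto_derive. auto.
    - exact (ex_RInt_scal (V := R_CompleteNormedModule) _ _ _ (exp (b * ln 6)) Exd).
    - intros x Hxx. rewrite <- (Rabs_pos_eq x) at 2 by lra. rewrite <- (Rabs_Ropp x). apply Pt. lra. }
  pose proof (RInt_Chasles (V := R_CompleteNormedModule) (circ b xi) (- PI) 0 PI
    (Ex _ _) (Ex _ _)) as E.
  unfold plus in E; simpl in E. rewrite <- E.
  replace (2 * exp (b * ln 6) / (b - 1) * exp ((1 - b) * ln d)) with
    (2 * (exp (b * ln 6) * V)) by (unfold V; field; lra).
  lra.
Qed.

(** The coefficient being assumed independent of the radius, the radius may follow [n]: for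
    [Cmod t = 1 - 1 / (n + 2)] the factor [Cmod tau ^ (- n)] stays below [exp 1], while the circle
    integral is of order [(n + 2) ^ (b - 1)]. The shift by [2] keeps the radius at least [/ 2], as
    [RInt_circ_bound] asks. *)
Lemma coef_growth (m : nat) (H : C -> C) (K b : R) (c : nat -> C) :
  (1 <= m)%nat -> 1 < b -> 0 < K ->
  (forall w, Re w < 0 -> cdiff H w) ->
  (forall w, Re w < 0 ->
    Cmod (H w) <= K * exp (- b * ln (Cmod (1 - Cexp (RtoC (INR m) * w))))) ->
  (forall x1 n, x1 < 0 -> cauchy_coef H x1 n = c n) ->
  exists K', 0 < K' /\ forall n, Cmod (c n) <= K' * exp ((b - 1) * ln (INR n + 2)).
Proof.
  intros Hm Hb HK Hd HB Hc. pose proof PI_RGT_0 as HPI.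
  assert (Hm1 : 1 <= INR m) by (replace 1 with (INR 1) by reflexivity; now apply le_INR).
  set (K1 := 2 * exp (b * ln 6) / (b - 1)).
  assert (HK1 : 0 < K1).
  { unfold K1. apply Rdiv_lt_0_compat; [|lra]. pose proof (exp_pos (b * ln 6)). lra. }
  assert (Hi : 0 < / (2 * PI)) by (apply Rinv_0_lt_compat; lra).
  pose proof (exp_pos 1) as He1.
  exists (/ (2 * PI) * (exp 1 * (K * K1))).
  split. { apply Rmult_lt_0_compat; [|apply Rmult_lt_0_compat; [|apply Rmult_lt_0_compat]]; assumption. }
  intros n. pose proof (pos_INR n) as Hn.
  set (r := 1 - / (INR n + 2)).
  assert (Hin : 0 < / (INR n + 2) <= / 2).
  { split; [apply Rinv_0_lt_compat; lra|apply Rinv_le_contravar; lra]. }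
  assert (Hr : / 2 <= r < 1) by (unfold r; lra).
  set (xi := ln r). set (x1 := xi / INR m).
  assert (Hxi : xi < 0) by (unfold xi; rewrite <- ln_1; apply ln_increasing; lra).
  assert (Hx1 : x1 < 0).
  { unfold x1. apply Rmult_lt_reg_r with (INR m); [lra|]. unfold Rdiv.
    rewrite Rmult_assoc, Rinv_l by lra. lra. }
  assert (Exi : exp xi = r) by (unfold xi; apply exp_ln; lra).
  rewrite <- (Hc x1 n Hx1).
  assert (Ccirc : forall x, continuous (circ b xi) x) by (intros; now apply circ_cont).
  assert (Ccm : forall x, continuous (fun x => circ b xi (INR m * x)) x).
  { intros x. apply (continuous_comp (fun x => INR m * x) (circ b xi)); [|apply Ccirc].
    apply (continuous_scal_r (K := R_AbsRing) (V := R_NormedModule) (INR m) (fun x => x)).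
    apply continuous_id. }
  set (I := RInt (fun th => circ b xi (INR m * th)) (- PI) PI).
  assert (HI : is_RInt (fun th => K * circ b xi (INR m * th)) (- PI) PI (K * I)).
  { apply (is_RInt_scal (V := R_NormedModule)).
    apply (RInt_correct (V := R_CompleteNormedModule)). now apply ex_RInt_cont. }
  assert (EI : I <= K1 * exp ((b - 1) * ln (INR n + 2))).
  { unfold I. rewrite (RInt_period_dilate (circ b xi) (2 * PI)); auto;
      [|intros; apply circ_period].
    eapply Rle_trans; [apply RInt_circ_bound; auto; lra|]. fold K1. right. f_equal. f_equal.
    rewrite Exi. unfold r. replace (1 - (1 - / (INR n + 2))) with (/ (INR n + 2)) by ring.
    rewrite ln_Rinv by lra. ring. }
  eapply Rle_trans.
  { apply (cauchy_coef_bound H x1) with (L := K * I)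
      (g := fun th => K * circ b xi (INR m * th)); auto.
    - intros w Hw. apply Hd. lra.
    - intros th Hth. unfold circ.
      replace (xi, INR m * th) with (RtoC (INR m) * (x1, th))%C.
      + apply HB. exact Hx1.
      + apply Ceq; simpl; unfold x1; field; lra. }
  rewrite !Rmult_assoc. apply Rmult_le_compat_l; [lra|].
  apply Rmult_le_compat; [left; apply exp_pos| | |].
  - apply Rmult_le_pos; [lra|]. apply RInt_ge_0; [lra|now apply ex_RInt_cont|].
    intros; left; apply exp_pos.
  - assert (Hx : - (INR n * x1) <= 1).
    { assert (Hl : - xi <= / (INR n + 1)).
      { unfold xi. rewrite <- ln_Rinv by lra.
        replace (/ r) with (1 + / (INR n + 1)) by (unfold r; field; split; lra).
        pose proof (exp_ineq1_le (/ (INR n + 1))) as G.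
        assert (0 < / (INR n + 1)) by (apply Rinv_0_lt_compat; lra).
        rewrite <- (ln_exp (/ (INR n + 1))) at 2. apply ln_le; lra. }
      assert (Hx : - x1 <= - xi).
      { unfold x1. replace (- (xi / INR m)) with (- xi * / INR m) by (field; lra).
        rewrite <- (Rmult_1_r (- xi)) at 2. apply Rmult_le_compat_l; [lra|].
        rewrite <- Rinv_1. apply Rinv_le_contravar; lra. }
      apply Rle_trans with (INR n * / (INR n + 1)).
      - replace (- (INR n * x1)) with (INR n * - x1) by ring.
        apply Rmult_le_compat_l; lra.
      - apply Rle_div_l; lra. }
    destruct Hx as [Hx|Hx]; [left; now apply exp_increasing|rewrite Hx; lra].
  - apply Rmult_le_compat_l; lra.
Qed.

(** * Bell polynomials and the expansion of powers of the logarithm *)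

Fixpoint rs (n : nat) (f : nat -> R) : R :=
  match n with O => 0 | S n' => rs n' f + f n' end.

Lemma rs_ext (n : nat) (f g : nat -> R) :
  (forall i, (i < n)%nat -> f i = g i) -> rs n f = rs n g.
Proof.
  induction n as [|n IH]; intros H; simpl; [reflexivity|].
  rewrite IH by (intros; apply H; lia). rewrite H by lia. reflexivity.
Qed.

Lemma rs_Sl (n : nat) (f : nat -> R) : rs (S n) f = f O + rs n (fun i => f (S i)).
Proof.
  induction n as [|n IH]; [simpl; ring|].
  change (rs (S (S n)) f) with (rs (S n) f + f (S n)). rewrite IH. simpl. ring.
Qed.

Lemma rs_minus (n : nat) (f g : nat -> R) :
  rs n (fun i => f i - g i) = rs n f - rs n g.
Proof. induction n as [|n IH]; simpl; [ring|rewrite IH; ring]. Qed.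

Lemma rs_scal (n : nat) (c : R) (f : nat -> R) : rs n (fun i => c * f i) = c * rs n f.
Proof. induction n as [|n IH]; simpl; [ring|rewrite IH; ring]. Qed.

Lemma rs_plus (n : nat) (f g : nat -> R) :
  rs n (fun i => f i + g i) = rs n f + rs n g.
Proof. induction n as [|n IH]; simpl; [ring|rewrite IH; ring]. Qed.

Lemma rs_swap (a b : nat) (f : nat -> nat -> R) :
  rs a (fun i => rs b (f i)) = rs b (fun j => rs a (fun i => f i j)).
Proof.
  induction a as [|a IH]; simpl.
  - induction b as [|b IHb]; simpl; [reflexivity|rewrite <- IHb; ring].
  - rewrite IH, <- rs_plus. reflexivity.
Qed.

Lemma rs_zero (n : nat) (f : nat -> R) : (forall i, (i < n)%nat -> f i = 0) -> rs n f = 0.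
Proof.
  induction n as [|n IH]; intros H; simpl; [reflexivity|].
  rewrite IH by (intros; apply H; lia). rewrite H by lia. ring.
Qed.

Lemma rs_extend (n k : nat) (f : nat -> R) : (n <= k)%nat ->
  (forall i, (n <= i)%nat -> f i = 0) -> rs k f = rs n f.
Proof.
  intros H Hf. induction H as [|k H IH]; [reflexivity|].
  simpl. rewrite IH, Hf by lia. ring.
Qed.

Lemma rs_Rabs_le (n : nat) (f g : nat -> R) :
  (forall i, (i < n)%nat -> Rabs (f i) <= g i) -> Rabs (rs n f) <= rs n g.
Proof.
  induction n as [|n IH]; intros H; simpl; [rewrite Rabs_R0; lra|].
  eapply Rle_trans; [apply Rabs_triang|].
  apply Rplus_le_compat; [apply IH; intros; apply H; lia|apply H; lia].
Qed.

Lemma rs_sum_f_R0 (n : nat) (f : nat -> R) : rs (S n) f = sum_f_R0 f n.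
Proof. induction n as [|n IH]; [simpl; ring|]. rewrite tech5, <- IH. reflexivity. Qed.

Lemma sum1_rs (n : nat) (f : nat -> R) : sum1 n f = rs n (fun i => f (S i)).
Proof. induction n as [|n IH]; simpl; [reflexivity|rewrite IH; reflexivity]. Qed.

Definition lsum {T : Type} (l : list T) (f : T -> R) : R := Rsum_list (map f l).

Lemma lsum_cons {T : Type} (a : T) (l : list T) (f : T -> R) :
  lsum (a :: l) f = f a + lsum l f.
Proof. reflexivity. Qed.

Lemma lsum_app {T : Type} (l1 l2 : list T) (f : T -> R) :
  lsum (l1 ++ l2) f = lsum l1 f + lsum l2 f.
Proof.
  induction l1 as [|a l1 IH]; [unfold lsum; simpl; ring|].
  simpl app. rewrite !lsum_cons, IH. ring.
Qed.

Lemma lsum_map {T U : Type} (g : T -> U) (l : list T) (f : U -> R) :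
  lsum (map g l) f = lsum l (fun a => f (g a)).
Proof. unfold lsum. rewrite map_map. reflexivity. Qed.

Lemma lsum_flat_map {T U : Type} (g : T -> list U) (l : list T) (f : U -> R) :
  lsum (flat_map g l) f = lsum l (fun a => lsum (g a) f).
Proof.
  induction l as [|a l IH]; [reflexivity|]. simpl. rewrite lsum_app, lsum_cons, IH. reflexivity.
Qed.

Lemma lsum_ext {T : Type} (l : list T) (f g : T -> R) :
  (forall a, f a = g a) -> lsum l f = lsum l g.
Proof. intros H. unfold lsum. f_equal. apply map_ext, H. Qed.

Lemma lsum_scal {T : Type} (l : list T) (c : R) (f : T -> R) :
  lsum l (fun a => c * f a) = c * lsum l f.
Proof.
  induction l as [|a l IH]; [unfold lsum; simpl; ring|]. rewrite !lsum_cons, IH. ring.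
Qed.

Lemma lsum_plus {T : Type} (l : list T) (f g : T -> R) :
  lsum l (fun a => f a + g a) = lsum l f + lsum l g.
Proof.
  induction l as [|a l IH]; [unfold lsum; simpl; ring|]. rewrite !lsum_cons, IH. ring.
Qed.

Lemma lsum_zero {T : Type} (l : list T) : lsum l (fun _ => 0) = 0.
Proof. induction l as [|a l IH]; [reflexivity|]. rewrite lsum_cons, IH. ring. Qed.

Lemma lsum_filter {T : Type} (P : T -> bool) (l : list T) (f : T -> R) :
  lsum (filter P l) f = lsum l (fun a => if P a then f a else 0).
Proof.
  induction l as [|a l IH]; [reflexivity|]. simpl filter. rewrite lsum_cons.
  destruct (P a); [rewrite lsum_cons|]; rewrite IH; ring.
Qed.

Lemma lsum_seq (n : nat) (f : nat -> R) : lsum (seq 0 n) f = rs n f.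
Proof.
  induction n as [|n IH]; [reflexivity|].
  rewrite seq_S, lsum_app, IH. unfold lsum. simpl. ring.
Qed.

Lemma rs_lsum {T : Type} (n : nat) (l : list T) (f : nat -> T -> R) :
  rs n (fun i => lsum l (f i)) = lsum l (fun a => rs n (fun i => f i a)).
Proof.
  induction n as [|n IH]; simpl; [rewrite lsum_zero; reflexivity|].
  rewrite IH, <- lsum_plus. reflexivity.
Qed.

Lemma lsum_Rabs_le {T : Type} (l : list T) (f g : T -> R) :
  (forall a, Rabs (f a) <= g a) -> Rabs (lsum l f) <= lsum l g.
Proof.
  intros H. induction l as [|a l IH]; [unfold lsum; simpl; rewrite Rabs_R0; lra|].
  rewrite !lsum_cons. eapply Rle_trans; [apply Rabs_triang|].
  apply Rplus_le_compat; auto.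
Qed.

Lemma binomial_div_fact (u v : R) (p : nat) :
  rs (S p) (fun k => u ^ k / INR (fact k) * (v ^ (p - k) / INR (fact (p - k))))
  = (u + v) ^ p / INR (fact p).
Proof.
  rewrite rs_sum_f_R0, binomial. unfold Rdiv. rewrite Rmult_comm, scal_sum.
  apply sum_eq. intros k Hk. unfold Binomial.C. field.
  repeat split; apply INR_fact_neq_0.
Qed.

(** Multinomial theorem in divided powers, [binomial_div_fact] splitting off the first exponent.
    Capping the entries at [b] is harmless when [p <= b], since they add up to [p]. The starting
    index [i] is general because positions carry weights and shift in the induction. *)
Lemma multinomial (x : nat -> R) (t : R) (b n : nat) : forall i p, (p <= b)%nat ->
  lsum (lists_bounded n b) (fun ks => if Nat.eqb (sum_list ks) p
    then bell_prod_from i x ks * t ^ wsum_from i ks else 0)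
  = (rs n (fun k => x (i + k)%nat / INR (fact (i + k)) * t ^ (i + k))) ^ p / INR (fact p).
Proof.
  induction n as [|n IH]; intros i p Hp.
  - unfold lsum. simpl. destruct p as [|p]; simpl; [field|]. field. 
    change (fact p + p * fact p)%nat with (fact (S p)). apply INR_fact_neq_0.
  - cbn [lists_bounded]. rewrite lsum_flat_map.
    rewrite (lsum_ext _ _ (fun k => if Nat.leb k p then
      (x i / INR (fact i) * t ^ i) ^ k / INR (fact k) *
      ((rs n (fun k => x (S i + k)%nat / INR (fact (S i + k)) * t ^ (S i + k))) ^ (p - k)
        / INR (fact (p - k))) else 0)).
    + rewrite lsum_seq.
      rewrite (rs_extend (S p) (S b)).
      * assert (EB : rs (S n) (fun k => x (i + k)%nat / INR (fact (i + k)) * t ^ (i + k)) =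
          x i / INR (fact i) * t ^ i +
          rs n (fun k => x (S i + k)%nat / INR (fact (S i + k)) * t ^ (S i + k))).
        { rewrite rs_Sl, Nat.add_0_r. f_equal. apply rs_ext. intros k _.
          rewrite <- plus_n_Sm. reflexivity. }
        rewrite EB, <- binomial_div_fact. apply rs_ext. intros k Hk.
        replace (Nat.leb k p) with true by (symmetry; apply Nat.leb_le; lia). reflexivity.
      * lia.
      * intros k Hk. replace (Nat.leb k p) with false by (symmetry; apply Nat.leb_gt; lia).
        reflexivity.
    + intros k. rewrite lsum_map. cbn [sum_list bell_prod_from wsum_from].
      destruct (Nat.leb k p) eqn:E.
      * apply Nat.leb_le in E. rewrite <- (IH (S i) (p - k)%nat) by lia.
        rewrite <- lsum_scal. apply lsum_ext. intros ks.
        destruct (Nat.eqb_spec (sum_list ks) (p - k)) as [E1|E1];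
        destruct (Nat.eqb_spec (k + sum_list ks) p) as [E2|E2]; try lia; [|ring].
        rewrite Rpow_mult_distr, pow_add, pow_mult.
        unfold Rdiv. rewrite Rpow_mult_distr, pow_inv. field.
        repeat split; try apply pow_nonzero; apply INR_fact_neq_0.
      * apply Nat.leb_gt in E. rewrite (lsum_ext _ _ (fun _ => 0)); [apply lsum_zero|].
        intros ks. destruct (Nat.eqb_spec (k + sum_list ks) p); [lia|reflexivity].
Qed.

(** * Taylor remainders of powers and of the logarithm *)

(** Falling factorial [al * (al - 1) * ...], unfolded from the left because differentiating
    [(1 + y) ^ al] replaces [al] by [al - 1]. *)
Fixpoint ff (al : R) (p : nat) : R :=
  match p with O => 1 | S p' => al * ff (al - 1) p' end.

Lemma mvt_bound (G g : R -> R) (y M : R) : 0 <= y -> G 0 = 0 ->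
  (forall t, 0 <= t <= y -> is_derive G t (g t)) ->
  (forall t, 0 <= t <= y -> Rabs (g t) <= M) -> Rabs (G y) <= y * M.
Proof.
  intros Hy H0 Hd Hb.
  destruct (MVT_gen G 0 y g) as [c [Hc E]].
  - intros t Ht. rewrite Rmin_left, Rmax_right in Ht by lra. apply Hd; lra.
  - intros t Ht. rewrite Rmin_left, Rmax_right in Ht by lra.
    apply continuity_pt_filterlim, (ex_derive_continuous (K := R_AbsRing) (V := R_NormedModule)).
    exists (g t). apply Hd; lra.
  - rewrite Rmin_left, Rmax_right in Hc by lra.
    rewrite H0, Rminus_0_r, Rminus_0_r in E. rewrite E, Rabs_mult, (Rabs_pos_eq y), Rmult_comm by lra.
    apply Rmult_le_compat_l; [lra|]. apply Hb; lra.
Qed.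

Lemma is_derive_rs (n : nat) (f : nat -> R -> R) (g : nat -> R) (t : R) :
  (forall i, (i < n)%nat -> is_derive (f i) t (g i)) ->
  is_derive (fun s => rs n (fun i => f i s)) t (rs n g).
Proof.
  induction n as [|n IH]; intros H; simpl.
  - apply (is_derive_const (K := R_AbsRing) (V := R_NormedModule)).
  - apply (is_derive_plus (K := R_AbsRing) (V := R_NormedModule)).
    + apply IH. intros; apply H; lia.
    + apply H; lia.
Qed.

Lemma is_derive_monomial (c t : R) (i : nat) :
  is_derive (fun s => c * s ^ S i) t (c * (INR (S i) * t ^ i)).
Proof.
  apply (is_derive_scal (fun s => s ^ S i) t c). apply is_derive_Reals. exact (derivable_pt_lim_pow t (S i)).
Qed.

(** The remainder of order [S n] for [al] has derivative [al] times the remainder of order [n] for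
    [al - 1], and vanishes at [0]; hence [al] is generalised in the induction. *)
Lemma binomial_taylor (n : nat) : forall al, exists K, 0 <= K /\ forall y, 0 <= y <= 1 ->
  Rabs (exp (al * ln (1 + y)) - rs n (fun p => ff al p / INR (fact p) * y ^ p)) <= K * y ^ n.
Proof.
  induction n as [|n IH]; intros al.
  - exists (exp (Rabs al * ln 2)). split; [left; apply exp_pos|].
    intros y Hy. simpl. rewrite Rminus_0_r, Rmult_1_r.
    rewrite Rabs_pos_eq by (left; apply exp_pos).
    assert (H0 : 0 <= ln (1 + y)) by (rewrite <- ln_1; apply ln_le; lra).
    assert (H1 : ln (1 + y) <= ln 2) by (apply ln_le; lra).
    assert (H : al * ln (1 + y) <= Rabs al * ln 2).
    { apply Rle_trans with (Rabs al * ln (1 + y)).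
      - apply Rmult_le_compat_r; auto. apply Rle_abs.
      - apply Rmult_le_compat_l; auto. apply Rabs_pos. }
    destruct H as [H|H]; [left; now apply exp_increasing|rewrite H; lra].
  - destruct (IH (al - 1)) as [K [HK B]]. exists (Rabs al * K).
    split; [apply Rmult_le_pos; auto; apply Rabs_pos|].
    intros y Hy.
    replace (Rabs al * K * y ^ S n) with (y * (Rabs al * (K * y ^ n))) by (simpl; ring).
    apply (mvt_bound (fun y => exp (al * ln (1 + y))
       - rs (S n) (fun p => ff al p / INR (fact p) * y ^ p))
      (fun y => al * (exp ((al - 1) * ln (1 + y))
       - rs n (fun p => ff (al - 1) p / INR (fact p) * y ^ p)))); [lra| | |].
    + rewrite Rplus_0_r, ln_1, Rmult_0_r, exp_0, rs_Sl.
      rewrite rs_zero; [simpl; field|]. intros i _. simpl. ring.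
    + intros t Ht. rewrite Rmult_minus_distr_l.
      apply (is_derive_minus (K := R_AbsRing) (V := R_NormedModule)).
      * auto_derive; [lra|].
        replace ((al - 1) * ln (1 + t)) with (al * ln (1 + t) + - ln (1 + t)) by ring.
        rewrite exp_plus, exp_Ropp, exp_ln by lra. field. lra.
      * apply (is_derive_ext (fun s => ff al 0 / INR (fact 0) * s ^ 0 +
          rs n (fun i => ff al (S i) / INR (fact (S i)) * s ^ S i))).
        { intros s. rewrite rs_Sl. reflexivity. }
        rewrite <- rs_scal, <- (Rplus_0_l (rs n _)).
        apply (is_derive_plus (K := R_AbsRing) (V := R_NormedModule)).
        { simpl. apply (is_derive_const (K := R_AbsRing) (V := R_NormedModule)). }
        apply is_derive_rs. intros i _.
        replace (al * (ff (al - 1) i / INR (fact i) * t ^ i)) with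
          (ff al (S i) / INR (fact (S i)) * (INR (S i) * t ^ i)).
        { apply is_derive_monomial. }
        rewrite fact_simpl, mult_INR. cbn [ff]. field.
        split; [apply INR_fact_neq_0|apply not_0_INR; lia].
    + intros t Ht. rewrite Rabs_mult. apply Rmult_le_compat_l; [apply Rabs_pos|].
      eapply Rle_trans; [apply B; lra|]. apply Rmult_le_compat_l; auto.
      apply pow_incr; lra.
Qed.

Lemma geometric_rs (t : R) (n : nat) : t <> 1 -> / (1 - t) - rs n (fun i => t ^ i) = t ^ n / (1 - t).
Proof.
  intros H. induction n as [|n IH]; simpl; [field; lra|].
  replace (/ (1 - t) - (rs n (fun i => t ^ i) + t ^ n)) with
    ((/ (1 - t) - rs n (fun i => t ^ i)) - t ^ n) by ring.
  rewrite IH. field. lra.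
Qed.

(** The derivative of the remainder is the geometric remainder [t ^ n / (1 - t)], at most
    [2 * t ^ n] on this range. *)
Lemma log_taylor (n : nat) (t : R) : 0 <= t <= / 2 ->
  Rabs (- ln (1 - t) - rs n (fun i => t ^ S i / INR (S i))) <= 2 * t ^ S n.
Proof.
  intros Ht. replace (2 * t ^ S n) with (t * (2 * t ^ n)) by (simpl; ring).
  apply (mvt_bound (fun t => - ln (1 - t) - rs n (fun i => t ^ S i / INR (S i)))
    (fun t => / (1 - t) - rs n (fun i => t ^ i))); [lra| | |].
  - rewrite Rminus_0_r, ln_1, rs_zero; [ring|]. intros i _. simpl pow. unfold Rdiv. ring.
  - intros s Hs. apply (is_derive_minus (K := R_AbsRing) (V := R_NormedModule)).
    + auto_derive; [lra|]. field. lra.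
    + apply is_derive_rs. intros i _. 
      apply (is_derive_ext (fun s => / INR (S i) * s ^ S i)); [intros; apply Rmult_comm|].
      replace (s ^ i) with (/ INR (S i) * (INR (S i) * s ^ i))
        by (field; apply not_0_INR; lia).
      apply is_derive_monomial.
  - intros s Hs. rewrite geometric_rs by lra.
    assert (0 <= s ^ n) by (apply pow_le; lra).
    rewrite Rabs_pos_eq by (apply Rdiv_le_0_compat; lra).
    apply Rle_trans with (2 * s ^ n).
    + unfold Rdiv. rewrite Rmult_comm. apply Rmult_le_compat_r; auto.
      rewrite <- (Rinv_inv 2). apply Rinv_le_contravar; lra.
    + apply Rmult_le_compat_l; [lra|]. apply pow_incr; lra.
Qed.

(** [t / 2 + t ^ 2 / 3 + ...]; since [xbell i / i! = 1 / (i + 1)], the arguments of the Bell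
    polynomials are the exponential coefficients of this function. *)
Definition Yfun (t : R) : R := - ln (1 - t) / t - 1.

Definition Xpoly (n : nat) (t : R) : R :=
  rs n (fun k => xbell (1 + k) / INR (fact (1 + k)) * t ^ (1 + k)).

Lemma Yfun_Xpoly (n : nat) (t : R) : 0 < t <= / 2 ->
  Rabs (Yfun t - Xpoly n t) <= 2 * t ^ S n.
Proof.
  intros Ht. pose proof (log_taylor (S n) t ltac:(lra)) as B. rewrite rs_Sl in B.
  assert (E : rs n (fun i => t ^ S (S i) / INR (S (S i))) = t * Xpoly n t).
  { unfold Xpoly. rewrite <- rs_scal. apply rs_ext. intros i _. unfold xbell.
    replace (1 + i + 1)%nat with (S (S i)) by lia. change (1 + i)%nat with (S i).
    cbn [pow]. field. split; [apply not_0_INR; lia|apply INR_fact_neq_0]. }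
  rewrite E in B.
  replace (Yfun t - Xpoly n t) with
    ((- ln (1 - t) - (t ^ 1 / INR 1 + t * Xpoly n t)) * / t)
    by (unfold Yfun; simpl; field; lra).
  rewrite Rabs_mult, (Rabs_pos_eq (/ t)) by (left; apply Rinv_0_lt_compat; lra).
  apply Rle_trans with (2 * t ^ S (S n) * / t).
  - apply Rmult_le_compat_r; auto. left; apply Rinv_0_lt_compat; lra.
  - right. simpl. field. lra.
Qed.

Lemma Yfun_bounds (t : R) : 0 < t <= / 2 -> 0 <= Yfun t <= 2 * t.
Proof.
  intros Ht. pose proof (Yfun_Xpoly 0 t Ht) as B. unfold Xpoly in B. simpl in B.
  rewrite Rminus_0_r, Rmult_1_r in B. pose proof (Rle_abs (Yfun t)).
  split; [|lra]. unfold Yfun.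
  assert (L : t <= - ln (1 - t)).
  { pose proof (exp_ineq1_le (- t)) as G. 
    assert (ln (1 - t) <= - t); [|lra]. rewrite <- (ln_exp (- t)). apply ln_le; lra. }
  assert (1 <= - ln (1 - t) / t); [|lra]. apply Rle_div_r; lra.
Qed.

Lemma pow_sub_le (a b : R) (p : nat) : Rabs a <= 1 -> Rabs b <= 1 ->
  Rabs (a ^ p - b ^ p) <= INR p * Rabs (a - b).
Proof.
  intros Ha Hb. induction p as [|p IH].
  - simpl. rewrite Rminus_diag, Rabs_R0. lra.
  - rewrite S_INR. simpl pow.
    replace (a * a ^ p - b * b ^ p) with (a * (a ^ p - b ^ p) + b ^ p * (a - b)) by ring.
    eapply Rle_trans; [apply Rabs_triang|]. rewrite !Rabs_mult.
    assert (Rabs (b ^ p) <= 1).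
    { rewrite <- RPow_abs. rewrite <- (pow1 p). apply pow_incr. split; [apply Rabs_pos|auto]. }
    pose proof (Rabs_pos (a ^ p - b ^ p)). pose proof (Rabs_pos (a - b)). nra.
Qed.

(** * Expansion of [psi] at [0+] *)

Definition rpoly (c : nat -> R) (n : nat) (t : R) : R := rs n (fun j => c j * t ^ j).

Definition rbigO (n : nat) (f : R -> R) : Prop :=
  exists K X, 0 < X /\ 0 <= K /\ forall t, 0 < t < X -> Rabs (f t) <= K * t ^ n.

Lemma rbigO_plus (n : nat) (f g : R -> R) :
  rbigO n f -> rbigO n g -> rbigO n (fun t => f t + g t).
Proof.
  intros [K [X [HX [HK B]]]] [K' [X' [HX' [HK' B']]]].
  exists (K + K'), (Rmin X X'). split; [now apply Rmin_pos|]. split; [lra|].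
  intros t Ht. pose proof (Rmin_l X X'). pose proof (Rmin_r X X').
  eapply Rle_trans; [apply Rabs_triang|].
  specialize (B t ltac:(lra)). specialize (B' t ltac:(lra)). lra.
Qed.

Lemma rbigO_scal (n : nat) (c : R) (f : R -> R) : rbigO n f -> rbigO n (fun t => c * f t).
Proof.
  intros [K [X [HX [HK B]]]]. exists (Rabs c * K), X.
  split; auto. split; [apply Rmult_le_pos; auto; apply Rabs_pos|].
  intros t Ht. rewrite Rabs_mult, Rmult_assoc.
  apply Rmult_le_compat_l; [apply Rabs_pos|auto].
Qed.

Lemma rbigO_ext (n : nat) (f g : R -> R) (X : R) : 0 < X ->
  (forall t, 0 < t < X -> f t = g t) -> rbigO n f -> rbigO n g.
Proof.
  intros HX E [K [X' [HX' [HK B]]]]. exists K, (Rmin X X').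
  split; [now apply Rmin_pos|]. split; auto. intros t Ht.
  pose proof (Rmin_l X X'). pose proof (Rmin_r X X'). rewrite <- E by lra. apply B. lra.
Qed.

Lemma rbigO_rs (n k : nat) (f : nat -> R -> R) :
  (forall i, (i < k)%nat -> rbigO n (f i)) -> rbigO n (fun t => rs k (fun i => f i t)).
Proof.
  induction k as [|k IH]; intros H; simpl.
  - exists 0, 1. repeat split; try lra. intros t Ht. rewrite Rabs_R0. lra.
  - apply rbigO_plus; [apply IH; intros; apply H; lia|apply H; lia].
Qed.

(* [psi al t = (- ln (1 - t) / t)^al]. *)
Definition psi (al t : R) : R := exp (al * ln (1 + Yfun t)).

(** Coefficient of [t ^ j] in [psi al], by the binomial series in [Yfun] and Faa di Bruno's formula;
    the term [p = 0] contributes for [j = 0] only. *)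
Definition bellco (al : R) (j : nat) : R :=
  rs (S j) (fun p => ff al p * (Bell j p xbell / INR (fact j))).

Lemma Bell_lsum (j p : nat) (x : nat -> R) : Bell j p x / INR (fact j) =
  lsum (lists_bounded j j) (fun ks => if Nat.eqb (sum_list ks) p then
    (if Nat.eqb (wsum_from 1 ks) j then bell_prod_from 1 x ks else 0) else 0).
Proof.
  unfold Bell. fold (lsum (filter (fun ks => andb (Nat.eqb (sum_list ks) p)
    (Nat.eqb (wsum_from 1 ks) j)) (lists_bounded j j))
    (fun ks => INR (fact j) * bell_prod_from 1 x ks)).
  rewrite lsum_filter. unfold Rdiv. rewrite Rmult_comm, <- lsum_scal.
  apply lsum_ext. intros ks.
  destruct (Nat.eqb (sum_list ks) p), (Nat.eqb (wsum_from 1 ks) j); simpl; try ring.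
  field. apply INR_fact_neq_0.
Qed.

Lemma rs_indicator (n w : nat) (v t : R) : (w < n)%nat ->
  rs n (fun j => (if Nat.eqb w j then v else 0) * t ^ j) = v * t ^ w.
Proof.
  induction n as [|n IH]; intros H; [lia|]. simpl.
  destruct (Nat.eq_dec w n) as [->|N].
  - rewrite Nat.eqb_refl, rs_zero; [ring|]. intros i Hi.
    destruct (Nat.eqb_spec n i); [lia|ring].
  - rewrite IH by lia. destruct (Nat.eqb_spec w n); [contradiction|ring].
Qed.

(* The order-[n] coefficient is read off from the tuples of length [n]; that the lower
   coefficients do not depend on the truncation follows from uniqueness of expansions. *)
Lemma psi_expansion_order (al : R) (n : nat) :
  exists q : nat -> R, q n = bellco al n /\
    rbigO (S n) (fun t => psi al t - rpoly q (S n) t).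
Proof.
  set (L := lists_bounded n n).
  set (q := fun j => rs (S n) (fun p => ff al p *
    lsum L (fun ks => if Nat.eqb (sum_list ks) p then
    (if Nat.eqb (wsum_from 1 ks) j then bell_prod_from 1 xbell ks else 0) else 0))).
  exists q. split.
  { unfold q, bellco. apply rs_ext. intros p _. rewrite Bell_lsum. reflexivity. }
  destruct (binomial_taylor (S n) al) as [K [HK B]].
  (* Three errors of order [S n] follow: truncating the binomial series, replacing [Yfun] by
     [Xpoly], and dropping the monomials of degree above [n] from the expanded powers. *)
  assert (A1 : rbigO (S n) (fun t => psi al t
    - rs (S n) (fun p => ff al p / INR (fact p) * Yfun t ^ p))).
  { exists (K * 2 ^ S n), (/ 2). split; [lra|]. split; [apply Rmult_le_pos; auto; apply pow_le; lra|].
    intros t Ht. pose proof (Yfun_bounds t ltac:(lra)) as HY.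
    eapply Rle_trans; [apply B; lra|]. rewrite Rmult_assoc. apply Rmult_le_compat_l; auto.
    rewrite <- Rpow_mult_distr. apply pow_incr. lra. }
  assert (A2 : rbigO (S n) (fun t => rs (S n) (fun p => ff al p / INR (fact p) *
    (Yfun t ^ p - Xpoly n t ^ p)))).
  { apply rbigO_rs. intros p _. apply rbigO_scal.
    exists (INR p * 2), (/ 4). split; [lra|]. split; [pose proof (pos_INR p); lra|].
    intros t Ht. pose proof (Yfun_bounds t ltac:(lra)) as HY.
    pose proof (Yfun_Xpoly n t ltac:(lra)) as HX.
    assert (Hp : t ^ S n <= t).
    { simpl. rewrite <- (Rmult_1_r t) at 3. apply Rmult_le_compat_l; [lra|].
      rewrite <- (pow1 n). apply pow_incr. lra. }
    assert (HX1 : Rabs (Xpoly n t) <= 1).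
    { replace (Xpoly n t) with (Yfun t + - (Yfun t - Xpoly n t)) by ring.
      eapply Rle_trans; [apply Rabs_triang|]. rewrite Rabs_Ropp, (Rabs_pos_eq (Yfun t)); lra. }
    eapply Rle_trans; [apply pow_sub_le; auto; rewrite Rabs_pos_eq; lra|].
    rewrite Rmult_assoc. apply Rmult_le_compat_l; [apply pos_INR|auto]. }
  assert (A3 : rbigO (S n) (fun t => rs (S n) (fun p => ff al p / INR (fact p) * Xpoly n t ^ p)
    - rpoly q (S n) t)).
  { set (M := lsum L (fun ks => rs (S n) (fun p => Rabs (ff al p * bell_prod_from 1 xbell ks)))).
    exists M, 1. split; [lra|].
    assert (Hpos : forall ks, 0 <= rs (S n) (fun p => Rabs (ff al p * bell_prod_from 1 xbell ks))).
    { intros ks. eapply Rle_trans; [apply Rabs_pos|].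
      apply rs_Rabs_le with (f := fun p => ff al p * bell_prod_from 1 xbell ks).
      intros; apply Rle_refl. }
    split.
    { unfold M. eapply Rle_trans; [apply (Rabs_pos (lsum L (fun _ => 0)))|].
      apply lsum_Rabs_le. intros ks. rewrite Rabs_R0. apply Hpos. }
    intros t Ht.
    assert (E1 : rs (S n) (fun p => ff al p / INR (fact p) * Xpoly n t ^ p) =
      lsum L (fun ks => rs (S n) (fun p => ff al p * (if Nat.eqb (sum_list ks) p
        then bell_prod_from 1 xbell ks * t ^ wsum_from 1 ks else 0)))).
    { rewrite <- rs_lsum. apply rs_ext. intros p Hp. rewrite lsum_scal. unfold L.
      rewrite multinomial by lia. unfold Xpoly, Rdiv. ring. }
    (* Summed over [j], each tuple selects the single power [j = wsum_from 1 ks]; so [rpoly q] is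
       the sum of [E1] restricted to tuples of weight at most [n]. *)
    assert (E2 : rpoly q (S n) t =
      lsum L (fun ks => rs (S n) (fun p => ff al p * (if Nat.eqb (sum_list ks) p
        then (if Nat.ltb (wsum_from 1 ks) (S n)
              then bell_prod_from 1 xbell ks * t ^ wsum_from 1 ks else 0) else 0)))).
    { unfold rpoly.
      transitivity (rs (S n) (fun j => lsum L (fun ks => rs (S n) (fun p =>
        ff al p * (if Nat.eqb (sum_list ks) p then
          (if Nat.eqb (wsum_from 1 ks) j then bell_prod_from 1 xbell ks else 0) * t ^ j else 0))))).
      - apply rs_ext. intros j _. unfold q. rewrite Rmult_comm, <- rs_scal, <- rs_lsum.
        apply rs_ext. intros p _. rewrite <- Rmult_assoc, (Rmult_comm (t ^ j)), Rmult_assoc.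
        rewrite <- lsum_scal, <- (lsum_scal L (ff al p)). apply lsum_ext. intros ks.
        destruct (Nat.eqb (sum_list ks) p); ring.
      - rewrite rs_lsum. apply lsum_ext. intros ks.
        destruct (Nat.ltb_spec (wsum_from 1 ks) (S n)) as [Lw|Lw].
        + transitivity (rs (S n) (fun p => rs (S n) (fun j => ff al p * (if Nat.eqb (sum_list ks) p then
            (if Nat.eqb (wsum_from 1 ks) j then bell_prod_from 1 xbell ks else 0) * t ^ j else 0)))).
          { apply rs_swap. }
          apply rs_ext. intros p _. rewrite rs_scal. f_equal.
          destruct (Nat.eqb (sum_list ks) p).
          * now apply rs_indicator.
          * now apply rs_zero.
        + transitivity 0.
          * apply rs_zero. intros j Hj. apply rs_zero. intros p _.
            destruct (Nat.eqb_spec (wsum_from 1 ks) j); [lia|].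
            destruct (Nat.eqb (sum_list ks) p); ring.
          * symmetry. apply rs_zero. intros p _.
            destruct (Nat.eqb (sum_list ks) p); ring. }
    rewrite E1, E2.
    replace (lsum L (fun ks => rs (S n) (fun p => ff al p * (if Nat.eqb (sum_list ks) p
        then bell_prod_from 1 xbell ks * t ^ wsum_from 1 ks else 0)))
     - lsum L (fun ks => rs (S n) (fun p => ff al p * (if Nat.eqb (sum_list ks) p
        then (if Nat.ltb (wsum_from 1 ks) (S n)
              then bell_prod_from 1 xbell ks * t ^ wsum_from 1 ks else 0) else 0))))
    with (lsum L (fun ks => rs (S n) (fun p => ff al p * (if Nat.eqb (sum_list ks) p
        then bell_prod_from 1 xbell ks * t ^ wsum_from 1 ks else 0)) +
       (-1) * rs (S n) (fun p => ff al p * (if Nat.eqb (sum_list ks) p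
        then (if Nat.ltb (wsum_from 1 ks) (S n)
              then bell_prod_from 1 xbell ks * t ^ wsum_from 1 ks else 0) else 0))))
    by (rewrite lsum_plus, lsum_scal; ring).
    unfold M. rewrite Rmult_comm, <- lsum_scal.
    apply lsum_Rabs_le. intros ks.
    rewrite <- (rs_scal (S n) (-1)), <- rs_scal.
    rewrite <- rs_plus. apply rs_Rabs_le. intros p _.
    assert (Htn : 0 <= t ^ S n) by (apply pow_le; lra).
    pose proof (Rabs_pos (ff al p * bell_prod_from 1 xbell ks)) as HA.
    destruct (Nat.eqb (sum_list ks) p).
    - destruct (Nat.ltb_spec (wsum_from 1 ks) (S n)) as [Lw|Lw].
      + match goal with |- Rabs ?e <= _ => replace e with 0 by ring end. rewrite Rabs_R0. nra.
      + match goal with |- Rabs ?e <= _ => replace e with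
          ((ff al p * bell_prod_from 1 xbell ks) * t ^ wsum_from 1 ks) by ring end.
        rewrite Rabs_mult, Rmult_comm. apply Rmult_le_compat_r; auto.
        rewrite Rabs_pos_eq by (apply pow_le; lra).
        replace (wsum_from 1 ks) with (S n + (wsum_from 1 ks - S n))%nat by lia.
        rewrite pow_add. rewrite <- (Rmult_1_r (t ^ S n)) at 2. apply Rmult_le_compat_l; auto.
        rewrite <- (pow1 (wsum_from 1 ks - S n)). apply pow_incr. lra.
    - match goal with |- Rabs ?e <= _ => replace e with 0 by ring end. rewrite Rabs_R0. nra. }
  apply (rbigO_ext (S n) (fun t => (psi al t
    - rs (S n) (fun p => ff al p / INR (fact p) * Yfun t ^ p)) +
    (rs (S n) (fun p => ff al p / INR (fact p) * (Yfun t ^ p - Xpoly n t ^ p)) +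
    (rs (S n) (fun p => ff al p / INR (fact p) * Xpoly n t ^ p) - rpoly q (S n) t))) _ 1); [lra| |].
  - intros t _.
    rewrite (rs_ext (S n) (fun p => ff al p / INR (fact p) * (Yfun t ^ p - Xpoly n t ^ p))
      (fun p => ff al p / INR (fact p) * Yfun t ^ p - ff al p / INR (fact p) * Xpoly n t ^ p))
      by (intros; ring).
    rewrite rs_minus. ring.
  - apply rbigO_plus; [exact A1|]. apply rbigO_plus; [exact A2|exact A3].
Qed.

(** * Uniqueness of asymptotic expansions *)

Fixpoint cs (n : nat) (f : nat -> C) : C :=
  match n with O => RtoC 0 | S n' => (cs n' f + f n')%C end.

Lemma cs_ext (n : nat) (f g : nat -> C) :
  (forall i, (i < n)%nat -> f i = g i) -> cs n f = cs n g.
Proof.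
  induction n as [|n IH]; intros H; simpl; [reflexivity|].
  rewrite IH by (intros; apply H; lia). rewrite H by lia. reflexivity.
Qed.

Lemma cs_Sl (n : nat) (f : nat -> C) : cs (S n) f = (f O + cs n (fun i => f (S i)))%C.
Proof.
  induction n as [|n IH]; [simpl; ring|].
  change (cs (S (S n)) f) with (cs (S n) f + f (S n))%C. rewrite IH. simpl. ring.
Qed.

Lemma cs_plus (n : nat) (f g : nat -> C) :
  cs n (fun i => f i + g i)%C = (cs n f + cs n g)%C.
Proof. induction n as [|n IH]; simpl; [ring|rewrite IH; ring]. Qed.

Lemma cs_minus (n : nat) (f g : nat -> C) :
  cs n (fun i => f i - g i)%C = (cs n f - cs n g)%C.
Proof. induction n as [|n IH]; simpl; [ring|rewrite IH; ring]. Qed.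

Lemma cs_mult (n : nat) (c : C) (f : nat -> C) :
  cs n (fun i => c * f i)%C = (c * cs n f)%C.
Proof. induction n as [|n IH]; simpl; [ring|rewrite IH; ring]. Qed.

Lemma cs_zero (n : nat) (f : nat -> C) :
  (forall i, (i < n)%nat -> f i = 0%C) -> cs n f = 0%C.
Proof.
  induction n as [|n IH]; intros H; simpl; [reflexivity|].
  rewrite IH by (intros; apply H; lia). rewrite H by lia. ring.
Qed.

Lemma cs_extend (n k : nat) (f : nat -> C) : (n <= k)%nat ->
  (forall i, (n <= i < k)%nat -> f i = 0%C) -> cs k f = cs n f.
Proof.
  intros H Hf. induction H as [|k H IH]; [reflexivity|].
  simpl. rewrite IH by (intros; apply Hf; lia). rewrite Hf by lia. ring.
Qed.

Lemma cs_swap (a b : nat) (f : nat -> nat -> C) :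
  cs a (fun i => cs b (f i)) = cs b (fun j => cs a (fun i => f i j)).
Proof.
  induction a as [|a IH]; simpl.
  - symmetry. now apply cs_zero.
  - rewrite IH, <- cs_plus. reflexivity.
Qed.

Lemma cs_single (n w : nat) (v : nat -> C) :
  cs n (fun k => if Nat.eqb w k then v k else 0)%C = (if Nat.ltb w n then v w else 0)%C.
Proof.
  induction n as [|n IH]; simpl; [reflexivity|]. rewrite IH.
  destruct (Nat.ltb_spec w n); destruct (Nat.ltb_spec w (S n));
  destruct (Nat.eqb_spec w n); try lia; subst; ring.
Qed.

Lemma cs_sum_n (n : nat) (f : nat -> C) :
  sum_n (G := C_AbelianMonoid) f n = cs (S n) f.
Proof.
  induction n as [|n IH].
  - rewrite sum_O. simpl. ring.
  - rewrite sum_Sn, IH. reflexivity.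
Qed.

Lemma Cmod_cs_le (n : nat) (f : nat -> C) (g : nat -> R) :
  (forall i, (i < n)%nat -> Cmod (f i) <= g i) -> Cmod (cs n f) <= rs n g.
Proof.
  induction n as [|n IH]; intros H; simpl; [rewrite Cmod_0; lra|].
  eapply Rle_trans; [apply Cmod_triangle|].
  apply Rplus_le_compat; [apply IH; intros; apply H; lia|apply H; lia].
Qed.

Definition cpoly (c : nat -> C) (n : nat) (x : R) : C :=
  cs n (fun k => c k * RtoC (x ^ k))%C.

Definition cbigO (n : nat) (f : R -> C) : Prop :=
  exists K X, 0 < X /\ 0 <= K /\ forall x, 0 < x < X -> Cmod (f x) <= K * x ^ n.

Lemma cbigO_plus (n : nat) (f g : R -> C) :
  cbigO n f -> cbigO n g -> cbigO n (fun t => f t + g t)%C.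
Proof.
  intros [K [X [HX [HK B]]]] [K' [X' [HX' [HK' B']]]].
  exists (K + K'), (Rmin X X'). split; [now apply Rmin_pos|]. split; [lra|].
  intros t Ht. pose proof (Rmin_l X X'). pose proof (Rmin_r X X').
  eapply Rle_trans; [apply Cmod_triangle|].
  specialize (B t ltac:(lra)). specialize (B' t ltac:(lra)). lra.
Qed.

Lemma cbigO_mult (n : nat) (c : C) (f : R -> C) : cbigO n f -> cbigO n (fun t => c * f t)%C.
Proof.
  intros [K [X [HX [HK B]]]]. exists (Cmod c * K), X.
  split; auto. split; [apply Rmult_le_pos; auto; apply Cmod_ge_0|].
  intros t Ht. rewrite Cmod_mult, Rmult_assoc.
  apply Rmult_le_compat_l; [apply Cmod_ge_0|auto].
Qed.

Lemma cbigO_ext (n : nat) (f g : R -> C) (X : R) : 0 < X ->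
  (forall t, 0 < t < X -> f t = g t) -> cbigO n f -> cbigO n g.
Proof.
  intros HX E [K [X' [HX' [HK B]]]]. exists K, (Rmin X X').
  split; [now apply Rmin_pos|]. split; auto. intros t Ht.
  pose proof (Rmin_l X X'). pose proof (Rmin_r X X'). rewrite <- E by lra. apply B. lra.
Qed.

Lemma cbigO_minus (n : nat) (f g : R -> C) :
  cbigO n f -> cbigO n g -> cbigO n (fun t => f t - g t)%C.
Proof.
  intros Hf Hg. apply (cbigO_ext n (fun t => f t + (- (1)) * g t)%C _ 1); [lra| |].
  - intros; ring.
  - apply cbigO_plus; auto. now apply cbigO_mult.
Qed.

Lemma cbigO_cs (n k : nat) (f : nat -> R -> C) :
  (forall i, (i < k)%nat -> cbigO n (f i)) -> cbigO n (fun t => cs k (fun i => f i t)).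
Proof.
  induction k as [|k IH]; intros H; simpl.
  - exists 0, 1. repeat split; try lra. intros t Ht. rewrite Cmod_0. lra.
  - apply cbigO_plus; [apply IH; intros; apply H; lia|apply H; lia].
Qed.

Lemma cbigO_weaken (n k : nat) (f : R -> C) : (n <= k)%nat -> cbigO k f -> cbigO n f.
Proof.
  intros H [K [X [HX [HK B]]]]. exists K, (Rmin X 1).
  split; [apply Rmin_pos; lra|]. split; auto. intros x Hx.
  pose proof (Rmin_l X 1). pose proof (Rmin_r X 1).
  eapply Rle_trans; [apply B; lra|]. apply Rmult_le_compat_l; auto.
  replace k with (n + (k - n))%nat by lia. rewrite pow_add.
  assert (0 <= x ^ n) by (apply pow_le; lra).
  rewrite <- (Rmult_1_r (x ^ n)) at 2. apply Rmult_le_compat_l; auto.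
  rewrite <- (pow1 (k - n)). apply pow_incr. lra.
Qed.

Lemma cbigO_monomial (n k : nat) (c : C) : (n <= k)%nat ->
  cbigO n (fun x => c * RtoC (x ^ k))%C.
Proof.
  intros H. apply cbigO_mult. apply (cbigO_weaken n k); auto.
  exists 1, 1. repeat split; try lra. intros x Hx.
  rewrite Cmod_R, Rabs_pos_eq by (apply pow_le; lra). lra.
Qed.

Lemma cpoly_Sl (c : nat -> C) (n : nat) (x : R) :
  cpoly c (S n) x = (c O + RtoC x * cpoly (fun k => c (S k)) n x)%C.
Proof.
  unfold cpoly. rewrite cs_Sl, <- cs_mult. f_equal; [simpl; ring|].
  apply cs_ext. intros i _. simpl. rewrite RtoC_mult. ring.
Qed.

(** Letting [x] tend to [0] kills the constant coefficient; dividing by [x] then lowers the order by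
    one. *)
Lemma cpoly_bigO_zero (n : nat) : forall c, cbigO n (cpoly c n) ->
  forall k, (k < n)%nat -> c k = 0%C.
Proof.
  induction n as [|n IH]; intros c HO k Hk; [lia|].
  destruct HO as [K [X [HX [HK B]]]].
  assert (HB : exists S0, 0 <= S0 /\ forall x, 0 < x < 1 ->
    Cmod (cpoly (fun k => c (S k)) n x) <= S0).
  { exists (rs n (fun k => Cmod (c (S k)))). split.
    - eapply Rle_trans; [apply Cmod_ge_0|]. apply (Cmod_cs_le n (fun k => c (S k))).
      intros; lra.
    - intros x Hx. apply Cmod_cs_le. intros i _. rewrite Cmod_mult.
      rewrite <- (Rmult_1_r (Cmod (c (S i)))) at 2.
      apply Rmult_le_compat_l; [apply Cmod_ge_0|].
      rewrite Cmod_R, Rabs_pos_eq by (apply pow_le; lra).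
      rewrite <- (pow1 i). apply pow_incr. lra. }
  destruct HB as [S0 [HS0 HB]].
  assert (H0 : c O = 0%C).
  { apply Cmod_eq_0. apply Rle_antisym; [|apply Cmod_ge_0]. apply Rnot_lt_le. intros Hpos.
    (* Inside the range of both bounds, and with [x * (K + S0 + 1)] at most half of [Cmod (c O)]. *)
    set (x := Rmin (/ 2) (Rmin (X / 2) (Cmod (c O) / (2 * (K + S0 + 1))))).
    assert (Hx0 : 0 < x).
    { repeat apply Rmin_pos; try lra. apply Rdiv_lt_0_compat; lra. }
    assert (Hx1 : x <= / 2) by apply Rmin_l.
    assert (Hx2 : x <= X / 2) by (eapply Rle_trans; [apply Rmin_r|apply Rmin_l]).
    assert (Hx3 : x <= Cmod (c O) / (2 * (K + S0 + 1)))
      by (eapply Rle_trans; [apply Rmin_r|apply Rmin_r]).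
    specialize (B x ltac:(lra)). specialize (HB x ltac:(lra)).
    rewrite cpoly_Sl in B.
    assert (Hp : x ^ S n <= x).
    { simpl. rewrite <- (Rmult_1_r x) at 3. apply Rmult_le_compat_l; [lra|].
      rewrite <- (pow1 n). apply pow_incr. lra. }
    assert (Hc : Cmod (c O) <= K * x ^ S n + x * S0).
    { replace (c O) with ((c O + RtoC x * cpoly (fun k => c (S k)) n x)
        - RtoC x * cpoly (fun k => c (S k)) n x)%C by ring.
      eapply Rle_trans; [apply Cmod_sub_triangle|].
      rewrite (Cmod_mult x), Cmod_R, (Rabs_pos_eq x) by lra.
      apply Rplus_le_compat; auto. apply Rmult_le_compat_l; lra. }
    assert (H1 : K * x ^ S n <= K * x) by (apply Rmult_le_compat_l; auto).
    assert (H2 : x * (K + S0 + 1) <= Cmod (c O) / 2).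
    { apply Rle_trans with (Cmod (c O) / (2 * (K + S0 + 1)) * (K + S0 + 1)).
      - apply Rmult_le_compat_r; lra.
      - right. field. lra. }
    nra. }
  destruct k as [|k]; [exact H0|].
  apply (IH (fun k => c (S k))); [|lia].
  exists K, X. repeat split; auto. intros x Hx. specialize (B x Hx).
  rewrite cpoly_Sl, H0, Cplus_0_l, Cmod_mult, Cmod_R, Rabs_pos_eq in B by lra.
  simpl in B. apply Rmult_le_reg_l with x; lra.
Qed.

Lemma expansion_unique (h : R -> C) (c d : nat -> C) :
  (forall n, cbigO n (fun x => h x - cpoly c n x)%C) ->
  (forall n, cbigO n (fun x => h x - cpoly d n x)%C) ->
  forall n, c n = d n.
Proof.
  intros Hc Hd n.
  assert (E : (c n - d n = 0)%C).
  { apply (cpoly_bigO_zero (S n) (fun k => c k - d k)%C); [|lia].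
    apply (cbigO_ext _ (fun x => (h x - cpoly d (S n) x) - (h x - cpoly c (S n) x))%C _ 1);
      [lra| |now apply cbigO_minus].
    intros x _. unfold cpoly.
    rewrite (cs_ext (S n) (fun k => (c k - d k) * RtoC (x ^ k))%C
      (fun k => c k * RtoC (x ^ k) - d k * RtoC (x ^ k))%C) by (intros; ring).
    rewrite cs_minus. ring. }
  replace (c n) with (c n - d n + d n)%C by ring. rewrite E. ring.
Qed.

Lemma RtoC_rs (n : nat) (f : nat -> R) : RtoC (rs n f) = cs n (fun i => RtoC (f i)).
Proof. induction n as [|n IH]; simpl; [reflexivity|rewrite RtoC_plus, IH; reflexivity]. Qed.

Lemma RtoC_rpoly (c : nat -> R) (n : nat) (t : R) :
  RtoC (rpoly c n t) = cpoly (fun k => RtoC (c k)) n t.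
Proof.
  unfold rpoly, cpoly. rewrite RtoC_rs. apply cs_ext. intros. apply RtoC_mult.
Qed.

Lemma psi_expansion (al : R) (n : nat) :
  rbigO n (fun t => psi al t - rpoly (bellco al) n t).
Proof.
  induction n as [|n IH].
  - destruct (psi_expansion_order al 0) as [q [_ [K [X [HX [HK B]]]]]].
    exists (K + Rabs (q O)), (Rmin X 1). split; [apply Rmin_pos; lra|].
    split; [pose proof (Rabs_pos (q O)); lra|].
    intros t Ht. pose proof (Rmin_l X 1). pose proof (Rmin_r X 1).
    specialize (B t ltac:(lra)). unfold rpoly in *. simpl in *.
    replace (psi al t - 0) with ((psi al t - (0 + q O * 1)) + q O) by ring.
    eapply Rle_trans; [apply Rabs_triang|]. nra.
  - destruct (psi_expansion_order al n) as [q [Eq HO]].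
    assert (Eall : forall k, (k < n)%nat -> RtoC (q k - bellco al k) = 0%C).
    { intros k Hk. apply (cpoly_bigO_zero n (fun k => RtoC (q k - bellco al k))); auto.
      assert (HO' : rbigO n (fun t => (psi al t - rpoly (bellco al) n t)
        + (-1) * (psi al t - rpoly q (S n) t) + (-1) * (q n * t ^ n))).
      { apply rbigO_plus; [apply rbigO_plus; auto; apply rbigO_scal|].
        - destruct HO as [K [X [HX [HK B]]]]. exists K, (Rmin X 1).
          split; [apply Rmin_pos; lra|]. split; auto. intros t Ht.
          pose proof (Rmin_l X 1). pose proof (Rmin_r X 1).
          eapply Rle_trans; [apply B; lra|]. apply Rmult_le_compat_l; auto.
          simpl. assert (0 <= t ^ n) by (apply pow_le; lra). nra.
        - apply rbigO_scal. exists (Rabs (q n)), 1.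
          split; [lra|]. split; [apply Rabs_pos|]. intros t Ht.
          rewrite Rabs_mult, (Rabs_pos_eq (t ^ n)) by (apply pow_le; lra). lra. }
      destruct HO' as [K [X [HX [HK B]]]]. exists K, X. repeat split; auto.
      intros t Ht. rewrite <- RtoC_rpoly, Cmod_R.
      replace (rpoly (fun k => q k - bellco al k) n t) with
        (psi al t - rpoly (bellco al) n t + -1 * (psi al t - rpoly q (S n) t)
         + -1 * (q n * t ^ n)); [now apply B|].
      unfold rpoly. simpl.
      rewrite (rs_ext n (fun j => (q j - bellco al j) * t ^ j)
        (fun j => q j * t ^ j - bellco al j * t ^ j)) by (intros; ring).
      rewrite rs_minus. ring. }
    apply (rbigO_ext _ (fun t => psi al t - rpoly q (S n) t) _ 1); [lra| |exact HO].
    intros t _. f_equal. unfold rpoly. apply rs_ext. intros k Hk.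
    destruct (Nat.eq_dec k n) as [->|N]; [now rewrite Eq|].
    assert (E : q k - bellco al k = 0) by (apply RtoC_inj; apply Eall; lia).
    replace (q k) with (bellco al k) by lra. reflexivity.
Qed.

(** * Asymptotic expansions of convergent series *)

(** The induction carries the factor [1 - (/ 2) ^ k], for which adding a term of size
    [M * q ^ N * (/ 2) ^ k] closes exactly. *)
Lemma series_geometric_tail (f : nat -> C) (l : C) (M q : R) (N : nat) :
  is_series (V := C_NormedModule) f l -> 0 <= M -> 0 <= q <= / 2 ->
  (forall n, (N <= n)%nat -> Cmod (f n) <= M * q ^ n) ->
  Cmod (l - cs N f) <= 2 * M * q ^ N.
Proof.
  intros Hs HM Hq Hf.
  assert (HqN : 0 <= M * q ^ N) by (apply Rmult_le_pos; auto; apply pow_le; lra).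
  assert (Hk : forall k, Cmod (cs (N + k) f - cs N f) <= 2 * M * q ^ N * (1 - (/ 2) ^ k)).
  { induction k as [|k IH].
    - rewrite Nat.add_0_r. replace (cs N f - cs N f)%C with (RtoC 0) by ring.
      rewrite Cmod_0. simpl. lra.
    - rewrite Nat.add_succ_r. simpl cs.
      replace (cs (N + k) f + f (N + k)%nat - cs N f)%C with
        ((cs (N + k) f - cs N f) + f (N + k)%nat)%C by ring.
      eapply Rle_trans; [apply Cmod_triangle|].
      specialize (Hf (N + k)%nat ltac:(lia)).
      assert (q ^ k <= (/ 2) ^ k) by (apply pow_incr; lra).
      rewrite pow_add in Hf.
      assert (M * (q ^ N * q ^ k) <= M * q ^ N * (/ 2) ^ k)
        by (rewrite <- Rmult_assoc; apply Rmult_le_compat_l; auto).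
      simpl. nra. }
  apply Rnot_lt_le. intros Hlt.
  set (e := Cmod (l - cs N f) - 2 * M * q ^ N).
  assert (He : 0 < e) by (unfold e; lra).
  destruct (proj1 (is_series_C_eps f l) Hs e He) as [N0 HN0].
  specialize (HN0 (N + N0)%nat ltac:(lia)). rewrite cs_sum_n in HN0.
  replace (S (N + N0)) with (N + S N0)%nat in HN0 by lia.
  specialize (Hk (S N0)).
  assert (0 <= (/ 2) ^ S N0) by (apply pow_le; lra).
  pose proof (Cmod_triangle (l - cs (N + S N0) f) (cs (N + S N0) f - cs N f)) as T.
  replace (l - cs (N + S N0) f + (cs (N + S N0) f - cs N f))%C with (l - cs N f)%C in T by ring.
  rewrite (Cmod_sub_sym l (cs (N + S N0) f)) in T. unfold e in *. nra.
Qed.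

Lemma series_terms_bounded (f : nat -> C) (l : C) :
  is_series (V := C_NormedModule) f l -> exists M, 0 <= M /\ forall n, Cmod (f n) <= M.
Proof.
  intros Hs. destruct (proj1 (is_series_C_eps f l) Hs 1 Rlt_0_1) as [N HN].
  assert (Hfin : exists M, 0 <= M /\ forall n, (n <= N)%nat -> Cmod (f n) <= M).
  { clear. induction N as [|N [M [HM B]]].
    - exists (Cmod (f O)). split; [apply Cmod_ge_0|]. intros n Hn.
      replace n with O by lia. lra.
    - exists (Rmax M (Cmod (f (S N)))). split; [eapply Rle_trans; [exact HM|apply Rmax_l]|].
      intros n Hn. destruct (Nat.eq_dec n (S N)) as [->|Hne]; [apply Rmax_r|].
      eapply Rle_trans; [apply B; lia|apply Rmax_l]. }
  destruct Hfin as [M [HM B]]. exists (M + 2). split; [lra|]. intros n.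
  destruct (Nat.le_gt_cases n N) as [L|L]; [specialize (B n L); lra|].
  destruct n as [|n]; [lia|].
  pose proof (HN n ltac:(lia)) as A1. pose proof (HN (S n) ltac:(lia)) as A2.
  rewrite !cs_sum_n in A1, A2. change (cs (S (S n)) f) with (cs (S n) f + f (S n))%C in A2.
  replace (f (S n)) with ((cs (S n) f + f (S n) - l) - (cs (S n) f - l))%C by ring.
  pose proof (Cmod_sub_triangle (cs (S n) f + f (S n) - l) (cs (S n) f - l)). lra.
Qed.

(** Terms bounded at [X / 2] decay geometrically for smaller [x], with ratio at most [/ 2] when
    [x < X / 4]; the tail from order [n] on is then of size [x ^ n]. *)
Lemma power_series_expansion (h : R -> C) (c : nat -> C) (X : R) : 0 < X ->
  (forall x, 0 < x < X -> is_series (V := C_NormedModule) (fun n => c n * RtoC (x ^ n))%C (h x)) ->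
  forall n, cbigO n (fun x => h x - cpoly c n x)%C.
Proof.
  intros HX Hs n.
  destruct (series_terms_bounded _ _ (Hs (X / 2) ltac:(lra))) as [M [HM B]].
  assert (Hc : forall k, Cmod (c k) * (X / 2) ^ k <= M).
  { intros k. specialize (B k). rewrite Cmod_mult, Cmod_R, Rabs_pos_eq in B
      by (apply pow_le; lra). exact B. }
  exists (2 * M * (/ (X / 2)) ^ n), (X / 4). split; [lra|].
  assert (Hi : 0 < / (X / 2)) by (apply Rinv_0_lt_compat; lra).
  split. { apply Rmult_le_pos; [lra|apply pow_le; lra]. }
  intros x Hx.
  replace (2 * M * (/ (X / 2)) ^ n * x ^ n) with (2 * M * (x / (X / 2)) ^ n)
    by (unfold Rdiv at 1; rewrite Rpow_mult_distr; ring).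
  apply series_geometric_tail; auto.
  - apply Hs. lra.
  - split; [apply Rdiv_le_0_compat; lra|]. apply Rle_div_l; lra.
  - intros k _. rewrite Cmod_mult, Cmod_R, Rabs_pos_eq by (apply pow_le; lra).
    replace (x ^ k) with ((X / 2) ^ k * (x / (X / 2)) ^ k).
    + rewrite <- Rmult_assoc. apply Rmult_le_compat_r; auto.
      apply pow_le. apply Rdiv_le_0_compat; lra.
    + rewrite <- Rpow_mult_distr. f_equal. field. lra.
Qed.

(** In the application [al] is [(n + 1) / m - 1], which lies in this range. As [1 + Yfun t] is
    between [1] and [2], the lower bound lets the size of the coefficients be read off a convergent
    series, and the upper one controls its terms elsewhere. *)
Lemma psi_bounds (al : R) (n : nat) (t : R) : 0 < t <= / 2 -> -1 <= al <= INR n ->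
  / 2 <= psi al t <= 2 ^ n.
Proof.
  intros Ht Hal. pose proof (Yfun_bounds t Ht) as HY. unfold psi.
  set (l := ln (1 + Yfun t)).
  assert (Hl0 : 0 <= l) by (unfold l; rewrite <- ln_1; apply ln_le; lra).
  assert (Hl2 : l <= ln 2) by (apply ln_le; lra).
  split.
  - rewrite <- (exp_ln 2), <- exp_Ropp by lra.
    assert (H : - ln 2 <= al * l) by nra.
    destruct H as [H|H]; [left; now apply exp_increasing|rewrite <- H; lra].
  - rewrite <- Rpower_pow by lra. unfold Rpower.
    assert (Hn : 0 <= INR n) by apply pos_INR.
    assert (H : al * l <= INR n * ln 2) by nra.
    destruct H as [H|H]; [left; now apply exp_increasing|rewrite <- H; lra].
Qed.

(** Coefficient of [x ^ k] when the terms [alpha n * x ^ n * psi (al n) (x ^ m)] are collected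
    formally: pairs with [n + j * m = k], indexed by [j]. *)
Definition Dco (m : nat) (alpha : nat -> C) (al : nat -> R) (k : nat) : C :=
  cs (S k) (fun j => if Nat.leb (j * m) k
    then (alpha (k - j * m)%nat * RtoC (bellco (al (k - j * m)%nat) j))%C else RtoC 0).

(** Modulo [x ^ N] only the terms [n < N] count, each with [psi] expanded to order [N]; the
    collection of powers is therefore a finite sum, and convergence of the double series is never at
    stake. *)
Lemma psi_series_expansion (m : nat) (alpha : nat -> C) (al : nat -> R) (h : R -> C) (X : R) :
  (1 <= m)%nat -> 0 < X -> (forall n, -1 <= al n <= INR n) ->
  (forall x, 0 < x < X -> is_series (V := C_NormedModule)
     (fun n => alpha n * RtoC (x ^ n * psi (al n) (x ^ m)))%C (h x)) ->
  forall N, cbigO N (fun x => h x - cpoly (Dco m alpha al) N x)%C.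
Proof.
  intros Hm HX Hal Hs N.
  set (X0 := Rmin X (/ 2)). assert (HX0 : 0 < X0) by (apply Rmin_pos; lra).
  assert (HX1 : X0 <= X) by apply Rmin_l. assert (HX2 : X0 <= / 2) by apply Rmin_r.
  assert (Hxm : forall x, 0 < x <= X0 -> 0 < x ^ m <= / 2).
  { intros x Hx. split; [apply pow_lt; lra|].
    destruct m as [|m']; [lia|]. simpl.
    assert (0 <= x ^ m' <= 1).
    { split; [apply pow_le; lra|]. rewrite <- (pow1 m'). apply pow_incr. lra. }
    nra. }
  set (xs := X0 / 2).
  destruct (series_terms_bounded _ _ (Hs xs ltac:(unfold xs; lra))) as [M [HM B]].
  (* The lower bound [/ 2] on [psi] turns boundedness of the terms at [xs] into a Cauchy estimate
     for [alpha]. *)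
  assert (Hc : forall k, Cmod (alpha k) * xs ^ k <= 2 * M).
  { intros k. specialize (B k).
    assert (Hp : 0 <= xs ^ k) by (apply pow_le; unfold xs; lra).
    pose proof (psi_bounds (al k) k (xs ^ m) (Hxm xs ltac:(unfold xs; lra)) (Hal k)) as [P _].
    rewrite Cmod_mult, Cmod_R, Rabs_pos_eq in B by (apply Rmult_le_pos; lra).
    pose proof (Cmod_ge_0 (alpha k)).
    assert (Cmod (alpha k) * xs ^ k * / 2 <= Cmod (alpha k) * (xs ^ k * psi (al k) (xs ^ m))).
    { rewrite Rmult_assoc. apply Rmult_le_compat_l; auto. apply Rmult_le_compat_l; auto. }
    lra. }
  assert (A1 : cbigO N (fun x => h x - cs N (fun n => alpha n * RtoC (x ^ n * psi (al n) (x ^ m))))%C).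
  { assert (Hi : 0 < 2 / xs) by (apply Rdiv_lt_0_compat; unfold xs; lra).
    (* The upper bound [2 ^ k] on [psi] doubles the ratio, so [x < xs / 4] is needed to keep it
       below [/ 2]. *)
    exists (2 * (2 * M) * (2 / xs) ^ N), (xs / 4). split; [unfold xs; lra|].
    split. { apply Rmult_le_pos; [lra|apply pow_le; lra]. }
    intros x Hx.
    replace (2 * (2 * M) * (2 / xs) ^ N * x ^ N) with (2 * (2 * M) * (2 * x / xs) ^ N).
    2:{ replace (2 * x / xs) with (2 / xs * x) by (unfold xs; field; lra).
        rewrite Rpow_mult_distr. ring. }
    apply series_geometric_tail.
    - apply Hs. unfold xs in Hx; lra.
    - lra.
    - split; [apply Rdiv_le_0_compat; unfold xs in *; lra|].
      apply Rle_div_l; unfold xs in *; lra.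
    - intros k _. rewrite Cmod_mult.
      assert (Hp : 0 <= x ^ k) by (apply pow_le; lra).
      pose proof (psi_bounds (al k) k (x ^ m) (Hxm x ltac:(unfold xs in *; lra)) (Hal k)) as [P P2].
      rewrite Cmod_R, Rabs_pos_eq by (apply Rmult_le_pos; lra).
      apply Rle_trans with (Cmod (alpha k) * (x ^ k * 2 ^ k)).
      { apply Rmult_le_compat_l; [apply Cmod_ge_0|]. apply Rmult_le_compat_l; auto. }
      replace (Cmod (alpha k) * (x ^ k * 2 ^ k)) with
        (Cmod (alpha k) * xs ^ k * (2 * x / xs) ^ k).
      + apply Rmult_le_compat_r; auto. apply pow_le, Rdiv_le_0_compat; unfold xs in *; lra.
      + rewrite Rmult_assoc, <- !Rpow_mult_distr.
        replace (xs * (2 * x / xs)) with (x * 2) by (unfold xs; field; lra). reflexivity. }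
  assert (A2 : cbigO N (fun x => cs N (fun n => alpha n * (RtoC (x ^ n)
    * RtoC (psi (al n) (x ^ m) - rpoly (bellco (al n)) N (x ^ m)))))%C).
  { apply cbigO_cs. intros n _. apply cbigO_mult.
    destruct (psi_expansion (al n) N) as [K [X' [HX' [HK B']]]].
    exists K, (Rmin X' 1). split; [apply Rmin_pos; lra|]. split; auto. intros x Hx.
    pose proof (Rmin_l X' 1). pose proof (Rmin_r X' 1).
    assert (Hm1 : 0 < x ^ m <= x).
    { split; [apply pow_lt; lra|]. destruct m as [|m']; [lia|]. simpl.
      assert (x ^ m' <= 1) by (rewrite <- (pow1 m'); apply pow_incr; lra). nra. }
    rewrite Cmod_mult, !Cmod_R, (Rabs_pos_eq (x ^ n)) by (apply pow_le; lra).
    assert (Hn1 : 0 <= x ^ n <= 1).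
    { split; [apply pow_le; lra|]. rewrite <- (pow1 n). apply pow_incr. lra. }
    apply Rle_trans with (1 * (K * (x ^ m) ^ N)).
    - apply Rmult_le_compat; try lra; [apply Rabs_pos|]. apply B'. lra.
    - rewrite Rmult_1_l. apply Rmult_le_compat_l; auto. apply pow_incr. lra. }
  assert (A3 : cbigO N (fun x => cs N (fun n => cs N (fun j =>
    (if Nat.ltb (n + j * m) N then RtoC 0 else
      (alpha n * RtoC (bellco (al n) j)) * RtoC (x ^ (n + j * m))))))%C).
  { apply cbigO_cs. intros n _. apply cbigO_cs. intros j _.
    destruct (Nat.ltb_spec (n + j * m) N) as [L|L].
    - exists 0, 1. repeat split; try lra. intros x Hx. rewrite Cmod_0. lra.
    - now apply cbigO_monomial. }
  apply (cbigO_ext N (fun x => (h x - cs N (fun n => alpha n * RtoC (x ^ n * psi (al n) (x ^ m))))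
    + (cs N (fun n => alpha n * (RtoC (x ^ n)
    * RtoC (psi (al n) (x ^ m) - rpoly (bellco (al n)) N (x ^ m)))) +
     cs N (fun n => cs N (fun j =>
    (if Nat.ltb (n + j * m) N then RtoC 0 else
      (alpha n * RtoC (bellco (al n) j)) * RtoC (x ^ (n + j * m)))))))%C _ 1); [lra| |].
  2:{ apply cbigO_plus; [exact A1|]. apply cbigO_plus; [exact A2|exact A3]. }
  intros x _.
  assert (E1 : cs N (fun n => alpha n * (RtoC (x ^ n)
      * RtoC (psi (al n) (x ^ m) - rpoly (bellco (al n)) N (x ^ m))))%C
    = (cs N (fun n => alpha n * RtoC (x ^ n * psi (al n) (x ^ m)))
     - cs N (fun n => cs N (fun j => (alpha n * RtoC (bellco (al n) j)) * RtoC (x ^ (n + j * m)))))%C).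
  { rewrite <- cs_minus. apply cs_ext. intros n _.
    rewrite RtoC_minus, RtoC_mult, RtoC_rpoly. unfold cpoly.
    rewrite (cs_ext N (fun j => (alpha n * RtoC (bellco (al n) j)) * RtoC (x ^ (n + j * m)))%C
      (fun j => (alpha n * RtoC (x ^ n)) * (RtoC (bellco (al n) j) * RtoC ((x ^ m) ^ j)))%C).
    - rewrite cs_mult. ring.
    - intros j _. rewrite pow_add, Nat.mul_comm, pow_mult, RtoC_mult. ring. }
  assert (E2 : cpoly (Dco m alpha al) N x = cs N (fun n => cs N (fun j =>
     if Nat.ltb (n + j * m) N then (alpha n * RtoC (bellco (al n) j)) * RtoC (x ^ (n + j * m))
     else RtoC 0))%C).
  (* Regrouping by [k = n + j * m] is written as a finite triple sum with an indicator, whose order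
     of summation is free. *)
  { transitivity (cs N (fun k => cs N (fun j => cs N (fun n =>
      if Nat.eqb (n + j * m) k then (alpha n * RtoC (bellco (al n) j)) * RtoC (x ^ k) else RtoC 0)))%C).
    - unfold cpoly. apply cs_ext. intros k Hk. unfold Dco.
      rewrite Cmult_comm, <- cs_mult, <- (cs_extend (S k) N) by
        (lia || (intros j Hj; destruct (Nat.leb_spec (j * m) k); [nia|ring])).
      apply cs_ext. intros j _.
      destruct (Nat.leb_spec (j * m) k) as [L|L].
      + rewrite (cs_ext N _ (fun n => if Nat.eqb (k - j * m) n then
          (alpha n * RtoC (bellco (al n) j)) * RtoC (x ^ k) else RtoC 0)%C).
        * rewrite (cs_single N (k - j * m) (fun n => (alpha n * RtoC (bellco (al n) j)) * RtoC (x ^ k))%C).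
          destruct (Nat.ltb_spec (k - j * m) N); [ring|lia].
        * intros n _. destruct (Nat.eqb_spec (n + j * m) k);
            destruct (Nat.eqb_spec (k - j * m) n); try lia; reflexivity.
      + rewrite cs_zero; [ring|]. intros n _.
        destruct (Nat.eqb_spec (n + j * m) k); [lia|reflexivity].
    - rewrite cs_swap. rewrite (cs_swap N N (fun n j => if Nat.ltb (n + j * m) N then _ else _)).
      apply cs_ext. intros j _. rewrite cs_swap. apply cs_ext. intros n _.
      rewrite <- (cs_single N (n + j * m)
        (fun k => (alpha n * RtoC (bellco (al n) j)) * RtoC (x ^ k))%C).
      reflexivity. }
  rewrite E1, E2.
  match goal with |- (_ - ?a + (?a - ?b + ?c) = _ - ?d)%C => 
    assert (E3 : b = (c + d)%C) end.
  { rewrite <- cs_plus. apply cs_ext. intros n _. rewrite <- cs_plus. apply cs_ext. intros j _.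
    destruct (Nat.ltb (n + j * m) N); ring. }
  rewrite E3. ring.
Qed.

(** * Improper integrals over the positive half-line *)

Notation FF := (filter_prod (at_right 0) (Rbar_locally p_infty)).

Lemma at_right_0 (P : R -> Prop) :
  at_right 0 P <-> exists d, 0 < d /\ forall a, 0 < a < d -> P a.
Proof.
  split.
  - intros [d Hd]. exists d. split; [apply cond_pos|]. intros a Ha. apply Hd; [|lra].
    unfold ball; simpl; unfold AbsRing_ball, abs, minus, plus, opp; simpl.
    rewrite Rabs_pos_eq; lra.
  - intros [d [Hd H]]. exists (mkposreal d Hd). intros a Ha Hp. apply H.
    unfold ball in Ha; simpl in Ha; unfold AbsRing_ball, abs, minus, plus, opp in Ha; simpl in Ha.
    rewrite Rabs_pos_eq in Ha; lra.
Qed.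

Lemma FF_iff (P : R * R -> Prop) :
  FF P <-> exists d b0, 0 < d /\ 0 < b0 /\ forall a b, 0 < a < d -> b0 < b -> P (a, b).
Proof.
  split.
  - intros [Q S HQ [b0 HS] H]. apply at_right_0 in HQ. destruct HQ as [d [Hd HQ]].
    exists d, (Rmax b0 1). split; [auto|]. split; [eapply Rlt_le_trans; [|apply Rmax_r]; lra|].
    intros a b Ha Hb. apply H; [now apply HQ|]. apply HS.
    eapply Rle_lt_trans; [apply Rmax_l|exact Hb].
  - intros [d [b0 [Hd [Hb0 H]]]].
    apply (Filter_prod _ _ _ (fun a => 0 < a < d) (fun b => b0 < b)).
    + apply at_right_0. exists d; auto.
    + exists b0; auto.
    + intros a b Ha Hb. now apply H.
Qed.

Lemma FF_pos : FF (fun ab => 0 < fst ab < snd ab).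
Proof.
  apply FF_iff. exists 1, 1. repeat split; try lra; simpl; lra.
Qed.

Section Improper.

Context {V : CompleteNormedModule R_AbsRing}.

(** Continuity on the open half-line is built in, so every proper integral exists and the limit can
    be taken of the total function [RInt]; the kernels may be singular at [0]. *)
Definition imp (f : R -> V) (l : V) : Prop :=
  (forall t, 0 < t -> continuous f t) /\
  filterlim (fun ab => RInt f (fst ab) (snd ab)) FF (locally l).

Lemma ex_RInt_pos (f : R -> V) (a b : R) : (forall t, 0 < t -> continuous f t) ->
  0 < a -> 0 < b -> ex_RInt f a b.
Proof.
  intros Hf Ha Hb. apply (ex_RInt_continuous (V := V)). intros t Ht. apply Hf.
  destruct Ht as [Ht _]. eapply Rlt_le_trans; [|exact Ht]. now apply Rmin_pos.
Qed.

Lemma imp_is_RInt_gen (f : R -> V) (l : V) :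
  imp f l -> is_RInt_gen f (at_right 0) (Rbar_locally p_infty) l.
Proof.
  intros [Hc Hl] P HP.
  assert (Hl' : FF (fun ab => P (RInt f (fst ab) (snd ab)))) by exact (Hl P HP).
  unfold filtermapi. generalize (filter_and _ _ FF_pos Hl'). apply filter_imp.
  intros [a b] [Hab HPab]. exists (RInt f a b). split; [|exact HPab].
  apply (RInt_correct (V := V)). simpl in *. apply ex_RInt_pos; auto; lra.
Qed.

Lemma imp_RInt_gen (f : R -> V) (l : V) :
  imp f l -> RInt_gen f (at_right 0) (Rbar_locally p_infty) = l.
Proof. intros H. apply is_RInt_gen_unique, imp_is_RInt_gen, H. Qed.

Lemma imp_unique (f : R -> V) (l k : V) : imp f l -> imp f k -> l = k.
Proof. intros H1 H2. rewrite <- (imp_RInt_gen _ _ H1). now apply imp_RInt_gen. Qed.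

Lemma imp_ext (f g : R -> V) (l : V) :
  (forall t, 0 < t -> f t = g t) -> imp f l -> imp g l.
Proof.
  intros E [Hc Hl]. split.
  - intros t Ht. apply (continuous_ext_loc g f); [|now apply Hc].
    exists (mkposreal t Ht). intros s Hs. apply E.
    unfold ball in Hs; simpl in Hs; unfold AbsRing_ball, abs, minus, plus, opp in Hs; simpl in Hs.
    apply Rabs_def2 in Hs. lra.
  - apply (filterlim_ext_loc (fun ab => RInt f (fst ab) (snd ab))); [|exact Hl].
    generalize FF_pos. apply filter_imp. intros [a b] Hab. simpl in *.
    apply RInt_ext. intros t Ht. rewrite Rmin_left in Ht by lra. apply E. lra.
Qed.

Lemma imp_plus (f g : R -> V) (l k : V) :
  imp f l -> imp g k -> imp (fun t => plus (f t) (g t)) (plus l k).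
Proof.
  intros [Hc Hl] [Hc' Hl']. split.
  - intros t Ht. apply (continuous_plus (V := V)); auto.
  - apply (filterlim_ext_loc (fun ab =>
      plus (RInt f (fst ab) (snd ab)) (RInt g (fst ab) (snd ab)))).
    + generalize FF_pos. apply filter_imp. intros [a b] Hab. simpl in *. symmetry.
      apply (RInt_plus (V := V)); apply ex_RInt_pos; auto; lra.
    + eapply filterlim_comp_2; [exact Hl|exact Hl'|]. apply (filterlim_plus (V := V)).
Qed.

Lemma imp_scal (c : R) (f : R -> V) (l : V) :
  imp f l -> imp (fun t => scal c (f t)) (scal c l).
Proof.
  intros [Hc Hl]. split.
  - intros t Ht. apply (continuous_scal_r (V := V)); auto.
  - apply (filterlim_ext_loc (fun ab => scal c (RInt f (fst ab) (snd ab)))).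
    + generalize FF_pos. apply filter_imp. intros [a b] Hab. simpl in *. symmetry.
      apply (RInt_scal (V := V)); apply ex_RInt_pos; auto; lra.
    + eapply filterlim_comp; [exact Hl|]. apply (filterlim_scal_r (V := V)).
Qed.

Lemma imp_eps (f : R -> V) (l : V) : imp f l ->
  forall eps, 0 < eps -> exists d b0, 0 < d /\ 0 < b0 /\
    forall a b, 0 < a < d -> b0 < b -> norm (minus (RInt f a b) l) < eps.
Proof.
  intros [Hc Hl] eps He.
  pose proof (Hl (fun y => norm (minus y l) < eps)) as H.
  apply (FF_iff (fun ab => norm (minus (RInt f (fst ab) (snd ab)) l) < eps)). apply H.
  pose proof (@norm_factor_gt_0 R_AbsRing V) as Hf.
  assert (Hp : 0 < eps / @norm_factor R_AbsRing V) by (apply Rdiv_lt_0_compat; auto).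
  exists (mkposreal _ Hp). intros y Hy.
  pose proof (norm_compat2 l y _ Hy) as K. simpl in K.
  replace (norm_factor * (eps / norm_factor)) with eps in K by (field; lra). exact K.
Qed.

Lemma imp_intro (f : R -> V) (l : V) : (forall t, 0 < t -> continuous f t) ->
  (forall eps, 0 < eps -> exists d b0, 0 < d /\ 0 < b0 /\
    forall a b, 0 < a < d -> b0 < b -> norm (minus (RInt f a b) l) < eps) ->
  imp f l.
Proof.
  intros Hc H. split; auto. apply filterlim_locally. intros eps. apply FF_iff.
  destruct (H eps (cond_pos eps)) as [d [b0 [Hd [Hb K]]]].
  exists d, b0. repeat split; auto. intros a b Ha Hb'.
  apply (norm_compat1 (V := V)). now apply K.
Qed.

Lemma imp_scale (c : R) (f : R -> V) (l : V) : 0 < c ->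
  imp f l -> imp (fun t => f (c * t)) (scal (/ c) l).
Proof.
  intros Hc Hf. destruct (Hf) as [Hcont _].
  assert (Hcont' : forall t, 0 < t -> continuous (fun t => scal c (f (c * t))) t).
  { intros t Ht. apply (continuous_scal_r (V := V)).
    apply (continuous_comp (fun t => c * t) f).
    - apply (continuous_scal_r (K := R_AbsRing) (V := R_NormedModule) c (fun x => x)).
      apply continuous_id.
    - apply Hcont. now apply Rmult_lt_0_compat. }
  assert (H : imp (fun t => scal c (f (c * t))) l).
  { apply imp_intro; auto. intros eps He.
    destruct (imp_eps f l Hf eps He) as [d [b0 [Hd [Hb K]]]].
    exists (d / c), (b0 / c).
    split; [now apply Rdiv_lt_0_compat|]. split; [now apply Rdiv_lt_0_compat|].
    intros a b Ha Hb'.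
    assert (A1 : c * a < d).
    { replace d with (c * (d / c)) by (field; lra). apply Rmult_lt_compat_l; lra. }
    assert (A2 : b0 < c * b).
    { replace b0 with (c * (b0 / c)) by (field; lra). apply Rmult_lt_compat_l; lra. }
    assert (A3 : 0 < c * a) by (apply Rmult_lt_0_compat; lra).
    pose proof (RInt_comp_lin (V := V) f c 0 a b) as E.
    rewrite !Rplus_0_r in E.
    rewrite (RInt_ext _ (fun y => scal c (f (c * y + 0)))).
    - rewrite E; [apply K; lra|]. apply ex_RInt_pos; auto. lra.
    - intros t _. rewrite Rplus_0_r. reflexivity. }
  apply (imp_scal (/ c)) in H. revert H. apply imp_ext. intros t Ht.
  rewrite scal_assoc. unfold mult; simpl. rewrite Rinv_l by lra. apply (scal_one (V := V)).
Qed.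

(** The endpoints come in either order, since the Cauchy criterion of [imp_dominated] compares
    arbitrary intervals. *)
Lemma norm_RInt_pos_le (f : R -> V) (g : R -> R) (a b : R) :
  (forall t, 0 < t -> continuous f t) -> (forall t, 0 < t -> continuous g t) ->
  (forall t, 0 < t -> norm (f t) <= g t) -> 0 < a -> 0 < b ->
  norm (RInt f a b) <= Rabs (RInt g a b).
Proof.
  intros Hf Hg Hn Ha Hb.
  assert (P : forall a b, 0 < a -> a <= b -> norm (RInt f a b) <= Rabs (RInt g a b)).
  { clear a b Ha Hb. intros a b Ha Hab.
    eapply Rle_trans; [|apply Rle_abs].
    apply (norm_RInt_le (V := V) f g a b); auto.
    - intros t Ht. apply Hn. lra.
    - apply (RInt_correct (V := V)). apply ex_RInt_pos; auto; lra.
    - apply (RInt_correct (V := R_CompleteNormedModule)).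
      apply (ex_RInt_continuous (V := R_CompleteNormedModule)). intros t Ht.
      rewrite Rmin_left in Ht by lra. apply Hg. lra. }
  destruct (Rle_dec a b) as [L|L]; [now apply P|].
  rewrite <- (opp_RInt_swap (V := V)) by (apply ex_RInt_pos; auto).
  eapply Rle_trans; [right; apply (norm_opp (K := R_AbsRing) (V := V) (RInt f b a))|].
  rewrite <- (opp_RInt_swap (V := R_CompleteNormedModule)).
  2:{ apply (ex_RInt_continuous (V := R_CompleteNormedModule)). intros t Ht. apply Hg.
      eapply Rlt_le_trans; [|exact (proj1 Ht)]. now apply Rmin_pos. }
  unfold opp; simpl. rewrite Rabs_Ropp. apply P; lra.
Qed.

End Improper.

Notation rimp := (imp (V := R_CompleteNormedModule)).
Notation cimp := (imp (V := CV)).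

Lemma rimp_eps (g : R -> R) (k : R) : rimp g k ->
  forall eps, 0 < eps -> exists d b0, 0 < d /\ 0 < b0 /\
    forall a b, 0 < a < d -> b0 < b -> Rabs (RInt g a b - k) < eps.
Proof. exact (imp_eps (V := R_CompleteNormedModule) g k). Qed.

Lemma rimp_intro (g : R -> R) (k : R) : (forall t, 0 < t -> continuous g t) ->
  (forall eps, 0 < eps -> exists d b0, 0 < d /\ 0 < b0 /\
    forall a b, 0 < a < d -> b0 < b -> Rabs (RInt g a b - k) < eps) -> rimp g k.
Proof. exact (imp_intro (V := R_CompleteNormedModule) g k). Qed.

Lemma rimp_scal (c : R) (f : R -> R) (l : R) : rimp f l -> rimp (fun t => c * f t) (c * l).
Proof. exact (imp_scal (V := R_CompleteNormedModule) c f l). Qed.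

Lemma rimp_plus (f g : R -> R) (l k : R) :
  rimp f l -> rimp g k -> rimp (fun t => f t + g t) (l + k).
Proof. exact (imp_plus (V := R_CompleteNormedModule) f g l k). Qed.

Lemma minus_plus_middle {G : AbelianGroup} (x y z : G) :
  minus (plus x (plus y z)) y = plus x z.
Proof.
  unfold minus. rewrite <- (plus_assoc x), (plus_comm y z), <- (plus_assoc z y), plus_opp_r, plus_zero_r.
  reflexivity.
Qed.

(** Cauchy criterion: two proper integrals of [f] differ by a piece near [0] and a piece near
    infinity, each bounded by the same piece of the integral of [g]. *)
Lemma imp_dominated {V : CompleteNormedModule R_AbsRing} (f : R -> V) (g : R -> R) (k : R) :
  (forall t, 0 < t -> continuous f t) -> (forall t, 0 < t -> norm (f t) <= g t) ->
  rimp g k -> exists l, imp f l.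
Proof.
  intros Hf Hn Hg. pose proof (proj1 Hg) as Hgc.
  destruct (proj1 (filterlim_locally_cauchy (F := FF) (fun ab => RInt f (fst ab) (snd ab))))
    as [l Hl]; [|exists l; split; auto].
  intros eps. assert (He : 0 < eps / 8) by (pose proof (cond_pos eps); lra).
  destruct (rimp_eps g k Hg _ He) as [d [b0 [Hd [Hb K]]]].
  exists (fun ab => 0 < fst ab < d /\ b0 < snd ab). split.
  { apply FF_iff. exists d, b0. repeat split; simpl; auto; lra. }
  intros [a b] [a' b'] [Ha Hb1] [Ha' Hb1']. simpl in *.
  apply (norm_compat1 (V := V)).
  assert (ex : forall x y, 0 < x -> 0 < y -> ex_RInt f x y)
    by (intros; now apply ex_RInt_pos).
  assert (exg : forall x y, 0 < x -> 0 < y -> ex_RInt g x y)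
    by (intros; now apply (ex_RInt_pos (V := R_CompleteNormedModule))).
  assert (E : minus (RInt f a' b') (RInt f a b) = plus (RInt f a' a) (RInt f b b')).
  { assert (E1 := RInt_Chasles (V := V) f a' a b' (ex a' a ltac:(lra) ltac:(lra))
      (ex a b' ltac:(lra) ltac:(lra))).
    assert (E2 := RInt_Chasles (V := V) f a b b' (ex a b ltac:(lra) ltac:(lra))
      (ex b b' ltac:(lra) ltac:(lra))).
    rewrite <- E1, <- E2. exact (minus_plus_middle (G := V) _ _ _). }
  eapply Rle_lt_trans; [right; exact (f_equal (@norm R_AbsRing V) E)|].
  eapply Rle_lt_trans; [apply (norm_triangle (V := V))|].
  pose proof (norm_RInt_pos_le f g a' a Hf Hgc Hn ltac:(lra) ltac:(lra)) as N1.
  pose proof (norm_RInt_pos_le f g b b' Hf Hgc Hn ltac:(lra) ltac:(lra)) as N2.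
  assert (G1 : Rabs (RInt g a' a) < eps / 4).
  { pose proof (RInt_Chasles (V := R_CompleteNormedModule) g a' a b
      (exg a' a ltac:(lra) ltac:(lra)) (exg a b ltac:(lra) ltac:(lra))) as C.
    unfold plus in C; simpl in C.
    pose proof (K a b Ha Hb1) as K1. pose proof (K a' b Ha' Hb1) as K2.
    apply Rabs_def2 in K1, K2. apply Rabs_def1; lra. }
  assert (G2 : Rabs (RInt g b b') < eps / 4).
  { pose proof (RInt_Chasles (V := R_CompleteNormedModule) g a b b'
      (exg a b ltac:(lra) ltac:(lra)) (exg b b' ltac:(lra) ltac:(lra))) as C.
    unfold plus in C; simpl in C.
    pose proof (K a b Ha Hb1) as K1. pose proof (K a b' Ha Hb1') as K2.
    apply Rabs_def2 in K1, K2. apply Rabs_def1; lra. }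
  pose proof (cond_pos eps). lra.
Qed.

Lemma plus_opp_minus {G : AbelianGroup} (x l : G) : l = plus x (opp (minus x l)).
Proof.
  rewrite opp_minus. unfold minus. rewrite plus_assoc, (plus_comm x l), <- (plus_assoc l x).
  rewrite plus_opp_r, plus_zero_r. reflexivity.
Qed.

Lemma norm_le_minus {V : NormedModule R_AbsRing} (x l : V) :
  norm l <= norm x + norm (minus x l).
Proof.
  rewrite <- (norm_opp (minus x l)).
  eapply Rle_trans; [|apply norm_triangle]. right. f_equal.
  exact (plus_opp_minus (G := NormedModule.AbelianGroup R_AbsRing V) x l).
Qed.

Lemma imp_norm_le {V : CompleteNormedModule R_AbsRing} (f : R -> V) (l : V) (g : R -> R) (k : R) :
  imp f l -> rimp g k -> (forall t, 0 < t -> norm (f t) <= g t) -> norm l <= k.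
Proof.
  intros Hf Hg Hn. apply Rnot_lt_le. intros Hlt.
  set (e := (norm l - k) / 4). assert (He : 0 < e) by (unfold e; lra).
  destruct (imp_eps f l Hf e He) as [d [b0 [Hd [Hb K]]]].
  destruct (rimp_eps g k Hg e He) as [d' [b0' [Hd' [Hb' K']]]].
  set (a := Rmin d d' / 2). set (b := Rmax (Rmax b0 b0') a + 1).
  assert (Ha : 0 < Rmin d d') by now apply Rmin_pos.
  pose proof (Rmin_l d d'). pose proof (Rmin_r d d').
  pose proof (Rmax_l (Rmax b0 b0') a). pose proof (Rmax_r (Rmax b0 b0') a).
  pose proof (Rmax_l b0 b0'). pose proof (Rmax_r b0 b0').
  assert (Hab : 0 < a <= b) by (split; [unfold a|unfold b]; lra).
  specialize (K a b ltac:(unfold a; lra) ltac:(unfold b; lra)).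
  specialize (K' a b ltac:(unfold a; lra) ltac:(unfold b; lra)).
  assert (N : norm (RInt f a b) <= RInt g a b).
  { apply (norm_RInt_le (V := V) f g a b); [lra| | |].
    - intros t Ht. apply Hn. lra.
    - apply (RInt_correct (V := V)). apply ex_RInt_pos; try lra. apply Hf.
    - apply (RInt_correct (V := R_CompleteNormedModule)).
      apply (ex_RInt_pos (V := R_CompleteNormedModule)); try lra. apply Hg. }
  apply Rabs_def2 in K'.
  pose proof (norm_le_minus (V := V) (RInt f a b) l) as T.
  assert (T2 : norm l <= RInt g a b + e).
  { eapply Rle_trans; [exact T|]. apply Rplus_le_compat; [exact N|left; exact K]. }
  unfold e in *. lra.
Qed.

Lemma rimp_primitive (F f : R -> R) (L0 L1 : R) :
  (forall t, 0 < t -> is_derive F t (f t)) -> (forall t, 0 < t -> continuous f t) ->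
  filterlim F (at_right 0) (locally L0) -> filterlim F (Rbar_locally p_infty) (locally L1) ->
  rimp f (L1 - L0).
Proof.
  intros Hd Hc H0 H1. split; auto.
  apply (filterlim_ext_loc (fun ab => minus (F (snd ab)) (F (fst ab)))).
  - generalize FF_pos. apply filter_imp. intros [a b] Hab. simpl in *. symmetry.
    apply (is_RInt_unique (V := R_CompleteNormedModule)).
    apply (is_RInt_derive (V := R_CompleteNormedModule) F f); intros t Ht;
      rewrite Rmin_left in Ht by lra; [apply Hd|apply Hc]; lra.
  - apply (filterlim_comp_2 (fun ab : R * R => F (snd ab)) (fun ab : R * R => opp (F (fst ab)))
      (fun x y => plus x y) (G := locally L1) (H := locally (opp L0))).
    + eapply filterlim_comp; [apply filterlim_snd|exact H1].
    + eapply filterlim_comp; [|apply (filterlim_opp (V := R_NormedModule) L0)].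
      eapply filterlim_comp; [apply filterlim_fst|exact H0].
    + apply (filterlim_plus (V := R_NormedModule) L1 (opp L0)).
Qed.

Lemma cimp_pair (f : R -> C) (l : C) :
  rimp (fun t => Re (f t)) (Re l) -> rimp (fun t => Im (f t)) (Im l) -> cimp f l.
Proof.
  intros H1 H2.
  assert (Hc : forall t, 0 < t -> rcont f t).
  { intros t Ht. apply (rcont_ext (fun t => (Re (f t), Im (f t)))).
    - intros s. destruct (f s); reflexivity.
    - apply rcont_pair; [now apply H1|now apply H2]. }
  apply imp_intro; auto. intros eps He.
  destruct (rimp_eps _ _ H1 (eps / 2) ltac:(lra)) as [d [b0 [Hd [Hb K]]]].
  destruct (rimp_eps _ _ H2 (eps / 2) ltac:(lra)) as [d' [b0' [Hd' [Hb' K']]]].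
  exists (Rmin d d'), (Rmax b0 b0'). split; [now apply Rmin_pos|].
  split; [eapply Rlt_le_trans; [exact Hb|apply Rmax_l]|].
  intros a b Ha Hab.
  pose proof (Rmin_l d d'). pose proof (Rmin_r d d').
  pose proof (Rmax_l b0 b0'). pose proof (Rmax_r b0 b0').
  specialize (K a b ltac:(lra) ltac:(lra)). specialize (K' a b ltac:(lra) ltac:(lra)).
  assert (E : CInt f a b = (RInt (fun t => Re (f t)) a b, RInt (fun t => Im (f t)) a b)).
  { apply (is_RInt_unique (V := CV)).
    apply (is_RInt_fct_extend_pair (U := R_NormedModule) (V := R_NormedModule) f a b);
    apply (RInt_correct (V := R_CompleteNormedModule));
    apply (ex_RInt_pos (V := R_CompleteNormedModule)); try lra; [apply H1|apply H2]. }
  rewrite E. eapply Rle_lt_trans; [right; symmetry; apply Cmod_norm|].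
  eapply Rle_lt_trans; [apply Cmod_le_Rabs|]. destruct l as [l1 l2]. simpl in *.
  unfold Rminus in K, K'.
  change (Rabs (RInt (fun t => Re (f t)) a b + - l1) + Rabs (RInt (fun t => Im (f t)) a b + - l2) < eps).
  lra.
Qed.

Lemma cimp_proj (f : R -> C) (l : C) : cimp f l ->
  rimp (fun t => Re (f t)) (Re l) /\ rimp (fun t => Im (f t)) (Im l).
Proof.
  intros H. pose proof (proj1 H) as Hc.
  assert (Hr : forall t, 0 < t -> continuous (fun s => Re (f s)) t)
    by (intros; now apply rcont_fst, Hc).
  assert (Hi : forall t, 0 < t -> continuous (fun s => Im (f s)) t)
    by (intros; now apply rcont_snd, Hc).
  assert (E : forall a b, 0 < a -> 0 < b ->
    CInt f a b = (RInt (fun t => Re (f t)) a b, RInt (fun t => Im (f t)) a b)).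
  { intros a b Ha Hb. apply (is_RInt_unique (V := CV)).
    apply (is_RInt_fct_extend_pair (U := R_NormedModule) (V := R_NormedModule) f a b);
    apply (RInt_correct (V := R_CompleteNormedModule));
    apply (ex_RInt_pos (V := R_CompleteNormedModule)); auto. }
  assert (K : forall eps, 0 < eps -> exists d b0, 0 < d /\ 0 < b0 /\
    forall a b, 0 < a < d -> b0 < b ->
      Rabs (RInt (fun t => Re (f t)) a b - Re l) < eps /\
      Rabs (RInt (fun t => Im (f t)) a b - Im l) < eps).
  { intros eps He. destruct (imp_eps (V := CV) f l H eps He) as [d [b0 [Hd [Hb K]]]].
    exists d, b0. repeat split; auto; specialize (K a b H0 H1); rewrite E in K by lra;
    eapply Rle_lt_trans; try exact K;
    (eapply Rle_trans; [|right; apply Cmod_norm]).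
    - apply (re_le_Cmod (RInt (fun t => Re (f t)) a b - Re l, RInt (fun t => Im (f t)) a b - Im l)).
    - apply (im_le_Cmod (RInt (fun t => Re (f t)) a b - Re l, RInt (fun t => Im (f t)) a b - Im l)). }
  split.
  - apply (rimp_intro (fun t => Re (f t)) (Re l) Hr). intros eps He.
    destruct (K eps He) as [d [b0 [Hd [Hb K']]]]. exists d, b0.
    split; [exact Hd|split; [exact Hb|]]. intros a b Ha Hb'. exact (proj1 (K' a b Ha Hb')).
  - apply (rimp_intro (fun t => Im (f t)) (Im l) Hi). intros eps He.
    destruct (K eps He) as [d [b0 [Hd [Hb K']]]]. exists d, b0.
    split; [exact Hd|split; [exact Hb|]]. intros a b Ha Hb'. exact (proj2 (K' a b Ha Hb')).
Qed.

Lemma cimp_mult (c : C) (f : R -> C) (l : C) : cimp f l -> cimp (fun t => c * f t)%C (c * l)%C.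
Proof.
  intros H. destruct (cimp_proj f l H) as [H1 H2].
  apply cimp_pair.
  - apply (imp_ext (V := R_CompleteNormedModule)
      (fun t => Re c * Re (f t) + - Im c * Im (f t))).
    { intros t _. unfold Re, Im, Cmult; simpl. ring. }
    replace (Re (c * l)%C) with (Re c * Re l + - Im c * Im l) by (unfold Re, Im, Cmult; simpl; ring).
    exact (rimp_plus _ _ _ _ (rimp_scal _ _ _ H1) (rimp_scal _ _ _ H2)).
  - apply (imp_ext (V := R_CompleteNormedModule)
      (fun t => Re c * Im (f t) + Im c * Re (f t))).
    { intros t _. unfold Re, Im, Cmult; simpl. ring. }
    replace (Im (c * l)%C) with (Re c * Im l + Im c * Re l) by (unfold Re, Im, Cmult; simpl; ring).
    exact (rimp_plus _ _ _ _ (rimp_scal _ _ _ H2) (rimp_scal _ _ _ H1)).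
Qed.

Lemma cimp_plus (f g : R -> C) (l k : C) :
  cimp f l -> cimp g k -> cimp (fun t => f t + g t)%C (l + k)%C.
Proof. exact (imp_plus (V := CV) f g l k). Qed.

Lemma cimp_minus (f g : R -> C) (l k : C) :
  cimp f l -> cimp g k -> cimp (fun t => f t - g t)%C (l - k)%C.
Proof.
  intros Hf Hg. apply (imp_ext (V := CV) (fun t => f t + (- (1)) * g t)%C).
  - intros t _. cring.
  - replace (l - k)%C with (l + (- (1)) * k)%C by ring.
    apply cimp_plus; auto. now apply cimp_mult.
Qed.

Lemma cimp_RtoC (f : R -> R) (l : R) : rimp f l -> cimp (fun t => RtoC (f t)) (RtoC l).
Proof.
  intros H. apply cimp_pair; [exact H|]. simpl.
  apply (imp_ext (V := R_CompleteNormedModule) (fun t => 0 * f t)).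
  - intros t _. apply Rmult_0_l.
  - pose proof (rimp_scal 0 f l H) as K. rewrite (Rmult_0_l l) in K. exact K.
Qed.

Lemma cimp_le (f : R -> C) (l : C) (g : R -> R) (k : R) :
  cimp f l -> rimp g k -> (forall t, 0 < t -> Cmod (f t) <= g t) -> Cmod l <= k.
Proof.
  intros Hf Hg H. rewrite Cmod_norm. apply (imp_norm_le (V := CV) f l g k); auto.
  intros t Ht. eapply Rle_trans; [right; symmetry; apply Cmod_norm|auto].
Qed.

Lemma cimp_dominated (f : R -> C) (g : R -> R) (k : R) :
  (forall t, 0 < t -> rcont f t) -> (forall t, 0 < t -> Cmod (f t) <= g t) ->
  rimp g k -> exists l, cimp f l.
Proof.
  intros Hf H Hg. apply (imp_dominated (V := CV) f g k); auto.
  intros t Ht. eapply Rle_trans; [right; symmetry; apply Cmod_norm|auto].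
Qed.

(** * The Gamma function *)

Notation cp a b := (@pair R R a%R b%R) (only parsing).

Lemma lim_at_0 (F : R -> R) (L : R) :
  (forall eps, 0 < eps -> exists d, 0 < d /\ forall a, 0 < a < d -> Rabs (F a - L) < eps) ->
  filterlim F (at_right 0) (locally L).
Proof.
  intros H. apply filterlim_locally. intros eps. apply at_right_0.
  destruct (H eps (cond_pos eps)) as [d [Hd K]]. exists d. split; auto.
Qed.

Lemma lim_at_infty (F : R -> R) (L : R) :
  (forall eps, 0 < eps -> exists M, forall b, M < b -> Rabs (F b - L) < eps) ->
  filterlim F (Rbar_locally p_infty) (locally L).
Proof.
  intros H. apply filterlim_locally. intros eps.
  destruct (H eps (cond_pos eps)) as [M K]. exists M. exact K.
Qed.

Lemma exp_le_le (x y : R) : x <= y -> exp x <= exp y.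
Proof. intros [H|H]; [left; now apply exp_increasing|rewrite H; lra]. Qed.

Lemma pow_small (s eps : R) : 0 < s -> 0 < eps ->
  exists d, 0 < d /\ forall t, 0 < t < d -> exp (s * ln t) < eps.
Proof.
  intros Hs He. exists (exp (ln eps / s)). split; [apply exp_pos|]. intros t Ht.
  rewrite <- (exp_ln eps) at 1 by auto. apply exp_increasing.
  assert (H : ln t < ln eps / s).
  { rewrite <- (ln_exp (ln eps / s)). apply ln_increasing; lra. }
  apply Rmult_lt_compat_l with (r := s) in H; auto.
  replace (s * (ln eps / s)) with (ln eps) in H by (field; lra). exact H.
Qed.

Lemma ex_derive_cont (f : R -> R) (t : R) : ex_derive f t -> continuous f t.
Proof. apply (ex_derive_continuous (K := R_AbsRing) (V := R_NormedModule)). Qed.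

(* The derivative of [t^s / (1 + t^s)]. *)
Definition gdom (s t : R) : R := s / t * exp (s * ln t) / (1 + exp (s * ln t)) ^ 2.

Lemma rimp_gdom (s : R) : 0 < s -> rimp (gdom s) 1.
Proof.
  intros Hs. replace 1 with (0 - -1) by ring.
  apply (rimp_primitive (fun t => - / (1 + exp (s * ln t)))).
  - intros t Ht. pose proof (exp_pos (s * ln t)). unfold gdom. auto_derive; [lra|].
    field. lra.
  - intros t Ht. pose proof (exp_pos (s * ln t)). apply ex_derive_cont. unfold gdom.
    auto_derive. repeat split; try lra. apply Rgt_not_eq. nra.
  - apply lim_at_0. intros eps He. destruct (pow_small s eps Hs He) as [d [Hd K]].
    exists d; split; auto. intros a Ha. specialize (K a Ha).
    pose proof (exp_pos (s * ln a)) as P. set (E := exp (s * ln a)) in *.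
    replace (- / (1 + E) - -1) with (E / (1 + E)) by (field; lra).
    rewrite Rabs_pos_eq by (apply Rdiv_le_0_compat; lra).
    apply Rle_lt_trans with E; auto. apply Rle_div_l; nra.
  - apply lim_at_infty. intros eps He. destruct (pow_small s eps Hs He) as [d [Hd K]].
    exists (/ d). intros b Hb.
    assert (Hb0 : 0 < b) by (pose proof (Rinv_0_lt_compat d Hd); lra).
    assert (K' : exp (s * ln (/ b)) < eps).
    { apply K. split; [now apply Rinv_0_lt_compat|].
      rewrite <- (Rinv_inv d). apply Rinv_lt_contravar; auto.
      apply Rmult_lt_0_compat; auto. now apply Rinv_0_lt_compat. }
    rewrite ln_Rinv in K' by auto.
    replace (s * - ln b) with (- (s * ln b)) in K' by ring. rewrite exp_Ropp in K'.
    pose proof (exp_pos (s * ln b)) as P. set (E := exp (s * ln b)) in *.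
    rewrite Rminus_0_r, Rabs_Ropp, Rabs_pos_eq by (left; apply Rinv_0_lt_compat; lra).
    apply Rlt_trans with (/ E); auto. apply Rinv_lt_contravar; nra.
Qed.

(** [1 + t <= n * (1 + t / n) <= n * exp (t / n)] for an integer [n] at least [1] and [s], raised to
    the power [n]. *)
Lemma pow_exp_bound (s : R) : exists K, 0 < K /\ forall t, 0 < t ->
  exp (s * ln (1 + t)) <= K * exp t.
Proof.
  destruct (INR_unbounded s) as [n0 Hn0]. set (n := S n0).
  assert (Hn : s <= INR n) by (unfold n; rewrite S_INR; lra).
  assert (Hp : 1 <= INR n) by (replace 1 with (INR 1) by reflexivity; apply le_INR; unfold n; lia).
  exists (INR n ^ n). split; [apply pow_lt; lra|]. intros t Ht.
  assert (H0 : 0 <= ln (1 + t)) by (rewrite <- ln_1; apply Rlt_le, ln_increasing; lra).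
  apply Rle_trans with ((1 + t) ^ n).
  - rewrite <- Rpower_pow by lra. unfold Rpower. apply exp_le_le.
    apply Rmult_le_compat_r; auto.
  - replace (exp t) with (exp (t / INR n) ^ n).
    + rewrite <- Rpow_mult_distr. apply pow_incr. split; [lra|].
      pose proof (exp_ineq1_le (t / INR n)) as G.
      apply Rle_trans with (INR n * (1 + t / INR n)); [|apply Rmult_le_compat_l; lra].
      replace (INR n * (1 + t / INR n)) with (INR n + t) by (field; lra). lra.
    + rewrite <- Rpower_pow by apply exp_pos. unfold Rpower. rewrite ln_exp. f_equal. field. lra.
Qed.

Definition gker (x t : R) : R := exp ((x - 1) * ln t - t).

(** [gdom s] is of order [t ^ (s - 1)] at [0] and [t ^ (- s - 1)] at infinity and has a known
    primitive: one majorant serves both ends, the exponential absorbing [(1 + t) ^ (2 * s)]. *)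
Lemma gker_dom (s : R) : 0 < s -> exists K, 0 < K /\ forall t, 0 < t -> gker s t <= K * gdom s t.
Proof.
  intros Hs. destruct (pow_exp_bound (2 * s)) as [K [HK B]].
  exists (4 * K / s). split; [apply Rdiv_lt_0_compat; lra|]. intros t Ht.
  specialize (B t Ht). unfold gker, gdom.
  assert (HE : exp (s * ln t) <= exp (s * ln (1 + t))).
  { apply exp_le_le, Rmult_le_compat_l; [lra|]. left. apply ln_increasing; lra. }
  assert (H1 : 1 <= exp (s * ln (1 + t))).
  { rewrite <- exp_0 at 1. apply exp_le_le. apply Rmult_le_pos; [lra|].
    rewrite <- ln_1. left; apply ln_increasing; lra. }
  replace (2 * s * ln (1 + t)) with (s * ln (1 + t) + s * ln (1 + t)) in B by ring.
  rewrite exp_plus in B.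
  replace ((s - 1) * ln t - t) with (s * ln t + - ln t + - t) by ring.
  rewrite !exp_plus, (exp_Ropp (ln t)), exp_ln, exp_Ropp by auto.
  pose proof (exp_pos (s * ln t)) as P. pose proof (exp_pos t) as Pt.
  set (E := exp (s * ln t)) in *. set (E1 := exp (s * ln (1 + t))) in *.
  assert (H2 : (1 + E) ^ 2 <= 4 * K * exp t).
  { apply Rle_trans with (4 * (E1 * E1)); [|lra]. nra. }
  replace (4 * K / s * (s / t * E / (1 + E) ^ 2)) with
    (E * / t * (4 * K / (1 + E) ^ 2)) by (field; repeat split; lra).
  apply Rmult_le_compat_l.
  - apply Rmult_le_pos; [lra|left; now apply Rinv_0_lt_compat].
  - apply Rle_div_r; [nra|]. apply Rmult_le_reg_l with (exp t); auto.
    rewrite <- Rmult_assoc, Rinv_r, Rmult_1_l by lra. lra.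
Qed.

Definition gam (s : C) (t : R) : C := Cexp ((Re s - 1) * ln t - t, Im s * ln t).

Lemma Cexp_path_cont (z1 z2 : R -> R) (t : R) :
  continuous z1 t -> continuous z2 t -> rcont (fun u => Cexp (z1 u, z2 u)) t.
Proof.
  intros H1 H2. apply (rcont_comp Cexp (fun u => (z1 u, z2 u))).
  - now apply rcont_pair.
  - apply cdiff_ccont, cdiff_Cexp.
Qed.

Lemma gam_cont (s : C) (t : R) : 0 < t -> rcont (gam s) t.
Proof.
  intros Ht. apply Cexp_path_cont; apply ex_derive_cont; auto_derive; lra.
Qed.

Lemma Cmod_gam (s : C) (t : R) : Cmod (gam s t) = gker (Re s) t.
Proof. unfold gam. rewrite Cmod_Cexp. reflexivity. Qed.

Lemma cimp_gam (s : C) : 0 < Re s -> cimp (gam s) (CGamma s).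
Proof.
  intros Hs. destruct (gker_dom (Re s) Hs) as [K [HK B]].
  destruct (cimp_dominated (gam s) (fun t => K * gdom (Re s) t) (K * 1)) as [l Hl].
  - intros; now apply gam_cont.
  - intros t Ht. rewrite Cmod_gam. now apply B.
  - apply rimp_scal. now apply rimp_gdom.
  - replace (CGamma s) with l; [exact Hl|].
    destruct (cimp_proj _ _ Hl) as [H1 H2]. unfold CGamma. apply Ceq.
    + symmetry. apply (imp_RInt_gen (V := R_CompleteNormedModule)). revert H1. apply imp_ext.
      intros t Ht. unfold gam, Cexp; simpl. unfold Rminus at 1. rewrite exp_plus. ring.
    + symmetry. apply (imp_RInt_gen (V := R_CompleteNormedModule)). revert H2. apply imp_ext.
      intros t Ht. unfold gam, Cexp; simpl. unfold Rminus at 1. rewrite exp_plus. ring.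
Qed.

Lemma CGamma_RtoC (x : R) : 0 < x -> CGamma (RtoC x) = RtoC (RGamma x).
Proof.
  intros Hx. destruct (cimp_proj _ _ (cimp_gam (RtoC x) Hx)) as [H1 H2].
  apply Ceq.
  - assert (K : rimp (fun t => Rpower t (x - 1) * exp (- t)) (Re (CGamma (RtoC x)))).
    { revert H1. apply imp_ext. intros t Ht. unfold gam, Cexp, Rpower; simpl.
      rewrite Rmult_0_l, cos_0. unfold Rminus at 1. rewrite exp_plus. ring. }
    exact (eq_sym (imp_RInt_gen (V := R_CompleteNormedModule) _ _ K)).
  - apply (imp_unique (V := R_CompleteNormedModule) (fun t => Im (gam (RtoC x) t)) _ 0 H2).
    apply (imp_ext (V := R_CompleteNormedModule) (fun t => 0 * Re (gam (RtoC x) t))).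
    + intros t Ht. unfold gam, Cexp; simpl. rewrite (Rmult_0_l (ln t)), sin_0. 
      rewrite Rmult_0_l, Rmult_0_r. reflexivity.
    + pose proof (rimp_scal 0 _ _ H1) as K. rewrite (Rmult_0_l (Re (CGamma (RtoC x)))) in K.
      exact K.
Qed.

Lemma rimp_gker (x : R) : 0 < x -> rimp (gker x) (RGamma x).
Proof.
  intros Hx. destruct (cimp_proj _ _ (cimp_gam (RtoC x) Hx)) as [H1 _].
  rewrite CGamma_RtoC in H1 by auto. revert H1. apply imp_ext. intros t Ht.
  unfold gam, Cexp, gker; simpl. rewrite Rmult_0_l, cos_0. ring.
Qed.

Lemma rimp_pos (f : R -> R) (l : R) : rimp f l -> (forall t, 0 < t -> 0 < f t) -> 0 < l.
Proof.
  intros H Hp. pose proof (proj1 H) as Hc.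
  assert (ex : forall a b, 0 < a -> 0 < b -> ex_RInt f a b)
    by (intros; now apply (ex_RInt_pos (V := R_CompleteNormedModule))).
  assert (Hi : 0 < RInt f 1 2).
  { apply RInt_gt_0; [lra| |].
    - intros t Ht. apply Hp; lra.
    - intros t Ht. apply Hc; lra. }
  destruct (rimp_eps f l H (RInt f 1 2) Hi) as [d [b0 [Hd [Hb K]]]].
  set (a := Rmin d 1 / 2). set (b := Rmax b0 2 + 1).
  assert (Hd1 : 0 < Rmin d 1) by (apply Rmin_pos; lra).
  pose proof (Rmin_l d 1). pose proof (Rmin_r d 1).
  pose proof (Rmax_l b0 2). pose proof (Rmax_r b0 2).
  assert (Ha : 0 < a < 1) by (unfold a; lra). assert (Hb2 : 2 < b) by (unfold b; lra).
  specialize (K a b ltac:(unfold a; lra) ltac:(unfold b; lra)). apply Rabs_def2 in K.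
  pose proof (RInt_Chasles (V := R_CompleteNormedModule) f a 1 b
    (ex a 1 ltac:(lra) ltac:(lra)) (ex 1 b ltac:(lra) ltac:(lra))) as E1.
  pose proof (RInt_Chasles (V := R_CompleteNormedModule) f 1 2 b
    (ex 1 2 ltac:(lra) ltac:(lra)) (ex 2 b ltac:(lra) ltac:(lra))) as E2.
  unfold plus in E1, E2; simpl in E1, E2.
  assert (0 <= RInt f a 1).
  { apply RInt_ge_0; [lra|apply ex; lra|]. intros t Ht. left; apply Hp; lra. }
  assert (0 <= RInt f 2 b).
  { apply RInt_ge_0; [lra|apply ex; lra|]. intros t Ht. left; apply Hp; lra. }
  lra.
Qed.

Lemma RGamma_pos (x : R) : 0 < x -> 0 < RGamma x.
Proof. intros Hx. apply (rimp_pos _ _ (rimp_gker x Hx)). intros; apply exp_pos. Qed.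

(** The integrand is the derivative of [Cexp (z1, z2)], whose modulus [exp z1] vanishes at both
    ends. The functional equations of Gamma and of the Beta integral are both instances. *)
Lemma cimp_derivative_zero (z1 z2 d1 d2 : R -> R) :
  (forall t, 0 < t -> is_derive z1 t (d1 t)) -> (forall t, 0 < t -> is_derive z2 t (d2 t)) ->
  (forall t, 0 < t -> continuous d1 t) -> (forall t, 0 < t -> continuous d2 t) ->
  filterlim (fun t => exp (z1 t)) (at_right 0) (locally 0) ->
  filterlim (fun t => exp (z1 t)) (Rbar_locally p_infty) (locally 0) ->
  cimp (fun t => (d1 t, d2 t) * Cexp (z1 t, z2 t))%C (RtoC 0).
Proof.
  intros D1 D2 C1 C2 L0 L1.
  assert (Hz1 : forall t, 0 < t -> continuous z1 t)
    by (intros t Ht; apply ex_derive_cont; eexists; now apply D1).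
  assert (Hz2 : forall t, 0 < t -> continuous z2 t)
    by (intros t Ht; apply ex_derive_cont; eexists; now apply D2).
  assert (Hc : forall t, 0 < t -> rcont (fun t => (d1 t, d2 t) * Cexp (z1 t, z2 t))%C t).
  { intros t Ht. apply rcont_mult; [apply rcont_pair; auto|apply Cexp_path_cont; auto]. }
  assert (Sq : forall (h : R -> R) F (FFF : Filter F), (forall t, Rabs (h t) <= 1) ->
    filterlim (fun t => exp (z1 t)) F (locally 0) ->
    filterlim (fun t => exp (z1 t) * h t) F (locally 0)).
  { intros h F FFF Hh HF. apply filterlim_locally. intros eps.
    generalize (proj1 (filterlim_locally _ _) HF eps). apply filter_imp. intros t Ht.
    unfold ball in *; simpl in *; unfold AbsRing_ball, abs, minus, plus, opp in *; simpl in *.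
    rewrite Ropp_0, Rplus_0_r in *. rewrite Rabs_mult.
    eapply Rle_lt_trans; [|exact Ht]. rewrite <- (Rmult_1_r (Rabs (exp (z1 t)))) at 2.
    apply Rmult_le_compat_l; [apply Rabs_pos|auto]. }
  assert (Bc : forall t, Rabs (cos (z2 t)) <= 1) by (intros t; apply Rabs_le, COS_bound).
  assert (Bs : forall t, Rabs (sin (z2 t)) <= 1) by (intros t; apply Rabs_le, SIN_bound).
  apply cimp_pair; simpl; replace 0 with (0 - 0) at 1 by ring.
  - apply (rimp_primitive (fun t => exp (z1 t) * cos (z2 t))).
    + intros t Ht. specialize (D1 t Ht). specialize (D2 t Ht).
      auto_derive; [repeat split; eexists; eassumption|].
      assert (U1 : Derive (fun x => z1 x) t = d1 t) by exact (is_derive_unique _ _ _ D1).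
      assert (U2 : Derive (fun x => z2 x) t = d2 t) by exact (is_derive_unique _ _ _ D2).
      rewrite U1, U2. simpl. ring.
    + intros t Ht. exact (rcont_fst _ _ (Hc t Ht)).
    + apply Sq; auto; apply filter_filter.
    + apply Sq; auto; apply filter_filter.
  - apply (rimp_primitive (fun t => exp (z1 t) * sin (z2 t))).
    + intros t Ht. specialize (D1 t Ht). specialize (D2 t Ht).
      auto_derive; [repeat split; eexists; eassumption|].
      assert (U1 : Derive (fun x => z1 x) t = d1 t) by exact (is_derive_unique _ _ _ D1).
      assert (U2 : Derive (fun x => z2 x) t = d2 t) by exact (is_derive_unique _ _ _ D2).
      rewrite U1, U2. simpl. ring.
    + intros t Ht. exact (rcont_snd _ _ (Hc t Ht)).
    + apply Sq; auto; apply filter_filter.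
    + apply Sq; auto; apply filter_filter.
Qed.

Lemma gam_shift (s : C) (t : R) : 0 < t -> gam (s + 1) t = (RtoC t * gam s t)%C.
Proof.
  intros Ht. rewrite <- (exp_ln t) at 2 by auto. rewrite <- Cexp_RtoC. unfold gam.
  rewrite <- Cexp_plus. f_equal. apply Ceq; destruct s; simpl; ring.
Qed.

(** The derivative of [t ^ s * exp (- t)] is [s * gam s t - gam (s + 1) t] and integrates to
    zero. *)
Lemma CGamma_succ (s : C) : 0 < Re s -> CGamma (s + 1) = (s * CGamma s)%C.
Proof.
  intros Hs. set (x := Re s). set (y := Im s).
  assert (Hz : cimp (fun t => cp (x / t - 1) (y / t) * Cexp (cp (x * ln t - t) (y * ln t)))%C (RtoC 0)).
  { apply (cimp_derivative_zero (fun t => x * ln t - t) (fun t => y * ln t)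
      (fun t => x / t - 1) (fun t => y / t)).
    - intros t Ht. auto_derive; [lra|]. field. lra.
    - intros t Ht. auto_derive; [lra|]. field. lra.
    - intros t Ht. apply ex_derive_cont. auto_derive. lra.
    - intros t Ht. apply ex_derive_cont. auto_derive. lra.
    - apply lim_at_0. intros eps He. destruct (pow_small x eps Hs He) as [d [Hd K]].
      exists d. split; auto. intros a Ha. rewrite Rminus_0_r, Rabs_pos_eq by (left; apply exp_pos).
      eapply Rle_lt_trans; [|apply (K a Ha)]. apply exp_le_le. lra.
    - apply lim_at_infty. intros eps He. destruct (pow_exp_bound (x + 1)) as [K [HK B]].
      exists (Rmax 1 (K / eps)). intros b Hb.
      pose proof (Rmax_l 1 (K / eps)). pose proof (Rmax_r 1 (K / eps)).
      rewrite Rminus_0_r, Rabs_pos_eq by (left; apply exp_pos).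
      specialize (B b ltac:(lra)).
      assert (B2 : exp ((x + 1) * ln b) <= K * exp b).
      { eapply Rle_trans; [|exact B]. apply exp_le_le, Rmult_le_compat_l; [unfold x; lra|].
        left; apply ln_increasing; lra. }
      replace ((x + 1) * ln b) with (x * ln b + ln b) in B2 by ring.
      rewrite exp_plus, exp_ln in B2 by lra.
      unfold Rminus. rewrite exp_plus, exp_Ropp. pose proof (exp_pos b).
      apply Rle_lt_trans with (K / b).
      + apply Rmult_le_reg_r with (b * exp b); [apply Rmult_lt_0_compat; lra|].
        replace (exp (x * ln b) * / exp b * (b * exp b)) with (exp (x * ln b) * b) by (field; lra).
        replace (K / b * (b * exp b)) with (K * exp b) by (field; lra). exact B2.
      + apply Rlt_div_l; [lra|]. apply Rmult_lt_reg_r with (/ eps); [now apply Rinv_0_lt_compat|].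
        replace (eps * b * / eps) with b by (field; lra). unfold Rdiv in *. lra. }
  assert (Hs1 : cimp (gam (s + 1)) (CGamma (s + 1))).
  { apply cimp_gam. unfold x in *. destruct s; simpl in *. lra. }
  pose proof (cimp_minus _ _ _ _ (cimp_mult s _ _ (cimp_gam s Hs)) Hs1) as H2.
  assert (E : (s * CGamma s - CGamma (s + 1) = 0)%C).
  { apply (imp_unique (V := CV) _ _ _ H2). revert Hz. apply (imp_ext (V := CV)).
    intros t Ht. rewrite gam_shift by auto.
    assert (E1 : Cexp (x * ln t - t, y * ln t) = (RtoC t * gam s t)%C).
    { rewrite <- gam_shift by auto. unfold gam. f_equal. apply Ceq; unfold x, y; destruct s; simpl; ring. }
    rewrite E1. assert (E2 : ((x / t - 1)%R, (y / t)%R) = ((s - RtoC t) / RtoC t)%C).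
    { unfold x, y. destruct s as [s1 s2]. apply Ceq; simpl; field; lra. }
    rewrite E2. cfield. intros E3. apply (f_equal Re) in E3. simpl in E3. lra. }
  replace (CGamma (s + 1)) with (s * CGamma s - (s * CGamma s - CGamma (s + 1)))%C by ring.
  rewrite E. ring.
Qed.

Lemma RGamma_succ (x : R) : 0 < x -> RGamma (x + 1) = x * RGamma x.
Proof.
  intros Hx. apply RtoC_inj. rewrite RtoC_mult, <- !CGamma_RtoC, RtoC_plus by lra.
  now apply CGamma_succ.
Qed.

Lemma rimp_gker_scaled (s x : R) : 0 < s -> 0 < x ->
  rimp (fun u => exp ((s - 1) * ln u - x * u)) (exp (- (s * ln x)) * RGamma s).
Proof.
  intros Hs Hx.
  pose proof (imp_scale (V := R_CompleteNormedModule) x (gker s) (RGamma s) Hx (rimp_gker s Hs)) as H.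
  apply (rimp_scal (exp (- ((s - 1) * ln x)))) in H.
  replace (exp (- (s * ln x)) * RGamma s) with
    (exp (- ((s - 1) * ln x)) * scal (/ x) (RGamma s)).
  - revert H. apply imp_ext. intros u Hu. unfold gker. rewrite <- exp_plus. f_equal.
    rewrite ln_mult by auto. ring.
  - unfold scal; simpl; unfold mult; simpl. rewrite <- Rmult_assoc. f_equal.
    rewrite <- (exp_ln x) at 2 by auto. rewrite <- exp_Ropp, <- exp_plus. f_equal. ring.
Qed.

(** * Ratios of Gamma values at large arguments *)

Lemma Cmod_Cexp_sub_1 (a b : R) : Cmod (Cexp (a, b) - 1) <= (Rabs a + Rabs b) * Rmax 1 (exp a).
Proof.
  assert (Hb : Cmod (Cexp (0, b) - 1) <= Rabs b).
  { unfold Cmod, Cexp; simpl. rewrite exp_0, <- sqrt_Rsqr_abs. apply sqrt_le_1_alt.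
    pose proof (cos_ge_quadratic b). pose proof (sin2_cos2 b) as E. unfold Rsqr in *. nra. }
  assert (Ha : Rabs (exp a - 1) <= Rabs a * Rmax 1 (exp a)).
  { pose proof (exp_ineq1_le a) as G1. pose proof (exp_ineq1_le (- a)) as G2.
    pose proof (exp_pos a) as P. rewrite exp_Ropp in G2.
    destruct (Rle_dec 0 a) as [L|L].
    - assert (1 <= exp a) by lra.
      rewrite Rmax_right, !Rabs_pos_eq by lra.
      apply Rmult_le_compat_l with (r := exp a) in G2; [|lra].
      rewrite Rinv_r in G2 by lra. lra.
    - assert (exp a < 1) by (rewrite <- exp_0; apply exp_increasing; lra).
      rewrite Rmax_left, !Rabs_left by lra. lra. }
  replace (Cexp (a, b) - 1)%C with (RtoC (exp a) * (Cexp (0, b) - 1) + RtoC (exp a - 1))%C.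
  - eapply Rle_trans; [apply Cmod_triangle|].
    rewrite Cmod_mult, !Cmod_R, (Rabs_pos_eq (exp a)) by (left; apply exp_pos).
    pose proof (Rmax_r 1 (exp a)). pose proof (Rabs_pos b). pose proof (exp_pos a).
    assert (exp a * Cmod (Cexp (0, b) - 1) <= Rmax 1 (exp a) * Rabs b).
    { apply Rmult_le_compat; try lra. apply Cmod_ge_0. }
    lra.
  - apply Ceq; unfold Cexp; simpl; rewrite exp_0; ring.
Qed.

(** For [exp L = t / x] the bound is a Laurent polynomial in [t], so integrating it against the
    Gamma weight calls only for Gamma at integer shifts of [x]. The absolute value of [exp L - 1] is
    removed by [v <= d + v ^ 2 / (4 * d)], where [d] remains to be chosen. *)
Lemma ratio_pointwise (r y L d : R) : 0 <= r <= 1 -> 0 < d ->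
  Cmod (Cexp (cp (r * L) (y * L)) - 1) <=
  (r + Rabs y) * (d + (exp L - 1) * (exp L - 1) / (4 * d)) * (exp L + exp (- L)).
Proof.
  intros Hr Hd. eapply Rle_trans; [apply Cmod_Cexp_sub_1|].
  rewrite !Rabs_mult, (Rabs_pos_eq r) by lra.
  replace ((r * Rabs L + Rabs y * Rabs L) * Rmax 1 (exp (r * L))) with
    ((r + Rabs y) * (Rabs L * Rmax 1 (exp (r * L)))) by ring.
  rewrite Rmult_assoc. apply Rmult_le_compat_l; [pose proof (Rabs_pos y); lra|].
  pose proof (exp_pos L) as P. pose proof (exp_pos (- L)) as P'.
  pose proof (exp_ineq1_le L) as G1. pose proof (exp_ineq1_le (- L)) as G2.
  apply Rle_trans with (Rabs (exp L - 1) * (exp L + exp (- L))).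
  - destruct (Rle_dec 0 L) as [HL|HL].
    + rewrite Rmax_right by (rewrite <- exp_0 at 1; apply exp_le_le; nra).
      rewrite !Rabs_pos_eq by lra.
      apply Rle_trans with ((exp L - 1) * exp L); [|nra].
      apply Rmult_le_compat; try lra; [left; apply exp_pos|apply exp_le_le; nra].
    + assert (exp L < 1) by (rewrite <- exp_0; apply exp_increasing; lra).
      rewrite Rmax_left by (rewrite <- exp_0; apply exp_le_le; nra).
      rewrite !Rabs_left by lra.
      assert (E : exp L * exp (- L) = 1) by (rewrite <- exp_plus, Rplus_opp_r; apply exp_0).
      assert (- L <= exp (- L) - exp L * exp (- L)) by lra. nra.
  - apply Rmult_le_compat_r; [lra|]. set (q := Rabs (exp L - 1)).
    replace ((exp L - 1) * (exp L - 1)) with (q * q)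
      by (unfold q; rewrite <- Rabs_mult; apply Rabs_pos_eq; apply (Rle_0_sqr (exp L - 1))).
    apply Rmult_le_reg_r with (4 * d); [lra|].
    replace ((d + q * q / (4 * d)) * (4 * d)) with (4 * d * d + q * q) by (field; lra).
    pose proof (Rle_0_sqr (q - 2 * d)) as S. unfold Rsqr in S. nra.
Qed.

(* For large [x], [Gamma(x+c) / Gamma(x)] is close to [x^c]: the weight [t^(x-1) e^-t]
   concentrates at [t = x], as its second moments show. *)
Lemma gamma_ratio (x r y d : R) : 2 <= x -> 0 <= r <= 1 -> 0 < d ->
  Cmod (CGamma (cp (x + r) y) - Cexp (cp (r * ln x) (y * ln x)) * RtoC (RGamma x)) <=
  exp (r * ln x) * RGamma x * ((r + Rabs y) * (3 * d + / (d * (x - 1)))).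
Proof.
  intros Hx Hr Hd. set (G := RGamma x). assert (HG : 0 < G) by (apply RGamma_pos; lra).
  set (c := r + Rabs y). assert (Hc : 0 <= c) by (unfold c; pose proof (Rabs_pos y); lra).
  set (w := exp (r * ln x) * c). assert (Hw : 0 <= w) by (apply Rmult_le_pos; auto; left; apply exp_pos).
  assert (G1 : RGamma (x + 1) = x * G) by (apply RGamma_succ; lra).
  assert (G2 : RGamma (x + 2) = (x + 1) * (x * G)).
  { replace (x + 2) with (x + 1 + 1) by ring. rewrite RGamma_succ, G1 by lra. reflexivity. }
  assert (G3 : RGamma (x + 3) = (x + 2) * ((x + 1) * (x * G))).
  { replace (x + 3) with (x + 2 + 1) by ring. rewrite RGamma_succ, G2 by lra. reflexivity. }
  assert (Gm : RGamma (x - 1) = G / (x - 1)).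
  { unfold G. replace x with (x - 1 + 1) at 2 by ring. rewrite RGamma_succ by lra. field. lra. }
  set (k := / (4 * d)).
  (* With [v = t / x], [(v - 1) ^ 2 * (v + / v) = v ^ 3 - 2 * v ^ 2 + 2 * v - 2 + / v], and each
     power of [t] shifts the argument of the weight. *)
  set (g := fun t => w * (d * (/ x * gker (x + 1) t + x * gker (x - 1) t) +
    k * (/ (x * x * x) * gker (x + 3) t + (-2) * / (x * x) * gker (x + 2) t
         + 2 * / x * gker (x + 1) t + (-2) * gker x t + x * gker (x - 1) t))).
  set (I := w * (d * (/ x * RGamma (x + 1) + x * RGamma (x - 1)) +
    k * (/ (x * x * x) * RGamma (x + 3) + (-2) * / (x * x) * RGamma (x + 2)
         + 2 * / x * RGamma (x + 1) + (-2) * RGamma x + x * RGamma (x - 1)))).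
  assert (Hg : rimp g I).
  { unfold g, I. apply rimp_scal. apply rimp_plus.
    - apply rimp_scal. apply rimp_plus; apply rimp_scal; apply rimp_gker; lra.
    - apply rimp_scal. do 4 (apply rimp_plus; [|apply rimp_scal, rimp_gker; lra]).
      apply rimp_scal, rimp_gker; lra. }
  apply Rle_trans with I.
  - apply (cimp_le (fun t => gam (cp (x + r) y) t - Cexp (cp (r * ln x) (y * ln x)) * gam (RtoC x) t)%C _ g);
      [|exact Hg|].
    + apply cimp_minus; [apply cimp_gam; simpl; lra|]. apply cimp_mult.
      unfold G. rewrite <- CGamma_RtoC by lra. apply cimp_gam. simpl; lra.
    + intros t Ht. set (L := ln t - ln x).
      assert (E : (gam (cp (x + r) y) t - Cexp (cp (r * ln x) (y * ln x)) * gam (RtoC x) t)%C =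
        (RtoC (gker x t) * (Cexp (cp (r * ln x) (y * ln x)) * (Cexp (cp (r * L) (y * L)) - 1)))%C).
      { assert (E1 : gam (RtoC x) t = RtoC (gker x t)).
        { unfold gam, gker. rewrite <- Cexp_RtoC. f_equal. apply Ceq; simpl; ring. }
        assert (E2 : gam (cp (x + r) y) t =
          (RtoC (gker x t) * (Cexp (cp (r * ln x) (y * ln x)) * Cexp (cp (r * L) (y * L))))%C).
        { unfold gam, gker. rewrite <- Cexp_RtoC, <- !Cexp_plus. f_equal.
          unfold L. apply Ceq; simpl; ring. }
        rewrite E1, E2. ring. }
      rewrite E, !Cmod_mult, Cmod_R, Cmod_Cexp, Rabs_pos_eq by (left; apply exp_pos).
      cbn [Re fst].
      pose proof (ratio_pointwise r y L d Hr Hd) as B. fold c in B.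
      assert (Hgk : 0 < gker x t) by apply exp_pos.
      apply Rle_trans with (gker x t * (exp (r * ln x) *
        (c * (d + (exp L - 1) * (exp L - 1) / (4 * d)) * (exp L + exp (- L))))).
      { apply Rmult_le_compat_l; [lra|]. apply Rmult_le_compat_l; [left; apply exp_pos|auto]. }
      right. unfold g, w.
      assert (Eq : exp L = t / x).
      { unfold L, Rminus. rewrite exp_plus, exp_Ropp, !exp_ln by lra. reflexivity. }
      assert (Sh : forall z, gker (z + 1) t = t * gker z t).
      { intros z. unfold gker. rewrite <- (exp_ln t) at 3 by auto. rewrite <- exp_plus.
        f_equal. ring. }
      assert (S1 := Sh x). assert (S2 := Sh (x + 1)). assert (S3 := Sh (x + 2)).
      assert (Sm := Sh (x - 1)).
      replace (x + 1 + 1) with (x + 2) in S2 by ring.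
      replace (x + 2 + 1) with (x + 3) in S3 by ring.
      replace (x - 1 + 1) with x in Sm by ring.
      assert (Sm' : gker (x - 1) t = gker x t / t) by (rewrite Sm; field; lra).
      rewrite S3, S2, S1, Sm', exp_Ropp, Eq. unfold k. field. repeat split; lra.
  (* The moments cancel to leading order: the bracket multiplied by [k] is of size [/ x]. *)
  - unfold I. rewrite G3, G2, G1, Gm. fold G.
    replace (w * (d * (/ x * (x * G) + x * (G / (x - 1))) +
      k * (/ (x * x * x) * ((x + 2) * ((x + 1) * (x * G))) + -2 * / (x * x) * ((x + 1) * (x * G)) +
      2 * / x * (x * G) + -2 * G + x * (G / (x - 1))))) with
      (w * G * (d * (2 + / (x - 1)) + k * (/ x + 2 * / (x * x) + / (x - 1))))
      by (field; lra).
    replace (exp (r * ln x) * G * (c * (3 * d + / (d * (x - 1))))) with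
      (w * G * (3 * d + / (d * (x - 1)))) by (unfold w; ring).
    apply Rmult_le_compat_l; [apply Rmult_le_pos; lra|].
    assert (H1 : 0 < / (x - 1) <= 1).
    { split; [apply Rinv_0_lt_compat; lra|]. rewrite <- Rinv_1. apply Rinv_le_contravar; lra. }
    assert (H2 : 0 < / x <= / (x - 1)).
    { split; [apply Rinv_0_lt_compat; lra|]. apply Rinv_le_contravar; lra. }
    assert (H3 : 2 * / (x * x) <= / (x - 1)).
    { apply Rle_trans with (/ x); [|lra]. apply Rmult_le_reg_r with (x * x); [nra|].
      replace (2 * / (x * x) * (x * x)) with 2 by (field; lra).
      replace (/ x * (x * x)) with x by (field; lra). lra. }
    assert (Hk : 0 < k) by (unfold k; apply Rinv_0_lt_compat; lra).
    assert (H4 : k * (/ x + 2 * / (x * x) + / (x - 1)) <= / (d * (x - 1))).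
    { apply Rle_trans with (k * (4 * / (x - 1))); [apply Rmult_le_compat_l; lra|].
      right. unfold k. field. lra. }
    nra.
Qed.

(** * The Beta integral *)

Lemma one_sub_exp_bounds (u : R) : 0 < u -> 0 < 1 - exp (- u) < 1 /\ 1 - exp (- u) <= u.
Proof.
  intros Hu. pose proof (exp_pos (- u)). pose proof (exp_ineq1_le (- u)).
  assert (exp (- u) < 1) by (rewrite <- exp_0; apply exp_increasing; lra). lra.
Qed.

Definition bker (x r u : R) : R := exp ((r - 1) * ln (1 - exp (- u)) - x * u).

(* The Beta integrand [s^(w-1) (1-s)^(r-1) ds] in the variable [s = exp (- u)]. *)
Definition kb (w : C) (r u : R) : C :=
  Cexp (cp ((r - 1) * ln (1 - exp (- u)) - Re w * u) (- (Im w) * u)).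

Lemma Cmod_kb (w : C) (r u : R) : Cmod (kb w r u) = bker (Re w) r u.
Proof. unfold kb. rewrite Cmod_Cexp. reflexivity. Qed.

Lemma kb_cont (w : C) (r u : R) : 0 < u -> rcont (kb w r) u.
Proof.
  intros Hu. destruct (one_sub_exp_bounds u Hu) as [H1 _].
  apply Cexp_path_cont; apply ex_derive_cont; auto_derive; lra.
Qed.

(** At [x = 1] the kernel has the primitive [(1 - exp (- u)) ^ r / r]; it dominates [kb w r]
    whenever [1 <= Re w]. *)
Lemma rimp_bker_1 (r : R) : 0 < r -> rimp (bker 1 r) (/ r).
Proof.
  intros Hr. replace (/ r) with (/ r - 0) by ring.
  apply (rimp_primitive (fun u => / r * exp (r * ln (1 - exp (- u))))).
  - intros u Hu. destruct (one_sub_exp_bounds u Hu) as [H1 _].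
    auto_derive; [lra|]. unfold bker.
    replace ((r - 1) * ln (1 - exp (- u)) - 1 * u) with
      (r * ln (1 - exp (- u)) + - ln (1 - exp (- u)) + - u) by ring.
    rewrite !exp_plus, (exp_Ropp (ln _)), exp_ln by lra. change (1 + - exp (- u)) with (1 - exp (- u)). field. lra.
  - intros u Hu. destruct (one_sub_exp_bounds u Hu) as [H1 _].
    apply ex_derive_cont. unfold bker. auto_derive. lra.
  - apply lim_at_0. intros eps He.
    destruct (pow_small r (r * eps) Hr ltac:(nra)) as [d [Hd K]].
    exists d; split; auto. intros a Ha.
    destruct (one_sub_exp_bounds a ltac:(lra)) as [H1 H2].
    specialize (K (1 - exp (- a)) ltac:(lra)).
    rewrite Rminus_0_r, Rabs_pos_eq.
    + apply Rmult_lt_reg_l with r; auto. rewrite <- Rmult_assoc, Rinv_r by lra. lra.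
    + apply Rmult_le_pos; [left; now apply Rinv_0_lt_compat|left; apply exp_pos].
  - apply lim_at_infty. intros eps He.
    exists (Rmax 1 (- ln (eps / 2))). intros b Hb.
    pose proof (Rmax_l 1 (- ln (eps / 2))). pose proof (Rmax_r 1 (- ln (eps / 2))).
    destruct (one_sub_exp_bounds b ltac:(lra)) as [H1 _].
    set (v := exp (- b)) in *.
    assert (Hv : v < eps / 2).
    { rewrite <- (exp_ln (eps / 2)) by lra. apply exp_increasing. lra. }
    assert (Hv2 : v <= / 2).
    { unfold v. rewrite exp_Ropp. apply Rinv_le_contravar; [lra|].
      pose proof (exp_ineq1_le b). lra. }
    assert (Hl : - (2 * v) <= ln (1 - v)).
    { rewrite <- (ln_exp (- (2 * v))). apply ln_le; [apply exp_pos|].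
      rewrite exp_Ropp. pose proof (exp_ineq1_le (2 * v)).
      apply Rle_trans with (/ (1 + 2 * v)).
      - apply Rinv_le_contravar; lra.
      - apply Rmult_le_reg_r with (1 + 2 * v); [lra|]. rewrite Rinv_l by lra. nra. }
    assert (Hle : ln (1 - v) <= 0) by (rewrite <- ln_1; apply ln_le; lra).
    assert (He1 : exp (r * ln (1 - v)) <= 1).
    { apply Rle_trans with (exp 0); [apply exp_le_le; nra|rewrite exp_0; lra]. }
    pose proof (exp_ineq1_le (r * ln (1 - v))) as G.
    replace (/ r * exp (r * ln (1 - v)) - / r) with (- (/ r * (1 - exp (r * ln (1 - v))))) by ring.
    assert (Hi : 0 < / r) by now apply Rinv_0_lt_compat.
    rewrite Rabs_Ropp, Rabs_pos_eq by (apply Rmult_le_pos; lra).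
    apply Rle_lt_trans with (2 * v); [|lra].
    apply Rmult_le_reg_l with r; auto. rewrite <- Rmult_assoc, Rinv_r by lra. nra.
Qed.

Definition CBeta (w : C) (r : R) : C :=
  RInt_gen (V := CV) (kb w r) (at_right 0) (Rbar_locally p_infty).

Lemma cimp_kb (w : C) (r : R) : 1 <= Re w -> 0 < r -> cimp (kb w r) (CBeta w r).
Proof.
  intros Hw Hr.
  destruct (cimp_dominated (kb w r) (bker 1 r) (/ r)) as [l Hl].
  - intros; now apply kb_cont.
  - intros u Hu. rewrite Cmod_kb. unfold bker. apply exp_le_le. nra.
  - now apply rimp_bker_1.
  - unfold CBeta. rewrite (imp_RInt_gen (V := CV) _ _ Hl). exact Hl.
Qed.

Lemma kb_shift (w : C) (r u : R) : kb (w + 1) r u = (RtoC (exp (- u)) * kb w r u)%C.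
Proof.
  unfold kb. rewrite <- Cexp_RtoC, <- Cexp_plus. f_equal.
  apply Ceq; destruct w; simpl; ring.
Qed.

Lemma kb_raise (w : C) (r u : R) : 0 < u ->
  kb w (r + 1) u = (RtoC (1 - exp (- u)) * kb w r u)%C.
Proof.
  intros Hu. destruct (one_sub_exp_bounds u Hu) as [H1 _].
  rewrite <- (exp_ln (1 - exp (- u))) at 1 by lra.
  rewrite <- Cexp_RtoC. unfold kb. rewrite <- Cexp_plus. f_equal.
  apply Ceq; destruct w; simpl; ring.
Qed.

Lemma Re_succ (w : C) : Re (w + 1)%C = Re w + 1.
Proof. destruct w; reflexivity. Qed.

(** [(w + r) * kb (w + 1) r - w * kb w r] is the derivative of
    [(1 - exp (- u)) ^ r * exp (- w * u)], which vanishes at both ends. *)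
Lemma CBeta_succ (w : C) (r : R) : 1 <= Re w -> 0 < r ->
  (w * CBeta w r = (w + RtoC r) * CBeta (w + 1) r)%C.
Proof.
  intros Hw Hr. set (x := Re w). set (y := Im w).
  assert (Hz : cimp (fun u => cp (r * exp (- u) / (1 - exp (- u)) - x) (- y)
    * Cexp (cp (r * ln (1 - exp (- u)) - x * u) (- y * u)))%C (RtoC 0)).
  { apply (cimp_derivative_zero (fun u => r * ln (1 - exp (- u)) - x * u) (fun u => - y * u)
      (fun u => r * exp (- u) / (1 - exp (- u)) - x) (fun u => - y)).
    - intros u Hu. destruct (one_sub_exp_bounds u Hu) as [H1 _]. auto_derive; [lra|]. field. lra.
    - intros u Hu. auto_derive; [auto|]. ring.
    - intros u Hu. destruct (one_sub_exp_bounds u Hu) as [H1 _].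
      apply ex_derive_cont. auto_derive. lra.
    - intros u Hu. apply continuous_const.
    - apply lim_at_0. intros eps He. destruct (pow_small r eps Hr He) as [d [Hd K]].
      exists d. split; auto. intros a Ha.
      destruct (one_sub_exp_bounds a ltac:(lra)) as [H1 H2].
      specialize (K (1 - exp (- a)) ltac:(lra)).
      rewrite Rminus_0_r, Rabs_pos_eq by (left; apply exp_pos).
      eapply Rle_lt_trans; [|exact K]. apply exp_le_le. unfold x. nra.
    - apply lim_at_infty. intros eps He. exists (Rmax 1 (- ln eps)). intros b Hb.
      pose proof (Rmax_l 1 (- ln eps)). pose proof (Rmax_r 1 (- ln eps)).
      destruct (one_sub_exp_bounds b ltac:(lra)) as [H1 _].
      rewrite Rminus_0_r, Rabs_pos_eq by (left; apply exp_pos).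
      rewrite <- (exp_ln eps) by auto. apply exp_increasing.
      assert (ln (1 - exp (- b)) <= 0) by (rewrite <- ln_1; apply ln_le; lra).
      unfold x. nra. }
  assert (Hw1 : 1 <= Re (w + 1)%C) by (rewrite Re_succ; lra).
  pose proof (cimp_minus _ _ _ _ (cimp_mult (w + RtoC r) _ _ (cimp_kb (w + 1) r Hw1 Hr))
    (cimp_mult w _ _ (cimp_kb w r Hw Hr))) as H2.
  assert (E : ((w + RtoC r) * CBeta (w + 1) r - w * CBeta w r = 0)%C).
  { apply (imp_unique (V := CV) _ _ _ H2). revert Hz. apply (imp_ext (V := CV)).
    intros u Hu. destruct (one_sub_exp_bounds u Hu) as [H1 _]. rewrite kb_shift.
    assert (E1 : Cexp (cp (r * ln (1 - exp (- u)) - x * u) (- y * u)) =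
      (RtoC (1 - exp (- u)) * kb w r u)%C).
    { rewrite <- kb_raise by auto. unfold kb. f_equal. apply Ceq; unfold x, y; simpl; ring. }
    rewrite E1. set (v := exp (- u)) in *.
    assert (E2 : cp (r * v / (1 - v) - x) (- y) = (RtoC r * RtoC v / RtoC (1 - v) - w)%C).
    { unfold x, y. rewrite <- RtoC_mult, <- RtoC_div by lra. destruct w; apply Ceq; simpl; ring. }
    rewrite E2. rewrite RtoC_minus. cfield.
    intros E3. apply (f_equal Re) in E3. simpl in E3. lra. }
  replace (w * CBeta w r)%C with ((w + RtoC r) * CBeta (w + 1) r
    - ((w + RtoC r) * CBeta (w + 1) r - w * CBeta w r))%C by ring.
  rewrite E. ring.
Qed.

Lemma CBeta_raise (w : C) (r : R) : 1 <= Re w -> 0 < r ->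
  CBeta w (r + 1) = (CBeta w r - CBeta (w + 1) r)%C.
Proof.
  intros Hw Hr. assert (Hw1 : 1 <= Re (w + 1)%C) by (rewrite Re_succ; lra).
  apply (imp_unique (V := CV) (kb w (r + 1))); [apply cimp_kb; auto; lra|].
  apply (imp_ext (V := CV) (fun u => kb w r u - kb (w + 1) r u)%C).
  - intros u Hu. rewrite kb_raise, kb_shift, RtoC_minus by auto. cring.
  - apply cimp_minus; now apply cimp_kb.
Qed.

(** The mass sits at [u] of size [/ x], where replacing [1 - exp (- u)] by [u] and the oscillating
    factor by [1] costs relative errors [u] and [Rabs y * u]. The assumption [r <= 1] bounds
    [((1 - exp (- u)) / u) ^ (r - 1)] by [u / (1 - exp (- u)) <= 1 + u]. *)
Lemma CBeta_asymp (x y r : R) : 1 <= x -> 0 < r <= 1 ->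
  Cmod (CBeta (x, y) r - RtoC (exp (- (r * ln x)) * RGamma r)) <=
  exp (- (r * ln x)) * ((1 + Rabs y) * (RGamma (r + 1) / x)).
Proof.
  intros Hx Hr.
  replace (exp (- (r * ln x)) * ((1 + Rabs y) * (RGamma (r + 1) / x))) with
    ((1 + Rabs y) * (exp (- ((r + 1) * ln x)) * RGamma (r + 1))).
  2:{ replace (- ((r + 1) * ln x)) with (- (r * ln x) + - ln x) by ring.
      rewrite exp_plus, (exp_Ropp (ln x)), exp_ln by lra. field. lra. }
  apply (cimp_le (fun u => kb (x, y) r u - RtoC (exp ((r - 1) * ln u - x * u)))%C _
    (fun u => (1 + Rabs y) * exp ((r + 1 - 1) * ln u - x * u))).
  - apply cimp_minus; [apply cimp_kb; simpl; lra|]. apply cimp_RtoC.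
    apply rimp_gker_scaled; lra.
  - apply rimp_scal. apply rimp_gker_scaled; lra.
  - intros u Hu. destruct (one_sub_exp_bounds u Hu) as [H1 H2].
    set (q := 1 - exp (- u)) in *. set (e := exp ((r - 1) * ln u - x * u)).
    set (a := (r - 1) * (ln q - ln u)).
    assert (E : (kb (x, y) r u - RtoC e)%C =
      (RtoC e * (Cexp (cp 0 (- y * u)) * RtoC (exp a - 1) + (Cexp (cp 0 (- y * u)) - 1)))%C).
    { assert (E1 : kb (x, y) r u = (RtoC e * (Cexp (cp 0 (- y * u)) * RtoC (exp a)))%C).
      { unfold kb, e. fold q. rewrite <- !Cexp_RtoC, <- !Cexp_plus. f_equal.
        unfold a. apply Ceq; simpl; ring. }
      rewrite E1, RtoC_minus. ring. }
    rewrite E, Cmod_mult, Cmod_R, Rabs_pos_eq by (left; apply exp_pos).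
    assert (Ee : exp ((r + 1 - 1) * ln u - x * u) = e * u).
    { unfold e. rewrite <- (exp_ln u) at 5 by auto. rewrite <- exp_plus. f_equal. ring. }
    rewrite Ee.
    replace ((1 + Rabs y) * (e * u)) with (e * (u + Rabs y * u)) by ring.
    apply Rmult_le_compat_l; [left; apply exp_pos|].
    eapply Rle_trans; [apply Cmod_triangle|]. apply Rplus_le_compat.
    + rewrite Cmod_mult, Cmod_Cexp, Cmod_R. simpl. rewrite exp_0, Rmult_1_l.
      assert (Hl : ln q <= ln u) by (apply ln_le; lra).
      assert (Ha0 : 0 <= a) by (unfold a; nra).
      assert (Ha1 : a <= ln u - ln q) by (unfold a; nra).
      assert (H3 : exp a <= u / q).
      { eapply Rle_trans; [apply exp_le_le, Ha1|]. unfold Rminus.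
        rewrite exp_plus, exp_Ropp, !exp_ln by lra. right; reflexivity. }
      assert (H4 : u / q <= 1 + u).
      { apply Rle_div_l; [lra|]. unfold q. rewrite exp_Ropp.
        pose proof (exp_ineq1_le u) as G.
        assert (/ exp u <= / (1 + u)) by (apply Rinv_le_contravar; lra).
        apply Rle_trans with ((1 + u) * (1 - / (1 + u))); [right; field; lra|].
        apply Rmult_le_compat_l; lra. }
      assert (1 <= exp a) by (rewrite <- exp_0; now apply exp_le_le).
      rewrite Rabs_pos_eq; lra.
    + eapply Rle_trans; [apply Cmod_Cexp_sub_1|]. rewrite exp_0, Rmax_left by lra.
      rewrite Rabs_R0, Rabs_mult, Rabs_Ropp, (Rabs_pos_eq u) by lra. lra.
Qed.

(** * The relation between Beta and Gamma *)

Definition shiftN (w : C) (n : nat) : C := (w + RtoC (INR n))%C.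

Lemma shiftN_S (w : C) (n : nat) : shiftN w (S n) = (shiftN w n + 1)%C.
Proof. unfold shiftN. rewrite S_INR, RtoC_plus. ring. Qed.

Lemma Re_shiftN (w : C) (n : nat) : Re (shiftN w n) = Re w + INR n.
Proof. unfold shiftN. destruct w; reflexivity. Qed.

(** In [gamma_ratio], [d] is fixed first so that [3 * d] contributes at most half of [eta]; then [x]
    is taken large enough for the other term. *)
Lemma gamma_shift_ratio (w : C) (r eta : R) : 0 <= r <= 1 -> 0 < eta ->
  exists X0, forall x, X0 <= x -> 2 <= x /\
  Cmod (CGamma (x + r, Im w) - Cexp (cp (r * ln x) (Im w * ln x)) * RtoC (RGamma x))
    <= eta * (exp (r * ln x) * RGamma x).
Proof.
  intros Hr He. set (c := r + Rabs (Im w)).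
  assert (Hc : 0 <= c) by (unfold c; pose proof (Rabs_pos (Im w)); lra).
  set (d := eta / (6 * (c + 1))). assert (Hd : 0 < d) by (apply Rdiv_lt_0_compat; lra).
  set (X0 := 2 + 2 * (c + 1) / (d * eta)).
  assert (Hde : 0 < d * eta) by now apply Rmult_lt_0_compat.
  assert (HX : 0 < 2 * (c + 1) / (d * eta)) by (apply Rdiv_lt_0_compat; lra).
  exists X0. intros x Hx. unfold X0 in Hx. split; [lra|].
  eapply Rle_trans; [apply (gamma_ratio x r (Im w) d); lra|]. fold c.
  rewrite Rmult_comm. apply Rmult_le_compat_r.
  { apply Rmult_le_pos; left; [apply exp_pos|apply RGamma_pos; lra]. }
  assert (H1 : (c + 1) * (3 * d) = eta / 2) by (unfold d; field; lra).
  assert (H2 : (c + 1) * / (d * (x - 1)) <= eta / 2).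
  { assert (Hx1 : 2 * (c + 1) <= d * eta * (x - 1)).
    { apply Rle_trans with (d * eta * (2 * (c + 1) / (d * eta))); [right; field; lra|].
      apply Rmult_le_compat_l; lra. }
    apply Rmult_le_reg_r with (d * (x - 1)); [apply Rmult_lt_0_compat; lra|].
    replace ((c + 1) * / (d * (x - 1)) * (d * (x - 1))) with (c + 1) by (field; lra).
    lra. }
  assert (H3 : 0 < / (d * (x - 1))) by (apply Rinv_0_lt_compat, Rmult_lt_0_compat; lra).
  nra.
Qed.

(** A zero would propagate to every [w + n] by the functional equation, against [gamma_shift_ratio]
    at [r = 0], which puts [CGamma (w + n)] close to a number of modulus [RGamma (Re w + n)]. *)
Lemma CGamma_neq0 (w : C) : 0 < Re w -> CGamma w <> 0%C.
Proof.
  intros Hw E.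
  assert (Hz : forall n, CGamma (shiftN w n) = 0%C).
  { induction n as [|n IH].
    - rewrite <- E. f_equal. unfold shiftN. simpl. ring.
    - rewrite shiftN_S, CGamma_succ, IH by (rewrite Re_shiftN; pose proof (pos_INR n); lra). ring. }
  destruct (gamma_shift_ratio w 0 (/ 2) ltac:(lra) ltac:(lra)) as [X0 H].
  destruct (INR_unbounded X0) as [n Hn].
  destruct (H (Re w + INR n) ltac:(lra)) as [H2 B].
  replace (Re w + INR n + 0, Im w) with (shiftN w n) in B
    by (unfold shiftN; destruct w; apply Ceq; simpl; ring).
  rewrite Hz in B. rewrite Cmod_sub_sym in B.
  replace (Cexp (cp (0 * ln (Re w + INR n)) (Im w * ln (Re w + INR n)))
    * RtoC (RGamma (Re w + INR n)) - 0)%C with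
    (Cexp (cp (0 * ln (Re w + INR n)) (Im w * ln (Re w + INR n)))
    * RtoC (RGamma (Re w + INR n)))%C in B by ring.
  rewrite Cmod_mult, Cmod_Cexp, Cmod_R in B. simpl in B.
  pose proof (RGamma_pos (Re w + INR n) ltac:(lra)) as P.
  rewrite Rabs_pos_eq in B by lra. rewrite Rmult_0_l, exp_0 in B. lra.
Qed.

(* The difference of the two sides satisfies the recurrence of [CGamma] under [w -> w + 1], and
   by [gamma_ratio] it is negligible with respect to [CGamma (w + n)] as [n] grows. *)
Lemma beta_gamma_small (w : C) (r : R) : 1 <= Re w -> 0 < r <= 1 ->
  (CBeta w r * CGamma (w + RtoC r) = CGamma w * RtoC (RGamma r))%C.
Proof.
  intros Hw Hr. set (Gr := RGamma r). assert (HGr : 0 < Gr) by (apply RGamma_pos; lra).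
  set (D := fun n => (CBeta (shiftN w n) r * CGamma (shiftN w n + RtoC r)
    - CGamma (shiftN w n) * RtoC Gr)%C).
  assert (HRe : forall n, 1 <= Re (shiftN w n)).
  { intros n. rewrite Re_shiftN. pose proof (pos_INR n). lra. }
  assert (E0 : shiftN w 0 = w) by (unfold shiftN; simpl; ring).
  assert (Rec : forall n, (D n * CGamma w = D 0%nat * CGamma (shiftN w n))%C).
  { induction n as [|n IH]; [rewrite E0; ring|].
    assert (E1 : D (S n) = (shiftN w n * D n)%C).
    { unfold D. rewrite shiftN_S. set (v := shiftN w n). pose proof (HRe n) as Hv. fold v in Hv.
      replace (v + 1 + RtoC r)%C with (v + RtoC r + 1)%C by ring.
      rewrite !CGamma_succ; [|lra|destruct v; simpl in *; lra].
      pose proof (CBeta_succ v r Hv ltac:(lra)) as EB.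
      transitivity ((v + RtoC r) * CBeta (v + 1) r * CGamma (v + RtoC r)
        - v * CGamma v * RtoC Gr)%C; [ring|]. rewrite <- EB. ring. }
    rewrite E1, shiftN_S, CGamma_succ by (pose proof (HRe n); lra).
    transitivity (shiftN w n * (D n * CGamma w))%C; [ring|]. rewrite IH. ring. }
  (* At [w + n] with [n] large the three estimates have relative error [eta]; dividing by
     [CGamma (w + n)], of modulus at least half of [RGamma x], brings the smallness back to [w]. *)
  assert (Hbound : forall eta, 0 < eta <= / 2 ->
    Cmod (D 0%nat) <= 4 * eta * (1 + Gr) * Cmod (CGamma w)).
  { intros eta He. set (y := Im w).
    destruct (gamma_shift_ratio w 0 eta ltac:(lra) ltac:(lra)) as [X1 B1].
    destruct (gamma_shift_ratio w r eta ltac:(lra) ltac:(lra)) as [X2 B2].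
    set (c := (1 + Rabs y) * RGamma (r + 1)).
    assert (Hc : 0 < c).
    { apply Rmult_lt_0_compat; [pose proof (Rabs_pos y); lra|apply RGamma_pos; lra]. }
    destruct (INR_unbounded (Rmax (Rmax X1 X2) (c / eta))) as [n Hn].
    pose proof (Rmax_l (Rmax X1 X2) (c / eta)). pose proof (Rmax_r (Rmax X1 X2) (c / eta)).
    pose proof (Rmax_l X1 X2). pose proof (Rmax_r X1 X2).
    set (x := Re w + INR n).
    destruct (B1 x ltac:(unfold x; lra)) as [Hx2 A1].
    destruct (B2 x ltac:(unfold x; lra)) as [_ A2].
    pose proof (CBeta_asymp x y r ltac:(lra) Hr) as A3.
    assert (Es : shiftN w n = (x, y)) by (unfold shiftN, x, y; destruct w; apply Ceq; simpl; ring).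
    set (G := RGamma x) in *. assert (HG : 0 < G) by (apply RGamma_pos; lra).
    set (xr := exp (r * ln x)) in *. assert (Hxr : 0 < xr) by apply exp_pos.
    assert (Exr : exp (- (r * ln x)) = / xr) by (unfold xr; apply exp_Ropp).
    rewrite Exr in A3. fold Gr in A3. fold y in A1, A2.
    set (X := Cexp (cp 0 (y * ln x))).
    assert (HX : Cmod X = 1) by (unfold X; rewrite Cmod_Cexp; apply exp_0).
    assert (EX1 : Cexp (cp (0 * ln x) (y * ln x)) = X) by (unfold X; rewrite Rmult_0_l; reflexivity).
    assert (EX2 : Cexp (cp (r * ln x) (y * ln x)) = (RtoC xr * X)%C).
    { unfold xr, X. rewrite <- Cexp_RtoC, <- Cexp_plus. f_equal. apply Ceq; simpl; ring. }
    rewrite EX1, Rmult_0_l, exp_0, Rmult_1_l, Rplus_0_r in A1. rewrite EX2 in A2.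
    assert (A3' : Cmod (CBeta (x, y) r - RtoC (/ xr * Gr)) <= eta * / xr).
    { eapply Rle_trans; [exact A3|]. rewrite (Rmult_comm eta).
      apply Rmult_le_compat_l; [left; now apply Rinv_0_lt_compat|].
      replace ((1 + Rabs y) * (RGamma (r + 1) / x)) with (c / x) by (unfold c; field; lra).
      apply Rle_div_l; [lra|].
      apply Rle_trans with (eta * (c / eta)); [right; field; lra|].
      apply Rmult_le_compat_l; [lra|]. unfold x. lra. }
    set (P := CGamma (x + r, y)) in *. set (Q := CGamma (x, y)) in *.
    set (b := CBeta (x, y) r) in *.
    assert (ED : D n = (b * P - Q * RtoC Gr)%C).
    { unfold D. rewrite Es. unfold b, P, Q. 
      replace ((x, y) + RtoC r)%C with (cp (x + r) y) by (apply Ceq; simpl; ring). reflexivity. }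
    assert (HP : Cmod P <= 2 * (xr * G)).
    { replace P with ((P - RtoC xr * X * RtoC G) + RtoC xr * X * RtoC G)%C by ring.
      eapply Rle_trans; [apply Cmod_triangle|].
      rewrite !Cmod_mult, HX, !Cmod_R, !Rabs_pos_eq by lra.
      assert (0 < xr * G) by now apply Rmult_lt_0_compat. nra. }
    assert (HQ : G / 2 <= Cmod Q).
    { pose proof (Cmod_sub_le (X * RtoC G) Q) as K. rewrite Cmod_sub_sym in K.
      rewrite Cmod_mult, HX, Cmod_R, Rabs_pos_eq in K by lra. nra. }
    assert (HD : Cmod (D n) <= 2 * eta * (1 + Gr) * G).
    { rewrite ED.
      assert (Hn0 : RtoC xr <> 0%C) by (intros K; apply RtoC_inj in K; lra).
      replace (b * P - Q * RtoC Gr)%C with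
        ((b - RtoC (/ xr * Gr)) * P + RtoC (/ xr * Gr) * (P - RtoC xr * X * RtoC G)
         - RtoC Gr * (Q - X * RtoC G))%C.
      2:{ rewrite RtoC_mult, RtoC_inv by lra. field. exact Hn0. }
      eapply Rle_trans; [apply Cmod_sub_triangle|].
      assert (K1 : Cmod ((b - RtoC (/ xr * Gr)) * P) <= 2 * eta * G).
      { rewrite Cmod_mult. apply Rle_trans with (eta * / xr * (2 * (xr * G))).
        - apply Rmult_le_compat; auto; apply Cmod_ge_0.
        - right. field. lra. }
      assert (K2 : Cmod (RtoC (/ xr * Gr) * (P - RtoC xr * X * RtoC G)) <= Gr * (eta * G)).
      { rewrite Cmod_mult, Cmod_R, Rabs_pos_eq
          by (apply Rmult_le_pos; [left; now apply Rinv_0_lt_compat|lra]).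
        apply Rle_trans with (/ xr * Gr * (eta * (xr * G))).
        - apply Rmult_le_compat_l; auto. apply Rmult_le_pos; [left; now apply Rinv_0_lt_compat|lra].
        - right. field. lra. }
      assert (K3 : Cmod (RtoC Gr * (Q - X * RtoC G)) <= Gr * (eta * G)).
      { rewrite Cmod_mult, Cmod_R, Rabs_pos_eq by lra. apply Rmult_le_compat_l; [lra|auto]. }
      pose proof (Cmod_triangle ((b - RtoC (/ xr * Gr)) * P)
        (RtoC (/ xr * Gr) * (P - RtoC xr * X * RtoC G))). lra. }
    pose proof (f_equal Cmod (Rec n)) as ER. rewrite !Cmod_mult, Es in ER. fold Q in ER.
    pose proof (Cmod_ge_0 (D 0%nat)) as P1. pose proof (Cmod_ge_0 (CGamma w)) as P2.
    assert (K1 : Cmod (D 0%nat) * (G / 2) <= 2 * eta * (1 + Gr) * G * Cmod (CGamma w)).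
    { apply Rle_trans with (Cmod (D 0%nat) * Cmod Q); [apply Rmult_le_compat_l; auto|].
      rewrite <- ER. apply Rmult_le_compat_r; auto. }
    apply Rmult_le_reg_r with (G / 2); [lra|].
    eapply Rle_trans; [exact K1|]. right. field. }
  assert (Hz : Cmod (D 0%nat) = 0).
  { apply Rle_antisym; [|apply Cmod_ge_0]. apply Rnot_lt_le. intros Hpos.
    set (M := 4 * (1 + Gr) * Cmod (CGamma w)).
    assert (HM : 0 <= M) by (unfold M; pose proof (Cmod_ge_0 (CGamma w)); nra).
    set (eta := Rmin (/ 2) (Cmod (D 0%nat) / (2 * (M + 1)))).
    assert (He : 0 < eta) by (apply Rmin_pos; [lra|apply Rdiv_lt_0_compat; lra]).
    assert (He1 : eta <= / 2) by apply Rmin_l.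
    assert (He2 : eta <= Cmod (D 0%nat) / (2 * (M + 1))) by apply Rmin_r.
    specialize (Hbound eta ltac:(lra)).
    assert (eta * (M + 1) <= Cmod (D 0%nat) / 2).
    { apply Rle_trans with (Cmod (D 0%nat) / (2 * (M + 1)) * (M + 1)).
      - apply Rmult_le_compat_r; lra.
      - right. field. lra. }
    unfold M in *. nra. }
  apply Cmod_eq_0 in Hz. unfold D in Hz. rewrite E0 in Hz.
  replace (CBeta w r * CGamma (w + RtoC r))%C with
    (CBeta w r * CGamma (w + RtoC r) - CGamma w * RtoC Gr + CGamma w * RtoC Gr)%C by ring.
  rewrite Hz. ring.
Qed.

(** [CBeta_asymp] is limited to [r <= 1]; larger [r] is reached in unit steps through [CBeta_raise]
    and [CBeta_succ]. *)
Lemma beta_gamma (w : C) (r : R) : 1 <= Re w -> 0 < r ->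
  (CBeta w r * CGamma (w + RtoC r) = CGamma w * RtoC (RGamma r))%C.
Proof.
  intros Hw Hr. destruct (INR_unbounded r) as [n Hn].
  assert (H : forall n r, 0 < r <= INR n + 1 ->
    (CBeta w r * CGamma (w + RtoC r) = CGamma w * RtoC (RGamma r))%C).
  { clear n Hn r Hr. induction n as [|n IH]; intros r Hr.
    - apply beta_gamma_small; auto. simpl in Hr. lra.
    - rewrite S_INR in Hr. destruct (Rle_dec r 1) as [L|L]; [apply beta_gamma_small; auto; lra|].
      specialize (IH (r - 1) ltac:(lra)). set (r' := r - 1) in *.
      replace r with (r' + 1) by (unfold r'; ring).
      assert (Hr' : 0 < r') by (unfold r'; lra).
      rewrite CBeta_raise, RGamma_succ, RtoC_plus, RtoC_mult by auto.
      replace (w + (RtoC r' + RtoC 1))%C with (w + RtoC r' + 1)%C by ring.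
      rewrite CGamma_succ by (destruct w; simpl in *; lra).
      pose proof (CBeta_succ w r' Hw Hr') as EB.
      transitivity (((w + RtoC r') * CBeta w r' - (w + RtoC r') * CBeta (w + 1) r')
        * CGamma (w + RtoC r'))%C; [ring|]. rewrite <- EB.
      transitivity (RtoC r' * (CBeta w r' * CGamma (w + RtoC r')))%C; [ring|].
      rewrite IH. ring. }
  apply (H n). lra.
Qed.

(** * Identification of the coefficients *)

(** The value of [rgamma] does not depend on the number of steps taken to reach the positive
    axis. *)
Lemma rising_RGamma_step (x : R) (k j : nat) : 0 < x + INR k ->
  rising x (k + j) / RGamma (x + INR (k + j)) = rising x k / RGamma (x + INR k).
Proof.
  intros H. induction j as [|j IH]; [rewrite Nat.add_0_r; reflexivity|].
  rewrite <- IH, Nat.add_succ_r. simpl rising. rewrite S_INR, <- Rplus_assoc.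
  assert (Hp : 0 < x + INR (k + j)) by (rewrite plus_INR; pose proof (pos_INR j); lra).
  rewrite RGamma_succ by exact Hp. pose proof (RGamma_pos _ Hp). field. lra.
Qed.

Lemma rising_ff (r : R) (p : nat) : rising (r - INR p) p = ff (r - 1) p.
Proof.
  revert r. induction p as [|p IH]; intros r; [reflexivity|].
  cbn [rising ff]. rewrite S_INR.
  replace (r - (INR p + 1)) with (r - 1 - INR p) by ring. rewrite IH. ring.
Qed.

(** Turns the reciprocal Gamma values of [d_rj] into binomial numerators. Where [r - p] is a pole of
    Gamma, the falling factorial contains the factor zero. *)
Lemma rgamma_ff (r : R) (p : nat) : 0 < r -> rgamma (r - INR p) = ff (r - 1) p / RGamma r.
Proof.
  intros Hr. unfold rgamma. set (x := r - INR p). set (k := Z.to_nat (up (- x))).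
  assert (Hk : 0 < x + INR k).
  { destruct (archimed (- x)) as [A _]. unfold k. rewrite INR_IZR_INZ.
    assert (IZR (up (- x)) <= IZR (Z.of_nat (Z.to_nat (up (- x))))) by (apply IZR_le; lia). lra. }
  assert (Hp : 0 < x + INR p) by (unfold x; lra).
  rewrite <- (rising_RGamma_step x k p Hk), Nat.add_comm, (rising_RGamma_step x p k Hp).
  unfold x. rewrite rising_ff. do 2 f_equal. ring.
Qed.

Lemma sum_list_0_wsum (ks : list nat) : forall i, sum_list ks = O -> wsum_from i ks = O.
Proof.
  induction ks as [|k ks IH]; intros i H; simpl in *; [reflexivity|].
  rewrite IH by lia. replace k with O by lia. lia.
Qed.

Lemma Bell_0 (j : nat) (x : nat -> R) : (1 <= j)%nat -> Bell j 0 x = 0.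
Proof.
  intros Hj. assert (E : Bell j 0 x / INR (fact j) = 0).
  { rewrite Bell_lsum, (lsum_ext _ _ (fun _ => 0)); [apply lsum_zero|].
    intros ks. destruct (Nat.eqb_spec (sum_list ks) 0) as [E|E]; [|reflexivity].
    rewrite (sum_list_0_wsum ks 1 E). destruct (Nat.eqb_spec 0 j); [lia|reflexivity]. }
  pose proof (INR_fact_neq_0 j). apply Rmult_eq_reg_r with (/ INR (fact j)).
  - rewrite Rmult_0_l. exact E.
  - now apply Rinv_neq_0_compat.
Qed.

Lemma bellco_0 (al : R) : bellco al 0 = 1.
Proof. unfold bellco, Bell, Rsum_list. simpl. field. Qed.

(** Here the Bell sums of the statement meet the expansion of a power of the logarithm. The sum over
    [p] starts at [1] in [d_rj] and at [0] in [bellco]; [Bell_0] closes the gap. *)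
Lemma d_rj_bellco (r : R) (j : nat) : 0 < r -> (1 <= j)%nat ->
  / RGamma (r + INR j) * d_rj r j = / RGamma r * bellco (r - 1) j.
Proof.
  intros Hr Hj. pose proof (RGamma_pos r Hr) as P1.
  assert (P2 : 0 < RGamma (r + INR j)) by (apply RGamma_pos; pose proof (pos_INR j); lra).
  pose proof (INR_fact_neq_0 j) as Pf.
  unfold d_rj, bellco. rewrite rs_Sl, Bell_0, sum1_rs by exact Hj.
  rewrite (rs_ext j (fun p => Bell j (S p) xbell * rgamma (r - INR (S p)))
    (fun p => (INR (fact j) / RGamma r) * (ff (r - 1) (S p) * (Bell j (S p) xbell / INR (fact j))))).
  - rewrite rs_scal. field. repeat split; first [exact Pf|lra].
  - intros p _. rewrite rgamma_ff by exact Hr. field. split; first [exact Pf|lra].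
Qed.

Lemma Csum1_cs (n : nat) (g : nat -> C) : Csum1 n g = cs n (fun j => g (S j)).
Proof. induction n as [|n IH]; simpl; [reflexivity|rewrite IH; reflexivity]. Qed.

(** Indices are shifted by one: [alphaco n] goes with [zeta ^ ((n + 1) / m - 1)], hence with
    [tau ^ n] once [tau ^ (m - 1)] is multiplied in. *)
Definition alphaco (m : nat) (lam : R) (a : nat -> C) (n : nat) : C :=
  (alam m lam a (S n) * RtoC (/ RGamma (INR (S n) / INR m)))%C.

Definition alexp (m n : nat) : R := INR (S n) / INR m - 1.

Lemma dn_Dco (m : nat) (lam : R) (a : nat -> C) (n : nat) : (1 <= m)%nat ->
  dn m lam a (S n) = Dco m (alphaco m lam a) (alexp m) n.
Proof.
  intros Hm. assert (Hmp : 0 < INR m) by (apply lt_0_INR; lia).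
  unfold Dco. rewrite (cs_Sl n). unfold dn. rewrite Csum1_cs.
  (* The sum of [dn] runs to [j = S n], one further than [Dco]; that term fails its guard because
     [1 <= m]. *)
  cbn [cs]. replace (Nat.ltb (S n * m) (S n)) with false by (symmetry; apply Nat.ltb_ge; nia).
  rewrite Nat.mul_0_l, Nat.sub_0_r. cbn [Nat.leb]. rewrite bellco_0.
  unfold alphaco at 1.
  set (rest := cs n (fun j => if (S j * m <? S n)%nat then _ else _)).
  assert (E : cs n (fun i => if (S i * m <=? n)%nat then
      (alphaco m lam a (n - S i * m) * RtoC (bellco (alexp m (n - S i * m)) (S i)))%C else RtoC 0)
    = (RtoC (/ RGamma (INR (S n) / INR m)) * rest)%C).
  { unfold rest. rewrite <- cs_mult. apply cs_ext. intros j _.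
    destruct (Nat.leb_spec (S j * m) n) as [L|L];
    destruct (Nat.ltb_spec (S j * m) (S n)) as [L'|L']; try lia; [|ring].
    replace (S n - S j * m)%nat with (S (n - S j * m)) by lia.
    unfold alphaco, alexp. set (k := (n - S j * m)%nat). set (r := INR (S k) / INR m).
    assert (Hr : 0 < r) by (apply Rdiv_lt_0_compat; auto; apply lt_0_INR; lia).
    assert (Er : INR (S n) / INR m = r + INR (S j)).
    { unfold r. replace (S n) with (S k + S j * m)%nat by (unfold k; lia).
      rewrite plus_INR, mult_INR. field. lra. }
    rewrite Er. pose proof (d_rj_bellco r (S j) Hr ltac:(lia)) as ED.
    apply (f_equal RtoC) in ED. rewrite !RtoC_mult in ED.
    transitivity (alam m lam a (S k) * (RtoC (/ RGamma r) * RtoC (bellco (r - 1) (S j))))%C; [ring|].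
    rewrite <- ED. ring. }
  rewrite E. ring.
Qed.

(** * The Taylor coefficients of the Borel transform *)

Section Main.

Variables (m : nat) (a : nat -> C) (lam : R) (F : C -> C) (A B : R).
Hypothesis m_pos : (1 <= m)%nat.
Hypothesis lam_pos : 0 < lam.
Hypothesis F_per : forall w : C, F (Cplus w (0, 2 * PI * INR m)) = F w.
Hypothesis F_diff : forall w : C, Omega_star lam w -> @ex_derive C_AbsRing C_NormedModule F w.
Hypothesis F_series : exists r : R, 0 < r /\ forall w : C, Cmod (Cexp w) < r ->
  Omega_star lam w -> is_series (fun n => borel_term m a w (S n)) (F w).
Hypothesis A_pos : 0 < A.
Hypothesis B_pos : 0 < B.
Hypothesis F_bound : forall w : C, Omega_star lam w ->
  Cmod (F w * Cexp (RtoC ((INR m - 1) / INR m) * w))%C <= A * exp (B * Cmod (Cexp w)).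

Let H := Hfun m lam F.
Let h (x : R) : C := H (RtoC (ln x)).

Lemma INR_m_ge1 : 1 <= INR m.
Proof. replace 1 with (INR 1) by reflexivity. now apply le_INR. Qed.

Lemma exp_INR_ln (n : nat) (x : R) : 0 < x -> exp (INR n * ln x) = x ^ n.
Proof. intros Hx. rewrite <- Rpower_pow by exact Hx. reflexivity. Qed.

(** With [t = x ^ m] and [e = (n + 1) / m - 1], [zeta ^ e] splits into [lam ^ e], absorbed by
    [alam], then [t ^ e = x ^ (n + 1 - m)], completed to [x ^ n] by the factor [x ^ (m - 1)], and
    [psi e t]. *)
Lemma borel_term_psi (x : R) (n : nat) : 0 < x -> x ^ m <= / 2 ->
  (borel_term m a (RtoC (ln (lam * - ln (1 - x ^ m)))) (S n) * RtoC (exp ((INR m - 1) * ln x)))%C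
  = (alphaco m lam a n * RtoC (x ^ n * psi (alexp m n) (x ^ m)))%C.
Proof.
  intros Hx Ht. pose proof INR_m_ge1 as Hm. set (t := x ^ m) in *.
  assert (Ht0 : 0 < t) by now apply pow_lt.
  assert (HL : 0 < - ln (1 - t)).
  { assert (ln (1 - t) < ln 1) by (apply ln_increasing; lra). rewrite ln_1 in H0. lra. }
  set (e := alexp m n).
  assert (Hem : e * INR m = INR n + 1 - INR m).
  { unfold e, alexp. rewrite S_INR. field. lra. }
  assert (HG : 0 < RGamma (INR (S n) / INR m)).
  { apply RGamma_pos. apply Rdiv_lt_0_compat; [apply lt_0_INR; lia|lra]. }
  unfold borel_term, alphaco, alam. fold (alexp m n). fold e.
  rewrite <- RtoC_mult, Cexp_RtoC. unfold Rpower, psi.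
  assert (EY : 1 + Yfun t = - ln (1 - t) / t) by (unfold Yfun; ring).
  rewrite EY, <- (exp_INR_ln n x Hx).
  assert (Elt : ln t = INR m * ln x) by (unfold t; rewrite <- exp_INR_ln, ln_exp by exact Hx; reflexivity).
  assert (EE : exp (e * ln (lam * - ln (1 - t))) * exp ((INR m - 1) * ln x) =
    exp (e * ln lam) * (exp (INR n * ln x) * exp (e * ln (- ln (1 - t) / t)))).
  { rewrite <- !exp_plus. f_equal. unfold Rdiv. rewrite !ln_mult, ln_Rinv, Elt;
      try lra; try (now apply Rinv_0_lt_compat).
    replace ((INR m - 1) * ln x) with (INR n * ln x - (INR n + 1 - INR m) * ln x) by ring.
    rewrite <- Hem. ring. }
  apply (f_equal RtoC) in EE. rewrite !RtoC_mult in EE.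
  unfold Cdiv. rewrite <- RtoC_inv by lra.
  transitivity (a (S n) * RtoC (/ RGamma (INR (S n) / INR m)) *
    (RtoC (exp (e * ln (lam * - ln (1 - t)))) * RtoC (exp ((INR m - 1) * ln x))))%C; [ring|].
  rewrite EE, !RtoC_mult. ring.
Qed.

Lemma is_series_Cmult (c : C) (f : nat -> C) (l : C) :
  is_series (V := C_NormedModule) f l -> is_series (V := C_NormedModule) (fun n => f n * c)%C (l * c)%C.
Proof.
  intros Hs. pose proof (is_series_scal (V := C_NormedModule) c f l Hs) as K.
  unfold scal in K; simpl in K. unfold mult in K; simpl in K.
  rewrite (Cmult_comm l c). revert K. apply is_series_ext. intros n. apply Cmult_comm.
Qed.

Lemma h_expansion (N : nat) : cbigO N (fun x => h x - cpoly (fun n => dn m lam a (S n)) N x)%C.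
Proof.
  pose proof INR_m_ge1 as Hm.
  destruct F_series as [r [Hr Fs]].
  (* As [- ln (1 - t) <= 2 * t] for [t <= / 2], this radius keeps [zeta] where the Borel series
     converges. *)
  set (X := Rmin (/ 2) (r / (2 * lam))).
  assert (HX : 0 < X) by (apply Rmin_pos; [lra|apply Rdiv_lt_0_compat; lra]).
  assert (HX1 : X <= / 2) by apply Rmin_l.
  assert (HX2 : X <= r / (2 * lam)) by apply Rmin_r.
  assert (K : cbigO N (fun x => h x - cpoly (Dco m (alphaco m lam a) (alexp m)) N x)%C).
  { apply (psi_series_expansion m (alphaco m lam a) (alexp m) h X); auto.
    - intros n. unfold alexp. pose proof (pos_INR n). rewrite S_INR. split.
      + assert (0 <= (INR n + 1) / INR m) by (apply Rdiv_le_0_compat; lra). lra.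
      + assert ((INR n + 1) / INR m <= INR n + 1); [|lra]. apply Rle_div_l; [lra|]. nra.
    - intros x Hx.
      assert (Ht : 0 < x ^ m <= x).
      { split; [apply pow_lt; lra|]. destruct m as [|m']; [lia|]. simpl.
        assert (x ^ m' <= 1) by (rewrite <- (pow1 m'); apply pow_incr; lra). nra. }
      set (t := x ^ m) in *.
      assert (Hlx : ln x < 0) by (rewrite <- ln_1; apply ln_increasing; lra).
      assert (Emt : exp (INR m * ln x) = t) by (apply exp_INR_ln; lra).
      set (w := RtoC (ln (lam * - ln (1 - t)))).
      assert (Ew : wmap lam (RtoC (INR m * ln x)) = w).
      { unfold w. rewrite wmap_RtoC, Emt; auto. nra. }
      assert (HL : 0 < - ln (1 - t) <= 2 * t).
      { pose proof (log_taylor 0 t ltac:(lra)) as LT. simpl in LT.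
        rewrite Rminus_0_r, Rmult_1_r in LT. pose proof (Rle_abs (- ln (1 - t))).
        assert (ln (1 - t) < ln 1) by (apply ln_increasing; lra). rewrite ln_1 in *. lra. }
      assert (Hs : is_series (V := C_NormedModule) (fun n => borel_term m a w (S n)) (F w)).
      { apply Fs.
        - unfold w. rewrite Cexp_RtoC, exp_ln by (apply Rmult_lt_0_compat; lra).
          rewrite Cmod_R, Rabs_pos_eq by (apply Rmult_le_pos; lra).
          apply Rle_lt_trans with (lam * (2 * t)); [apply Rmult_le_compat_l; lra|].
          apply Rlt_le_trans with (lam * (2 * (r / (2 * lam)))); [|right; field; lra].
          apply Rmult_lt_compat_l; lra.
        - rewrite <- Ew. apply Omega_wmap; auto. simpl. nra. }
      assert (Eh : h x = (F w * RtoC (exp ((INR m - 1) * ln x)))%C).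
      { unfold h, H. rewrite Hfun_RtoC; auto. rewrite Emt. reflexivity. }
      rewrite Eh.
      apply (is_series_ext (V := C_NormedModule)
        (fun n => borel_term m a w (S n) * RtoC (exp ((INR m - 1) * ln x)))%C).
      + intros n. apply borel_term_psi; fold t; lra.
      + now apply is_series_Cmult. }
  revert K. apply (cbigO_ext N _ _ 1); [lra|]. intros x _.
  unfold cpoly. rewrite (cs_ext N (fun k => Dco m (alphaco m lam a) (alexp m) k * RtoC (x ^ k))%C
    (fun k => dn m lam a (S k) * RtoC (x ^ k))%C); [reflexivity|].
  intros k _. rewrite dn_Dco by exact m_pos. reflexivity.
Qed.

Lemma H_cdiff (w : C) : Re w < 0 -> cdiff H w.
Proof. intros Hw. apply (Hfun_cdiff m lam F); auto. Qed.

Lemma H_period (w : C) : H (Cplus w (0, 2 * PI)) = H w.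
Proof. now apply (Hfun_period m lam F). Qed.

(** For [Re w <= - ln 2] one has [Cmod t <= / 2], away from the singular point [t = 1]; this
    supplies the boundedness that [cauchy_expansion] requires at [tau = 0]. *)
Lemma H_bounded : exists M, forall w, Re w <= - ln 2 -> Cmod (H w) <= M.
Proof.
  pose proof INR_m_ge1 as Hm.
  assert (Hl2 : 0 < ln 2) by (rewrite <- ln_1; apply ln_increasing; lra).
  assert (Hb0 : 0 < lam * B) by now apply Rmult_lt_0_compat.
  destruct (Hfun_bound m lam A B F m_pos lam_pos A_pos B_pos F_bound (lam * B) (Rle_refl _))
    as [K [HK Bd]].
  exists (K * exp (lam * B * ln 2)). intros w Hw.
  eapply Rle_trans; [apply Bd; lra|]. apply Rmult_le_compat_l; [lra|].
  apply exp_le_le.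
  assert (Hc : / 2 <= Cmod (1 - Cexp (RtoC (INR m) * w))).
  { eapply Rle_trans; [|apply Cmod_sub_le]. rewrite Cmod_1, Cmod_Cexp.
    replace (Re (RtoC (INR m) * w)%C) with (INR m * Re w) by (destruct w; simpl; ring).
    assert (exp (INR m * Re w) <= exp (- ln 2)) by (apply exp_le_le; nra).
    rewrite exp_Ropp, exp_ln in H0 by lra. lra. }
  assert (Hln : - ln 2 <= ln (Cmod (1 - Cexp (RtoC (INR m) * w)))).
  { rewrite <- ln_Rinv by lra. apply ln_le; lra. }
  nra.
Qed.

Lemma H_series (x0 x1 : R) : x0 < x1 < 0 ->
  is_series (V := C_NormedModule) (fun n => cauchy_coef H x1 n * RtoC (exp (INR n * x0)))%C
    (H (RtoC x0)).
Proof.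
  intros Hx. destruct H_bounded as [M HM].
  apply (cauchy_expansion H x0 x1 (- ln 2) M); auto.
  - lra.
  - intros w Hw. apply H_cdiff. lra.
  - apply H_period.
Qed.

(** Both families are coefficients of an expansion of the same [h] at [0+]; independence of the
    radius comes as a by-product. *)
Lemma coef_dn (x1 : R) (n : nat) : x1 < 0 -> cauchy_coef H x1 n = dn m lam a (S n).
Proof.
  intros Hx. revert n.
  apply (expansion_unique h).
  - apply (power_series_expansion h (cauchy_coef H x1) (exp x1)); [apply exp_pos|].
    intros x Hxx.
    assert (Hl : ln x < x1) by (rewrite <- (ln_exp x1); apply ln_increasing; lra).
    apply (is_series_ext (V := C_NormedModule)
      (fun n => cauchy_coef H x1 n * RtoC (exp (INR n * ln x)))%C).
    + intros n. rewrite exp_INR_ln by lra. reflexivity.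
    + apply H_series. lra.
  - exact h_expansion.
Qed.

Lemma dn_growth (b : R) : lam * B <= b -> 1 < b -> exists K, 0 < K /\
  forall n, Cmod (dn m lam a (S n)) <= K * exp ((b - 1) * ln (INR n + 2)).
Proof.
  intros Hb1 Hb2.
  destruct (Hfun_bound m lam A B F m_pos lam_pos A_pos B_pos F_bound b Hb1) as [K [HK Bd]].
  apply (coef_growth m H K b (fun n => dn m lam a (S n))); auto.
  - intros w. apply H_cdiff.
  - intros x1 n. apply coef_dn.
Qed.

(** On the ray, [tau = (1 - exp (- zeta / lam)) ^ (1 / m)] stays in []0, 1[], so the Taylor series
    represents [F] on the whole half-line and not only near [0]. *)
Lemma F_real_series (zeta : R) : 0 < zeta ->
  is_series (V := C_NormedModule) (fun n => dn m lam a (S n) *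
    RtoC (exp (alexp m n * ln (1 - exp (- (/ lam * zeta))))))%C (F (RtoC (ln zeta))).
Proof.
  intros Hz. pose proof INR_m_ge1 as Hm.
  assert (Hu : 0 < / lam * zeta) by (apply Rmult_lt_0_compat; auto; now apply Rinv_0_lt_compat).
  destruct (one_sub_exp_bounds _ Hu) as [Hq _]. set (q := 1 - exp (- (/ lam * zeta))) in *.
  assert (Hlq : ln q < 0) by (rewrite <- ln_1; apply ln_increasing; lra).
  set (x0 := ln q / INR m).
  assert (Hx0m : INR m * x0 = ln q) by (unfold x0; field; lra).
  assert (Hx0 : x0 < 0) by nra.
  (* Any abscissa strictly between [x0] and [0] would do. *)
  pose proof (H_series x0 (x0 / 2) ltac:(lra)) as Hs.
  unfold H in Hs. rewrite Hfun_RtoC in Hs; auto.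
  rewrite Hx0m, exp_ln in Hs by lra.
  replace (lam * - ln (1 - q)) with zeta in Hs.
  2:{ unfold q. replace (1 - (1 - exp (- (/ lam * zeta)))) with (exp (- (/ lam * zeta))) by ring.
      rewrite ln_exp. field. lra. }
  apply (is_series_Cmult (RtoC (exp (- ((INR m - 1) * x0))))) in Hs.
  replace (F (RtoC (ln zeta)) * RtoC (exp ((INR m - 1) * x0))
    * RtoC (exp (- ((INR m - 1) * x0))))%C with (F (RtoC (ln zeta))) in Hs.
  2:{ rewrite <- Cmult_assoc, <- RtoC_mult, <- exp_plus, Rplus_opp_r, exp_0. ring. }
  revert Hs. apply is_series_ext. intros n. fold H. rewrite coef_dn by lra.
  rewrite <- Cmult_assoc, <- RtoC_mult, <- exp_plus. do 3 f_equal.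
  rewrite <- Hx0m. unfold alexp. rewrite S_INR. field. lra.
Qed.

Lemma Omega_real (zeta : R) : 0 < zeta -> Omega_star lam (RtoC (ln zeta)).
Proof.
  intros Hz. assert (Hu : 0 < / lam * zeta).
  { apply Rmult_lt_0_compat; auto. now apply Rinv_0_lt_compat. }
  destruct (one_sub_exp_bounds _ Hu) as [Hq _].
  split; [|apply Cexp_neq0]. rewrite Cexp_RtoC, exp_ln by exact Hz.
  exists (RtoC (exp (- (/ lam * zeta)))). split.
  - rewrite <- RtoC_minus, Cmod_R, Rabs_left; lra.
  - rewrite Cln_RtoC, ln_exp by apply exp_pos. rewrite <- RtoC_opp, <- RtoC_mult. f_equal.
    field. lra.
Qed.

(** * The Laplace integral and the exchange with the sum *)

Variable z : C.
Hypothesis z_large : Rmax B (/ lam) < Re z.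

Let fz (zeta : R) : C := (F (RtoC (ln zeta)) * Cexp (- (z * RtoC zeta)))%C.
Let wz : C := (RtoC lam * z)%C.
Let rn (n : nat) : R := INR (S n) / INR m.
(** The [n]-th term of the integrand: the power of [1 - exp (- zeta / lam)] and the factor
    [exp (- z * zeta)] combine into the Beta kernel at [u = zeta / lam]. *)
Let fn (n : nat) (zeta : R) : C := (dn m lam a (S n) * kb wz (rn n) (/ lam * zeta))%C.

Lemma Re_wz : Re wz = lam * Re z.
Proof. unfold wz. destruct z; simpl; ring. Qed.

Lemma sig_bounds : 1 < lam * Re z /\ lam * B < lam * Re z.
Proof.
  pose proof (Rmax_l B (/ lam)). pose proof (Rmax_r B (/ lam)).
  split; [|apply Rmult_lt_compat_l; lra].
  apply Rle_lt_trans with (lam * / lam); [right; field; lra|]. apply Rmult_lt_compat_l; lra.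
Qed.

Lemma rn_pos (n : nat) : 0 < rn n.
Proof. pose proof INR_m_ge1. apply Rdiv_lt_0_compat; [apply lt_0_INR; lia|lra]. Qed.

(** The substitution [zeta = lam * u] produces the factor [lam]; the rest is [beta_gamma], divided
    by a nonzero Gamma value. *)
Lemma cimp_fn (n : nat) : cimp (fn n) (fact_term m lam a z (S n)).
Proof.
  pose proof sig_bounds as [Hs _]. pose proof (rn_pos n) as Hr.
  assert (Hw : 1 <= Re wz) by (rewrite Re_wz; lra).
  pose proof (cimp_kb wz (rn n) Hw Hr) as K.
  apply (imp_scale (V := CV) (/ lam)) in K; [|now apply Rinv_0_lt_compat].
  apply (cimp_mult (dn m lam a (S n))) in K.
  match type of K with cimp _ ?l => replace (fact_term m lam a z (S n)) with l end; [exact K|].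
  assert (Hw2 : 0 < Re (wz + RtoC (rn n))%C) by (destruct wz; simpl in *; lra).
  pose proof (CGamma_neq0 _ Hw2) as Hn.
  pose proof (beta_gamma wz (rn n) Hw Hr) as E.
  assert (Es : scal (/ / lam) (CBeta wz (rn n)) = (RtoC lam * CBeta wz (rn n))%C).
  { rewrite Rinv_inv. destruct (CBeta wz (rn n)) as [b1 b2].
    apply Ceq; [change (lam * b1 = lam * b1 - 0 * b2)|change (lam * b2 = lam * b2 + 0 * b1)]; ring. }
  assert (EB : CBeta wz (rn n) = (CGamma wz * RtoC (RGamma (rn n)) / CGamma (wz + RtoC (rn n)))%C).
  { rewrite <- E. field. exact Hn. }
  transitivity (dn m lam a (S n) * (RtoC lam * CBeta wz (rn n)))%C; [f_equal; exact Es|].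
  rewrite EB. unfold fact_term. fold wz. fold (rn n). field. exact Hn.
Qed.

Lemma kb_expand (n : nat) (zeta : R) :
  kb wz (rn n) (/ lam * zeta) =
  (RtoC (exp (alexp m n * ln (1 - exp (- (/ lam * zeta))))) * Cexp (- (z * RtoC zeta)))%C.
Proof.
  unfold kb. rewrite <- Cexp_RtoC, <- Cexp_plus. f_equal. unfold wz, alexp. fold (rn n).
  apply Ceq; destruct z; simpl; field; lra.
Qed.

Lemma fz_series (zeta : R) : 0 < zeta ->
  is_series (V := C_NormedModule) (fun n => fn n zeta) (fz zeta).
Proof.
  intros Hz. pose proof (is_series_Cmult (Cexp (- (z * RtoC zeta))) _ _ (F_real_series zeta Hz)) as K.
  revert K. apply is_series_ext. intros n. unfold fn. rewrite kb_expand. cring.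
Qed.

Lemma fz_cont (zeta : R) : 0 < zeta -> rcont fz zeta.
Proof.
  intros Hz. unfold fz. apply rcont_mult.
  - apply (rcont_comp F (fun t => RtoC (ln t))).
    + apply rcont_RtoC. now apply continuous_ln.
    + apply cdiff_ccont, cdiff_of_ex_derive, F_diff. now apply Omega_real.
  - apply (rcont_comp Cexp (fun t => - (z * RtoC t))%C); [|apply cdiff_ccont, cdiff_Cexp].
    apply (rcont_ext (fun t => (- z) * RtoC t)%C); [intros; ring|].
    apply rcont_mult; [apply rcont_const|]. apply rcont_RtoC, continuous_id.
Qed.

(* With [v = exp (- u)] and [y = (n + 2) v / m], this is the boundedness of [y^s exp (- y)]. *)
Lemma power_peak (s : R) : 0 < s -> exists C0, 0 < C0 /\ forall n u, 0 < u ->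
  exp (INR n / INR m * ln (1 - exp (- u)) - s * u) <= C0 * exp (- (s * ln (INR n + 2))).
Proof.
  intros Hs. pose proof INR_m_ge1 as Hm.
  destruct (pow_exp_bound s) as [K [HK Bd]].
  exists (exp 2 * (exp (s * ln (INR m)) * K)).
  pose proof (exp_pos 2) as He2. pose proof (exp_pos (s * ln (INR m))) as Hem.
  split. { apply Rmult_lt_0_compat; auto. now apply Rmult_lt_0_compat. }
  intros n u Hu. destruct (one_sub_exp_bounds u Hu) as [Hq _]. pose proof (pos_INR n) as Hn.
  set (v := exp (- u)) in *.
  assert (Hv : 0 < v < 1) by (split; [apply exp_pos|lra]).
  set (y := (INR n + 2) * v / INR m).
  assert (Hy : 0 < y) by (apply Rdiv_lt_0_compat; [apply Rmult_lt_0_compat|]; lra).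
  assert (Hlq : ln (1 - v) <= - v).
  { rewrite <- (ln_exp (- v)). apply ln_le; [lra|]. pose proof (exp_ineq1_le (- v)). lra. }
  assert (Hnm : 0 <= INR n / INR m) by (apply Rdiv_le_0_compat; lra).
  assert (H1 : INR n / INR m * ln (1 - v) <= - y + 2).
  { apply Rle_trans with (INR n / INR m * - v); [apply Rmult_le_compat_l; auto|].
    assert (E : y = INR n / INR m * v + 2 * v / INR m) by (unfold y; field; lra).
    assert (2 * v / INR m <= 2) by (apply Rle_div_l; nra). rewrite E. lra. }
  assert (Hlv : ln v = - u) by (unfold v; apply ln_exp).
  assert (Hly : ln y = ln (INR n + 2) - u - ln (INR m)).
  { unfold y, Rdiv. rewrite !ln_mult, ln_Rinv, Hlv; try lra.
    - apply Rmult_lt_0_compat; lra.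
    - apply Rinv_0_lt_compat; lra. }
  specialize (Bd y Hy).
  assert (B2 : exp (s * ln y) <= K * exp y).
  { eapply Rle_trans; [|exact Bd]. apply exp_le_le, Rmult_le_compat_l; [lra|].
    left; apply ln_increasing; lra. }
  replace (exp 2 * (exp (s * ln (INR m)) * K) * exp (- (s * ln (INR n + 2)))) with
    (exp (2 + s * ln (INR m) - s * ln (INR n + 2)) * K)
    by (unfold Rminus; rewrite !exp_plus; ring).
  apply Rle_trans with (exp (2 - y - s * u)).
  - apply exp_le_le. lra.
  - apply Rle_trans with (exp (2 + s * ln (INR m) - s * ln (INR n + 2) - y) * exp (s * ln y)).
    + rewrite <- exp_plus. apply exp_le_le. rewrite Hly. lra.
    + apply Rle_trans with (exp (2 + s * ln (INR m) - s * ln (INR n + 2) - y) * (K * exp y)).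
      * apply Rmult_le_compat_l; auto. left; apply exp_pos.
      * right. unfold Rminus at 1. rewrite exp_plus, exp_Ropp. pose proof (exp_pos y). field. lra.
Qed.

(** [(n + 1) ^ (- e)]: its differences majorise [e * (n + 2) ^ (- 1 - e)], so summability and
    explicit tails both come from telescoping. *)
Definition Eseq (e : R) (n : nat) : R := exp (- (e * ln (INR n + 1))).

Lemma Eseq_telescope (e : R) (n : nat) : 0 < e ->
  exp (- ((1 + e) * ln (INR n + 2))) <= / e * (Eseq e n - Eseq e (S n)).
Proof.
  intros He. pose proof (pos_INR n) as Hn. unfold Eseq. rewrite S_INR.
  replace (INR n + 1 + 1) with (INR n + 2) by ring.
  set (l2 := ln (INR n + 2)). set (l1 := ln (INR n + 1)).
  assert (Hd : / (INR n + 2) <= l2 - l1).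
  { assert (L : ln ((INR n + 1) * / (INR n + 2)) <= - / (INR n + 2)).
    { rewrite <- (ln_exp (- / (INR n + 2))). apply ln_le.
      - apply Rmult_lt_0_compat; [lra|apply Rinv_0_lt_compat; lra].
      - pose proof (exp_ineq1_le (- / (INR n + 2))).
        replace ((INR n + 1) * / (INR n + 2)) with (1 + - / (INR n + 2)) by (field; lra). lra. }
    rewrite ln_mult, ln_Rinv in L; try lra; [|apply Rinv_0_lt_compat; lra].
    unfold l1, l2. lra. }
  replace (exp (- (e * l1))) with (exp (- (e * l2)) * exp (e * (l2 - l1)))
    by (rewrite <- exp_plus; f_equal; ring).
  replace (- ((1 + e) * l2)) with (- (e * l2) + - l2) by ring.
  rewrite exp_plus, (exp_Ropp l2). unfold l2 at 2. rewrite exp_ln by lra.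
  pose proof (exp_ineq1_le (e * (l2 - l1))) as G. pose proof (exp_pos (- (e * l2))) as P.
  replace (/ e * (exp (- (e * l2)) * exp (e * (l2 - l1)) - exp (- (e * l2)))) with
    (exp (- (e * l2)) * (/ e * (exp (e * (l2 - l1)) - 1))) by ring.
  apply Rmult_le_compat_l; [lra|].
  apply Rmult_le_reg_l with e; auto. rewrite <- Rmult_assoc, Rinv_r by lra. nra.
Qed.

Lemma Eseq_lim (e eps : R) : 0 < e -> 0 < eps ->
  exists N, forall n, (N <= n)%nat -> Eseq e n < eps.
Proof.
  intros He Hp. destruct (pow_small e eps He Hp) as [d [Hd K]].
  destruct (INR_unbounded (/ d)) as [N HN]. exists N. intros n Hn. unfold Eseq.
  apply le_INR in Hn. pose proof (pos_INR n) as Hn0.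
  replace (- (e * ln (INR n + 1))) with (e * ln (/ (INR n + 1))) by (rewrite ln_Rinv by lra; ring).
  apply K. split; [apply Rinv_0_lt_compat; lra|].
  rewrite <- (Rinv_inv d). apply Rinv_lt_contravar; [|lra].
  apply Rmult_lt_0_compat; [now apply Rinv_0_lt_compat|lra].
Qed.

Lemma series_telescope_tail (f : nat -> C) (l : C) (c : R) (E : nat -> R) (N : nat) :
  is_series (V := C_NormedModule) f l -> 0 <= c -> (forall n, 0 <= E n) ->
  (forall n, Cmod (f n) <= c * (E n - E (S n))) -> Cmod (l - cs N f) <= c * E N.
Proof.
  intros Hs Hc HE Hf.
  assert (Hk : forall k, Cmod (cs (N + k) f - cs N f) <= c * (E N - E (N + k)%nat)).
  { induction k as [|k IH].
    - rewrite Nat.add_0_r. replace (cs N f - cs N f)%C with (RtoC 0) by ring.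
      rewrite Cmod_0. lra.
    - rewrite Nat.add_succ_r. simpl cs.
      replace (cs (N + k) f + f (N + k)%nat - cs N f)%C with
        ((cs (N + k) f - cs N f) + f (N + k)%nat)%C by ring.
      eapply Rle_trans; [apply Cmod_triangle|]. specialize (Hf (N + k)%nat). lra. }
  apply Rnot_lt_le. intros Hlt. set (e := Cmod (l - cs N f) - c * E N).
  assert (He : 0 < e) by (unfold e; lra).
  destruct (proj1 (is_series_C_eps f l) Hs e He) as [N0 HN0].
  specialize (HN0 (N + N0)%nat ltac:(lia)). rewrite cs_sum_n in HN0.
  replace (S (N + N0)) with (N + S N0)%nat in HN0 by lia.
  specialize (Hk (S N0)). specialize (HE (N + S N0)%nat).
  pose proof (Cmod_triangle (l - cs (N + S N0) f) (cs (N + S N0) f - cs N f)) as T.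
  replace (l - cs (N + S N0) f + (cs (N + S N0) f - cs N f))%C with (l - cs N f)%C in T by ring.
  rewrite (Cmod_sub_sym l (cs (N + S N0) f)) in T. unfold e in *. nra.
Qed.

Lemma cimp_cs (N : nat) (f : nat -> R -> C) (l : nat -> C) :
  (forall n, cimp (f n) (l n)) -> (1 <= N)%nat -> cimp (fun t => cs N (fun n => f n t)) (cs N l).
Proof.
  intros Hf HN. induction HN as [|N HN IH].
  - apply (imp_ext (V := CV) (f 0%nat)); [intros; simpl; cring|].
    replace (cs 1 l) with (l 0%nat) by (simpl; ring). apply Hf.
  - simpl. apply cimp_plus; auto.
Qed.

(** With [b] strictly between [max (lam * B) 1] and [sig = lam * Re z], split [exp (- sig * u)] into
    [exp (- s * u)] and [exp (- ep * u)]. The first, together with [(1 - exp (- u)) ^ (n / m)], is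
    at most of order [(n + 2) ^ (- s)], which reduces the coefficient growth [(n + 2) ^ (b - 1)] to
    the summable [(n + 2) ^ (- 1 - e)]. The second, together with [(1 - exp (- u)) ^ (1 / m - 1)],
    is integrable and free of [n]. *)
Lemma fn_dominated : exists (c e k : R) (g : R -> R),
  0 < c /\ 0 < e /\ rimp g k /\ (forall t, 0 < t -> 0 <= g t) /\
  forall n t, 0 < t -> Cmod (fn n t) <= c * (Eseq e n - Eseq e (S n)) * g t.
Proof.
  pose proof INR_m_ge1 as Hm. destruct sig_bounds as [S1 S2]. set (sig := lam * Re z) in *.
  set (b := (Rmax (lam * B) 1 + sig) / 2).
  assert (Hmx : Rmax (lam * B) 1 < sig) by (apply Rmax_lub_lt; lra).
  pose proof (Rmax_l (lam * B) 1). pose proof (Rmax_r (lam * B) 1).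
  assert (Hb1 : lam * B <= b) by (unfold b; lra).
  assert (Hb2 : 1 < b) by (unfold b; lra).
  assert (Hb3 : b < sig) by (unfold b; lra).
  destruct (dn_growth b Hb1 Hb2) as [K [HK Bd]].
  (* [ep <= (sig - b) / 2] leaves [e] positive. [ep <= 1] gives
     [1 - exp (- ep * u) <= 1 - exp (- u)], so the singular factor, whose exponent is at most zero,
     is majorised by its value at [ep * u], and the majorant is a rescaled [bker 1 kap]. *)
  set (ep := Rmin 1 ((sig - b) / 2)).
  assert (Hep : 0 < ep) by (apply Rmin_pos; lra).
  assert (Hep1 : ep <= 1) by apply Rmin_l.
  assert (Hep2 : ep <= (sig - b) / 2) by apply Rmin_r.
  set (s := sig - ep). set (e := s - b).
  assert (He : 0 < e) by (unfold e, s; lra). assert (Hs : 0 < s) by (unfold s; lra).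
  destruct (power_peak s Hs) as [C0 [HC0 Pk]].
  set (kap := / INR m). assert (Hkap : 0 < kap <= 1).
  { unfold kap. split; [apply Rinv_0_lt_compat; lra|]. rewrite <- Rinv_1.
    apply Rinv_le_contravar; lra. }
  assert (Hel : 0 < ep * / lam) by (apply Rmult_lt_0_compat; auto; now apply Rinv_0_lt_compat).
  set (g := fun t => bker 1 kap (ep * / lam * t)).
  exists (K * C0 * / e), e, (/ (ep * / lam) * / kap), g.
  split. { apply Rmult_lt_0_compat; [now apply Rmult_lt_0_compat|now apply Rinv_0_lt_compat]. }
  split; [exact He|]. split.
  { apply (imp_scale (V := R_CompleteNormedModule) (ep * / lam) (bker 1 kap) (/ kap) Hel).
    apply rimp_bker_1. lra. }
  split; [intros; left; apply exp_pos|].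
  intros n t Ht. set (u := / lam * t).
  assert (Hu : 0 < u) by (apply Rmult_lt_0_compat; auto; now apply Rinv_0_lt_compat).
  destruct (one_sub_exp_bounds u Hu) as [Hq _].
  assert (Heu : 0 < ep * u) by now apply Rmult_lt_0_compat.
  destruct (one_sub_exp_bounds (ep * u) Heu) as [Hqe _].
  unfold fn. rewrite Cmod_mult, Cmod_kb, Re_wz. fold u. fold sig.
  assert (Eb : bker sig (rn n) u = exp (INR n / INR m * ln (1 - exp (- u)) - s * u)
    * exp ((kap - 1) * ln (1 - exp (- u)) - ep * u)).
  { unfold bker. rewrite <- exp_plus. f_equal. unfold rn, s, kap. rewrite S_INR. field. lra. }
  assert (Hg : exp ((kap - 1) * ln (1 - exp (- u)) - ep * u) <= g t).
  { unfold g, bker. replace (ep * / lam * t) with (ep * u) by (unfold u; ring).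
    apply exp_le_le. rewrite Rmult_1_l.
    assert (ln (1 - exp (- (ep * u))) <= ln (1 - exp (- u))).
    { apply ln_le; [lra|]. assert (exp (- u) <= exp (- (ep * u))) by (apply exp_le_le; nra). lra. }
    nra. }
  rewrite Eb. specialize (Pk n u Hu). specialize (Bd n).
  pose proof (Eseq_telescope e n He) as Te.
  assert (Hgt : 0 < g t) by apply exp_pos.
  pose proof (Cmod_ge_0 (dn m lam a (S n))) as P0.
  pose proof (exp_pos ((b - 1) * ln (INR n + 2))) as P1.
  pose proof (exp_pos (- (s * ln (INR n + 2)))) as P2.
  apply Rle_trans with (K * exp ((b - 1) * ln (INR n + 2)) *
    (C0 * exp (- (s * ln (INR n + 2))) * g t)).
  - apply Rmult_le_compat; auto.
    + apply Rmult_le_pos; left; apply exp_pos.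
    + apply Rmult_le_compat; auto; left; apply exp_pos.
  - replace (K * exp ((b - 1) * ln (INR n + 2)) * (C0 * exp (- (s * ln (INR n + 2))) * g t)) with
      (K * C0 * exp (- ((1 + e) * ln (INR n + 2))) * g t).
    + apply Rmult_le_compat_r; [lra|]. rewrite !Rmult_assoc.
      apply Rmult_le_compat_l; [lra|]. apply Rmult_le_compat_l; [lra|auto].
    + replace (- ((1 + e) * ln (INR n + 2))) with
        ((b - 1) * ln (INR n + 2) + - (s * ln (INR n + 2))) by (unfold e; ring).
      rewrite exp_plus. ring.
Qed.

Lemma factorial_series :
  ex_series (fun n => Cmod (fact_term m lam a z (S n))) /\
  exists I : C, cimp fz I /\
    is_series (V := C_NormedModule) (fun n => fact_term m lam a z (S n)) I.
Proof.
  destruct fn_dominated as [c [e [k [g [Hc [He [Hg [Hg0 Bd]]]]]]]].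
  set (E := Eseq e). assert (HE : forall n, 0 <= E n) by (intros; left; apply exp_pos).
  assert (Hk : 0 <= k).
  { eapply Rle_trans; [apply Cmod_ge_0|].
    apply (cimp_le (fun _ => RtoC 0) (RtoC 0) g k); auto.
    - pose proof (cimp_mult 0 _ _ (cimp_fn 0)) as K.
      replace (RtoC 0 * fact_term m lam a z 1)%C with (RtoC 0) in K by ring.
      revert K. apply (imp_ext (V := CV)). intros; cring.
    - intros t Ht. rewrite Cmod_0. now apply Hg0. }
  assert (Hdiff : forall n, 0 <= E n - E (S n)).
  { intros n. pose proof (Eseq_telescope e n He) as T.
    pose proof (exp_pos (- ((1 + e) * ln (INR n + 2)))) as P.
    apply Rmult_le_reg_l with (/ e); [now apply Rinv_0_lt_compat|]. rewrite Rmult_0_r.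
    unfold E. lra. }
  assert (Bt : forall n, Cmod (fact_term m lam a z (S n)) <= c * k * (E n - E (S n))).
  { intros n. apply Rle_trans with (c * (E n - E (S n)) * k); [|right; ring].
    apply (cimp_le (fn n) _ (fun t => c * (E n - E (S n)) * g t) _ (cimp_fn n)).
    - now apply rimp_scal.
    - intros t Ht. now apply Bd. }
  split.
  - apply (ex_series_le (K := R_AbsRing) (V := R_CompleteNormedModule) _
      (fun n => c * k * (E n - E (S n)))).
    + intros n. unfold norm; simpl; unfold abs; simpl.
      rewrite Rabs_pos_eq by apply Cmod_ge_0. apply Bt.
    + exists (c * k * E 0%nat). apply (is_series_scal (K := R_AbsRing) (V := R_NormedModule) (c * k)).
      apply filterlim_locally. intros eps.
      destruct (Eseq_lim e eps He (cond_pos eps)) as [N HN]. exists N. intros n Hn.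
      assert (ES : sum_n (fun n => E n - E (S n)) n = E 0%nat - E (S n)).
      { clear. induction n as [|n IH]; [rewrite sum_O; reflexivity|].
        rewrite sum_Sn, IH. unfold plus; simpl. ring. }
      change (Rabs (sum_n (fun n => E n - E (S n)) n - E 0%nat) < eps). rewrite ES.
      replace (E 0%nat - E (S n) - E 0%nat) with (- E (S n)) by ring.
      rewrite Rabs_Ropp, Rabs_pos_eq by apply HE. apply HN. lia.
  (* The bound separates [N] from [t], so a single integral of [g] controls the error of every
     partial sum after integration. *)
  - assert (Tail : forall N t, 0 < t -> Cmod (fz t - cs N (fun n => fn n t)) <= c * E N * g t).
    { intros N t Ht. replace (c * E N * g t) with (c * g t * E N) by ring.
      apply series_telescope_tail; auto.
      - now apply fz_series.
      - apply Rmult_le_pos; [lra|auto].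
      - intros n. eapply Rle_trans; [now apply Bd|]. right. unfold E. ring. }
    destruct (cimp_dominated fz (fun t => c * E 0%nat * g t) (c * E 0%nat * k)) as [I HI].
    + intros t Ht. now apply fz_cont.
    + intros t Ht. specialize (Tail 0%nat t Ht). simpl in Tail.
      replace (fz t) with (fz t - 0)%C by ring. exact Tail.
    + now apply rimp_scal.
    + exists I. split; [exact HI|]. apply is_series_C_eps. intros eps Hep.
      assert (Hp : 0 < eps / (c * k + 1)).
      { apply Rdiv_lt_0_compat; auto. assert (0 <= c * k) by (apply Rmult_le_pos; lra). lra. }
      destruct (Eseq_lim e _ He Hp) as [N HN]. exists N. intros n Hn. rewrite cs_sum_n.
      rewrite Cmod_sub_sym.
      assert (B1 : Cmod (I - cs (S n) (fun n => fact_term m lam a z (S n))) <= c * E (S n) * k).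
      { apply (cimp_le (fun t => fz t - cs (S n) (fun n => fn n t))%C _
          (fun t => c * E (S n) * g t)).
        - apply cimp_minus; auto. apply (cimp_cs (S n) fn); [apply cimp_fn|lia].
        - now apply rimp_scal.
        - intros t Ht. now apply Tail. }
      eapply Rle_lt_trans; [exact B1|]. specialize (HN (S n) ltac:(lia)). fold E in HN.
      assert (Hck : 0 <= c * k) by (apply Rmult_le_pos; lra).
      apply Rle_lt_trans with (E (S n) * (c * k + 1)); [specialize (HE (S n)); nra|].
      apply Rmult_lt_compat_r with (r := c * k + 1) in HN; [|lra].
      replace (eps / (c * k + 1) * (c * k + 1)) with eps in HN by (field; lra). exact HN.
Qed.

End Main.

Theorem theorem5p6 (m : nat) (a : nat -> C) (lam : R) (F : C -> C) (A B : R) :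
  (1 <= m)%nat ->
  Gevrey1 m a ->
  0 < lam ->
  (* F is the analytic continuation of the Borel transform to Omega_lam^* *)
  (forall w : C, F (Cplus w (0, 2 * PI * INR m)) = F w) ->
  (forall w : C, Omega_star lam w -> @ex_derive C_AbsRing C_NormedModule F w) ->
  (exists r : R, 0 < r /\
     forall w : C, Cmod (Cexp w) < r -> Omega_star lam w ->
       is_series (fun n => borel_term m a w (S n)) (F w)) ->
  0 < A -> 0 < B ->
  (forall w : C, Omega_star lam w ->
     Cmod (F w * Cexp (RtoC ((INR m - 1) / INR m) * w))%C
       <= A * exp (B * Cmod (Cexp w))) ->
  forall z : C, Rmax B (/ lam) < Re z ->
    ex_series (fun n => Cmod (fact_term m lam a z (S n))) /\
    exists I L : C,
      is_RInt_gen (fun t : R => (F (RtoC (ln t)) * Cexp (- (z * RtoC t)))%C)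
                  (at_right 0) (Rbar_locally p_infty) I /\
      is_series (fun n => fact_term m lam a z (S n)) L /\
      (a 0%nat + L = a 0%nat + I)%C.
Proof.
  intros Hm _ Hlam Fper Fdiff Fser HA HB Fbd z Hz.
  destruct (factorial_series m a lam F A B Hm Hlam Fper Fdiff Fser HA HB Fbd z Hz)
    as [Hex [I [HI HL]]].
  split; [exact Hex|]. exists I, I. split; [|split].
  - exact (imp_is_RInt_gen (V := CV) _ _ HI).
  - exact HL.
  - reflexivity.
Qed.
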